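(* Let $F$ be a real Hilbert space with inner product $\langle\cdot,\cdot\rangle_F$, and let $E\subset F$ be a dense linear subspace which is itself a Hilbert space (with a different inner product) such that the inclusion $E\hookrightarrow F$ is compact. Let $\mathfrak{R}$ be any real number. Then the equalities $(\mathrm{im}\,T)^{\perp_F}=\ker T$ give rise to a canonical orientation of the restrictions $$\det|_{\mathcal{F}_s^{>\mathfrak{R}}(E,F)}\quad\text{and}\quad \det|_{\mathcal{F}_s^{<\mathfrak{R}}(E,F)}$$ of the determinant line bundle $\det\to\mathcal{F}(E,F)$ to the subspaces of index zero symmetric Fredholm operators with spectrum bounded from below by $\mathfrak{R}$, respectively from above by $\mathfrak{R}$.
   Context: $\mathcal{F}(E,F)$ is the space of Fredholm operators $E\to F$ (bounded from the Hilbert space $E$ to $F$). $\mathcal{F}_s(E,F)$ is the subspace of those $T$ that are of index zero and symmetric, i.e. $\langle Tx,y\rangle_F=\langle x,Ty\rangle_F$ for all $x,y\in E$ (equivalently, the Fredholm operators that are self-adjoint as unbounded operators on $F$ with domain $E$). For such $T$ one has $(\mathrm{im}\,T)^{\perp_F}=\ker T$, where $\perp_F$ denotes the orthogonal complement in $F$, and the spectrum $\sigma(T)\subset\mathbb{R}$ (of $T$ as unbounded operator on $F$ with domain $E$) is discrete and consists only of eigenvalues of finite multiplicity. Set $$\mathcal{F}_s^{>\mathfrak{R}}(E,F)=\{T\in\mathcal{F}_s(E,F)\mid\sigma(T)\subset(\mathfrak{R},\infty)\},\qquad \mathcal{F}_s^{<\mathfrak{R}}(E,F)=\{T\in\mathcal{F}_s(E,F)\mid\sigma(T)\subset(-\infty,\mathfrak{R})\}.$$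 Determinant line bundle: for Banach spaces $X,Y$ let $\mathcal{F}(X,Y)$ be the space of Fredholm operators $X\to Y$. For $D\in\mathcal{F}(X,Y)$ with adjoint $D^*$ on the dual spaces, $\det(D)=\Lambda^{\max}(\ker D^* )\otimes\Lambda^{\max}(\ker D)$. These lines form a real line bundle $\det\to\mathcal{F}(X,Y)$ whose bundle structure is as follows. Over surjective operators, $\det$ is the top exterior power of the kernel bundle. Given $T\in\mathcal{F}(X,Y)$, $N=\dim\mathrm{coker}\,T$, and an isomorphism $\Phi$ from $\mathbb{R}^N$ onto a direct complement of $\mathrm{im}\,T$ in $Y$, the operator $D\oplus\Phi:X\oplus\mathbb{R}^N\to Y$, $(x,\zeta)\mapsto Dx+\Phi\zeta$, is surjective for $D$ in a neighbourhood of $T$. For such $D$ with $k=\dim\ker D$, $l=\dim\mathrm{coker}\,D$, let $x_1,\dots,x_k$ be a basis of $\ker D$, $y_1^*,\dots,y_l^*$ a basis of $\ker D^*$, and choose a basis $\zeta_1,\dots,\zeta_N$ of $\mathbb{R}^N$ and $\xi_{l+1},\dots,\xi_N\in X$ with $D\xi_j+\Phi\zeta_j=0$ for $j=l+1,\dots,N$. The map $\iota_\Phi(D,\cdot):\det(D)\to\Lambda^{\max}\ker(D\oplus\Phi)$ sends $(y_l^*\wedge\dots\wedge y_1^* )\otimes(x_1\wedge\dots\wedge x_k)$ to $$(-1)^{kl}\frac{\det(\langle y_j^*,\Phi\zeta_i\rangle)_{i,j=1,\dots,l}}{\det(\zeta_1,\dots,\zeta_N)}(x_1,0)\wedge\dots\wedge(x_k,0)\wedge(\xi_{l+1},\zeta_{l+1})\wedge\dots\wedge(\xi_N,\zeta_N),$$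 and the bundle structure is the one for which all $\iota_\Phi$ are line bundle isomorphisms onto the top exterior power of the kernel bundle of $D\oplus\Phi$. For $T\in\mathcal{F}_s(E,F)$, identifying $F$ with its dual by the inner product, $\ker T^*$ becomes $(\mathrm{im}\,T)^{\perp_F}=\ker T$, so $\det(T)=\Lambda^{\max}(\ker T)\otimes\Lambda^{\max}(\ker T)$. An orientation of a real line bundle is a continuous choice of orientations of its fibres. *)

(* Defs.v *)
(* MathComp / MathComp-Analysis *)
From HB Require Import structures.
From mathcomp Require Export all_boot all_order all_algebra.
From mathcomp Require Export all_classical all_reals all_analysis.
Export Order.TTheory GRing.Theory Num.Theory.
Export numFieldNormedType.Exports.
Set Implicit Arguments.
Unset Strict Implicit.
Unset Printing Implicit Defensive.
Local Open Scope classical_set_scope.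
Local Open Scope ring_scope.

Section LinearAlgebra.
Context {R : realType}.

Definition ker {X Y : lmodType R} (f : X -> Y) : set X := [set x | f x = 0].

Definition lincomb {X : lmodType R} (c : nat -> R) (s : seq X) : X :=
  \sum_(i < size s) c i *: s`_i.

(* Subspaces are sets of vectors.  An ordered finite basis of V exists only if
   V is a finite-dimensional subspace; its length is then dim V. *)
Definition basis {X : lmodType R} (V : set X) (s : seq X) : Prop :=
  (forall v, V v <-> exists c, v = lincomb c s) /\
  (forall c, lincomb c s = 0 -> forall i, (i < size s)%N -> c i = 0).

Definition lin_span {X : lmodType R} (A : set X) : set X :=
  [set v | exists (s : seq X) (c : nat -> R),
     (forall i, (i < size s)%N -> A s`_i) /\ v = lincomb c s].

(* One function on lists of vectors encodes a family (alpha_n), one alternating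
   n-linear form for each n: alpha_n is the restriction to lists of length n. *)
Record altform (X : lmodType R) := AltForm {
  altform_fun :> seq X -> R;
  altform_linear : forall s t a u v,
    altform_fun (s ++ (a *: u + v) :: t) =
    a * altform_fun (s ++ u :: t) + altform_fun (s ++ v :: t);
  altform_alt : forall s t r u, altform_fun (s ++ u :: t ++ u :: r) = 0 }.

(* The exterior algebra of X embeds into the functions on alternating forms:
   v_1 /\ ... /\ v_n is evaluation of forms at (v_1, ..., v_n). *)
Definition exterior (X : lmodType R) := altform X -> R^o.

Definition wedge {X : lmodType R} (s : seq X) : exterior X := fun alpha => alpha s.

Definition top_exterior {X : lmodType R} (V : set X) : set (exterior X) :=
  [set w | exists s c, basis V s /\ w = c *: wedge s].

(* The tensor product of function spaces is realised inside the functions of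
   two variables. *)
Definition ext_tensor (Z X : lmodType R) := altform Z * altform X -> R^o.

Definition tensor {Z X : lmodType R} (a : exterior Z) (b : exterior X) :
    ext_tensor Z X :=
  fun p => a p.1 * b p.2.

(* Tensor product of two lines, where every tensor is pure. *)
Definition tensor_line {Z X : lmodType R}
    (L : set (exterior Z)) (M : set (exterior X)) : set (ext_tensor Z X) :=
  [set w | exists a b, [/\ L a, M b & w = tensor a b]].

(* An orientation of a line is given by its open half-line of positive vectors. *)
Definition line_orientation {V : lmodType R} (L o : set V) : Prop :=
  exists w : V, [/\ w <> 0,
    L = [set v | exists c, v = c *: w] &
    o = [set v | exists2 c, 0 < c & v = c *: w]].

End LinearAlgebra.

Section DeterminantLineBundle.
Context {R : realType} {X Y : completeNormedModType R}.
Implicit Types D T : {linear X -> Y}.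

(* Phi is an isomorphism from R^N onto a direct complement of im T; hence
   N = dim coker T. *)
Definition coker_iso T N (Phi : {linear 'rV[R]_N -> Y}) : Prop :=
  [/\ injective Phi,
      (forall y, exists x z, y = T x + Phi z) &
      (forall x z, T x = Phi z -> Phi z = 0)].

Definition fredholm T : Prop :=
  [/\ continuous T, (exists xs, basis (ker T) xs) &
      exists N (Phi : {linear 'rV[R]_N -> Y}), coker_iso T Phi].

Definition index_zero T : Prop :=
  exists xs N (Phi : {linear 'rV[R]_N -> Y}),
    [/\ basis (ker T) xs, coker_iso T Phi & size xs = N].

(* Ball of the operator norm: |D - T| <= d. *)
Definition op_ball T (d : R) : set {linear X -> Y} :=
  [set D | forall x, `|D x - T x| <= d * `|x|].

(* Kernel of the adjoint on the topological dual of Y. *)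
Definition ker_adj D : set (Y -> R^o) :=
  [set f | [/\ linear f, continuous f & forall x, f (D x) = 0]].

Definition det_space := ext_tensor (Y -> R^o) X.

Definition det_line D : set det_space :=
  tensor_line (top_exterior (ker_adj D)) (top_exterior (ker D)).

(* (y_l /\ ... /\ y_1) (x) (x_1 /\ ... /\ x_k) *)
Definition det_gen (ys : seq (Y -> R^o)) (xs : seq X) : det_space :=
  tensor (wedge (rev ys)) (wedge xs).

Definition stab D N (Phi : {linear 'rV[R]_N -> Y}) (v : X * 'rV[R]_N) : Y :=
  D v.1 + Phi v.2.

(* Graph of the isomorphism from det_line D to the top exterior power of
   ker (D (+) Phi), for D (+) Phi surjective.  The lists zetas, xis are
   (zeta_1, ..., zeta_N) and (xi_{l+1}, ..., xi_N). *)
Definition iota_graph N (Phi : {linear 'rV[R]_N -> Y}) D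
    (w : det_space) (h : exterior (X * 'rV[R]_N)%type) : Prop :=
  exists xs ys (zetas : seq 'rV[R]_N) (xis : seq X) (c : R),
    let k := size xs in
    let l := size ys in
    [/\ basis (ker D) xs, basis (ker_adj D) ys,
        basis setT zetas /\ size zetas = N,
        size xis = (N - l)%N /\
        (forall j, (j < N - l)%N -> D xis`_j + Phi zetas`_(l + j) = 0) &
        w = c *: det_gen ys xs /\
        h = (c * ((-1) ^+ (k * l) *
               (\det (\matrix_(i < l, j < l) (ys`_j (Phi zetas`_i) : R)) /
                \det (\matrix_(i < N, j < N) zetas`_i 0 j)))) *:
            wedge ([seq (x, 0) | x <- xs] ++ zip xis (drop l zetas))].

(* s_0, ..., s_(m-1) is a continuous frame of the kernel bundle of D (+) Phi
   over the Fredholm operators D with |D - T| <= d; in particular D (+) Phi is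
   surjective there. *)
Definition kernel_frame N (Phi : {linear 'rV[R]_N -> Y}) T (d : R)
    m (s : nat -> {linear X -> Y} -> X * 'rV[R]_N) : Prop :=
  let U := [set D | fredholm D /\ op_ball T d D] in
  forall D, U D ->
  [/\ (forall y, exists v, stab D Phi v = y),
      basis (ker (stab D Phi)) (mkseq (s^~ D) m) &
      forall i, (i < m)%N -> forall e : R, 0 < e -> exists2 r : R, 0 < r &
        forall D', U D' -> op_ball D r D' -> `|s i D' - s i D| < e].

(* An orientation of the restriction of det to A: an orientation of each fibre,
   such that near each T in A every iota_Phi maps it to the orientation given by
   a continuous frame of the kernel bundle of D (+) Phi, up to a constant sign
   e (which cannot be absorbed into the frame when m = 0). *)
Definition det_orientation (A : set {linear X -> Y})
    (o : {linear X -> Y} -> set det_space) : Prop :=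
  (forall D, A D -> line_orientation (det_line D) (o D)) /\
  (forall T, A T -> forall N (Phi : {linear 'rV[R]_N -> Y}), coker_iso T Phi ->
     exists (d : R) m s (e : R),
       [/\ 0 < d, kernel_frame Phi T d m s, e <> 0 &
           forall D, A D -> op_ball T d D ->
             o D = [set w | exists2 c : R, 0 < c &
               iota_graph Phi D w ((c * e) *: wedge (mkseq (s^~ D) m))]]).

End DeterminantLineBundle.

(* Together with completeness of the normed module: a real Hilbert space. *)
Definition inner_product {R : realType} {H : normedModType R}
    (ip : H -> H -> R) : Prop :=
  [/\ (forall x y, ip x y = ip y x),
      (forall a x y z, ip (a *: x + y) z = a * ip x z + ip y z) &
      (forall x, `|x| ^+ 2 = ip x x)].

Definition compact_operator {R : realType} {E F : normedModType R}
    (j : E -> F) : Prop :=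
  compact (closure (j @` [set x | `|x| <= 1])).

Section SymmetricFredholm.
Context {R : realType} {E F : completeNormedModType R}.
(* The subspace E of F is given by its inclusion j. *)
Variables (ipF : F -> F -> R) (j : {linear E -> F}).
Implicit Types T : {linear E -> F}.

Definition sym_fredholm T : Prop :=
  [/\ fredholm T, index_zero T & forall x y, ipF (T x) (j y) = ipF (j x) (T y)].

Definition orthocomp (A : set F) : set F :=
  [set y | forall x, A x -> ipF x y = 0].

(* Spectrum of T as an unbounded operator on F with domain E. *)
Definition spectrum T : set R :=
  [set lambda | ~ exists S : F -> E,
     [/\ (forall x, S (T x - lambda *: j x) = x),
         (forall y, T (S y) - lambda *: j (S y) = y) &
         continuous (j \o S)]].

Definition sym_fredholm_gt (r : R) : set {linear E -> F} :=
  [set T | sym_fredholm T /\ spectrum T `<=` [set lambda | r < lambda]].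

Definition sym_fredholm_lt (r : R) : set {linear E -> F} :=
  [set T | sym_fredholm T /\ spectrum T `<=` [set lambda | lambda < r]].

Definition eigen_sum (S : set R) T : set E :=
  lin_span [set x | exists2 lambda, S lambda & T x = lambda *: j x].

(* The identification of ker T, which is the orthogonal complement of im T in F,
   with the kernel of the adjoint of T. *)
Definition dualF (x : E) : F -> R^o := fun y => ipF (j x) y.

(* Orientation of det T = top(ker T) (x) top(ker T) in which
   (-1)^n (x_k /\ ... /\ x_1) (x) (x_1 /\ ... /\ x_k) is positive for every basis
   (x_i) of ker T, where n is the number, with multiplicity, of eigenvalues of T
   in S.  Without the sign the fibrewise orientations do not fit together
   continuously where an eigenvalue crosses 0. *)
Definition canonical_orientation (S : set R) T : set (@det_space R E F) :=
  [set w | exists (c : R) xs vs,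
     [/\ 0 < c, basis (ker T) xs, basis (eigen_sum S T) vs &
         w = (c * (-1) ^+ size vs) *: det_gen (map dualF xs) xs]].

(* Both are normalised to be the standard orientation of det T = R where T is
   invertible with spectrum in (0, oo), respectively in (-oo, 0). *)
Definition canonical_orientation_gt := canonical_orientation [set l | l < 0].
Definition canonical_orientation_lt := canonical_orientation [set l | 0 <= l].

End SymmetricFredholm.

(* Main.v *)
(* Fix lam < 0 below all spectra.  For a symmetric T the number n(T) of negative eigenvalues is
   the index of the form q_T(x) = <T x, j x>, and n jumps by the number of small eigenvalues
   that become negative.  Let e be an orthonormal basis of ker T and let D be near T.  The
   vectors X with D X in the span of e form a space of dimension N = dim ker T, orthogonal
   for q_D to the complement of ker T; on that complement q_D keeps the index n(T), by a form
   bound for D - T relative to T - lam.  Hence n(D) = n(T) + n(B), where B is the Gram matrix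
   of q_D on a complement of ker D in that space.  On the other hand B is, up to sign, the
   block that remains when <j X, Phi zeta> is expressed in a basis of ker (D (+) Phi) adapted
   to ker D, so iota_Phi maps the generator given by a basis of ker D to a multiple of a
   continuous frame whose sign is a constant times sign (det B) = (-1)^(n(D) - n(T)).
   Spectra bounded from above reduce to this case through D |-> - D. *)

(* The obstacle is that D is close to T only as an operator from E to F, which does not make the
   form of D - T small relative to the norm of F. The substitute is the energy form of T - lam,
   nonnegative because lam lies below the spectrum: Reid's inequality turns operator smallness into
   smallness relative to this form, and the gap of T off its kernel and its negative eigenvectors is
   measured in the same form. Eigenvalues are never followed along a path; n(D) and n(T) are
   compared by dimension counts between subspaces on which q_D has a sign. The spectral input is
   limited to extremal eigenvectors of the compact resolvent and to the finiteness of eigenvector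
   systems with bounded eigenvalues. The vectors X come from a Lyapunov-Schmidt reduction along a
   chosen complement of im T. It is carried out twice: along the image of Phi, which gives the frame
   of ker (D (+) Phi), and along j (ker T), which gives the space where q_D reduces to B. The two
   are linked by the matrix of the <j X, Phi zeta>, invertible at T and so of constant sign nearby;
   this sign and the parity of n(T) make up the constant of the frame. *)
From HB Require Import structures.
Require Import Defs.
From mathcomp Require Import perm ring lra zify.

Set Implicit Arguments.
Unset Strict Implicit.
Unset Printing Implicit Defensive.

Local Open Scope classical_set_scope.
Local Open Scope ring_scope.

(** * Alternating forms and determinants *)

Section DetUnique.
Context {R : realType} {n : nat} (phi : 'M[R]_n -> R).
Hypothesis phi_lin : forall (A B C : 'M[R]_n) i0 b c,
  (forall j, A i0 j = b * B i0 j + c * C i0 j) ->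
  (forall i j, i != i0 -> B i j = A i j) ->
  (forall i j, i != i0 -> C i j = A i j) -> phi A = b * phi B + c * phi C.
Hypothesis phi_alt : forall (A : 'M[R]_n) i1 i2,
  i1 != i2 -> (forall j, A i1 j = A i2 j) -> phi A = 0.

Let upd (A : 'M[R]_n) (i0 : 'I_n) (v : 'I_n -> R) : 'M[R]_n :=
  \matrix_(i, j) if i == i0 then v j else A i j.

Lemma row_sum_expand A i0 (I : Type) (r : seq I) (c : I -> R) (v : I -> 'I_n -> R) :
  phi (upd A i0 (fun j => \sum_(k <- r) c k * v k j)) =
  \sum_(k <- r) c k * phi (upd A i0 (v k)).
Proof.
elim: r => [|k r IH].
  rewrite big_nil.
  rewrite (@phi_lin _ (upd A i0 (fun=> 0)) (upd A i0 (fun=> 0)) i0 0 0) ?mul0r ?addr0 //.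
  - by move=> j; rewrite !mxE eqxx big_nil !mul0r addr0.
  - by move=> i j /negbTE ii; rewrite !mxE ii.
  - by move=> i j /negbTE ii; rewrite !mxE ii.
rewrite big_cons -IH -[X in _ + X]mul1r.
apply: (@phi_lin _ _ _ i0).
- by move=> j; rewrite !mxE eqxx big_cons mul1r.
- by move=> i j /negbTE ii; rewrite !mxE ii.
- by move=> i j /negbTE ii; rewrite !mxE ii.
Qed.

(** Polarisation: phi vanishes when the rows i1 and i2 are both replaced by their sum. *)
Lemma row_swap A i1 i2 : i1 != i2 -> phi (xrow i1 i2 A) = - phi A.
Proof.
move=> ne.
pose M u v := upd (upd A i1 u) i2 v.
have Mz u : phi (M u u) = 0.
  by apply: (@phi_alt _ _ _ ne) => j; rewrite !mxE (negbTE ne) !eqxx.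
have Ml u1 u2 v : phi (M (fun j => u1 j + u2 j) v) = phi (M u1 v) + phi (M u2 v).
  rewrite -[phi (M u1 v)]mul1r -[phi (M u2 v)]mul1r; apply: (@phi_lin _ _ _ i1).
  - by move=> j; rewrite !mxE (negbTE ne) eqxx !mul1r.
  - by move=> i j /negbTE ii; rewrite !mxE ii.
  - by move=> i j /negbTE ii; rewrite !mxE ii.
have Mr u v1 v2 : phi (M u (fun j => v1 j + v2 j)) = phi (M u v1) + phi (M u v2).
  rewrite -[phi (M u v1)]mul1r -[phi (M u v2)]mul1r; apply: (@phi_lin _ _ _ i2).
  - by move=> j; rewrite !mxE eqxx !mul1r.
  - by move=> i j /negbTE ii; rewrite !mxE ii.
  - by move=> i j /negbTE ii; rewrite !mxE ii.
have := Mz (fun j => A i1 j + A i2 j).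
rewrite Ml !Mr !Mz add0r addr0.
have -> : M (A i1) (A i2) = A.
  apply/matrixP => i j; rewrite !mxE.
  by case: eqVneq => [->//|_]; case: eqVneq => [->//|_].
have -> : M (A i2) (A i1) = xrow i1 i2 A.
  apply/matrixP => i j; rewrite !mxE.
  case: eqVneq => [->|h2]; first by rewrite tpermR.
  case: eqVneq => [->|h1]; first by rewrite tpermL.
  by rewrite tpermD // eq_sym.
by move=> /eqP; rewrite addr_eq0 => /eqP ->; rewrite opprK.
Qed.

Hypothesis phi1 : phi 1%:M = 0.

Lemma alternating_zero_perm (s : {perm 'I_n}) : phi (perm_mx s) = 0.
Proof.
have [ts -> dts] := prod_tpermP s.
elim: ts dts => [_|[a b] ts IH] /=; first by rewrite big_nil perm_mx1.
move=> /andP[/= ab dts]; rewrite big_cons /= perm_mxM -[perm_mx (tperm _ _)]/(tperm_mx _ _).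
by rewrite -xrowE row_swap // IH // oppr0.
Qed.

Lemma alternating_zero_delta (f : 'I_n -> 'I_n) :
  phi (\matrix_(i, j) (f i == j)%:R) = 0.
Proof.
have [/injectiveP inj|/injectivePn] := boolP (injectiveb f).
  rewrite -(alternating_zero_perm (perm inj)); congr phi.
  by apply/matrixP => i j; rewrite !mxE permE.
move=> [i1 [i2 ne eqf]]; apply: (@phi_alt _ _ _ ne) => j.
by rewrite !mxE eqf.
Qed.

(** Rows are expanded in the standard basis one at a time. The induction on k treats matrices whose
    rows from k on are already unit vectors; k = 0 is the matrix of a map of ['I_n], k = n is
    arbitrary. *)
Lemma alternating_zero A : phi A = 0.
Proof.
suff H k : (k <= n)%N -> forall (f : 'I_n -> 'I_n) (B : 'M[R]_n),
    (forall (i j : 'I_n), (k <= i)%N -> B i j = (f i == j)%:R) -> phi B = 0.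
  by apply: (H n (leqnn n) id) => i j; rewrite leqNgt ltn_ord.
elim: k => [|k IH] kn f B Bf.
  rewrite -(alternating_zero_delta f); congr phi.
  by apply/matrixP => i j; rewrite Bf // mxE.
pose i0 := Ordinal kn.
have -> : B = upd B i0 (fun j => \sum_k B i0 k * (k == j)%:R).
  apply/matrixP => i j; rewrite mxE; case: eqVneq => [->|//].
  rewrite (bigD1 j) //= eqxx mulr1 big1 ?addr0 // => l /negbTE ->.
  by rewrite mulr0.
rewrite row_sum_expand big1 // => l _.
rewrite (IH (ltnW kn) (fun i => if i == i0 then l else f i)) ?mulr0 // => i j ki.
rewrite mxE; case: eqVneq => [//|ne]; apply: Bf.
by rewrite ltn_neqAle ki andbT; apply: contra ne => /eqP e; apply/eqP/val_inj.
Qed.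

End DetUnique.

(** The difference of the two sides is alternating in the rows and vanishes at the identity. *)
Lemma det_unique {R : realType} n (phi : 'M[R]_n -> R) :
  (forall (A B C : 'M[R]_n) i0 b c,
    (forall j, A i0 j = b * B i0 j + c * C i0 j) ->
    (forall i j, i != i0 -> B i j = A i j) ->
    (forall i j, i != i0 -> C i j = A i j) -> phi A = b * phi B + c * phi C) ->
  (forall (A : 'M[R]_n) i1 i2,
    i1 != i2 -> (forall j, A i1 j = A i2 j) -> phi A = 0) ->
  forall A, phi A = \det A * phi 1%:M.
Proof.
move=> lin alt A; apply/eqP; rewrite -subr_eq0; apply/eqP.
apply: (@alternating_zero R n (fun A => phi A - \det A * phi 1%:M)).
- move=> {}A B C i0 b c h0 hB hC; rewrite (lin A B C i0 b c) //.
  rewrite (@determinant_multilinear _ _ A B C i0 b c); first by ring.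
  + by apply/rowP => j; rewrite !mxE h0.
  + by apply/matrixP => i j; rewrite !mxE hB // eq_sym neq_lift.
  + by apply/matrixP => i j; rewrite !mxE hC // eq_sym neq_lift.
- move=> {}A i1 i2 ne eqA; rewrite (alt _ _ _ ne eqA).
  by rewrite (@determinant_alternate _ _ A i1 i2 ne eqA) mul0r subr0.
- by rewrite det1 mul1r subrr.
Qed.

Section AltForm.
Context {R : realType} {X : lmodType R}.
Implicit Types alpha : altform X.

(** Bases and wedges are lists, while changes of basis are matrices; [fam] turns families over
    ['I_n] into lists so that matrices can act on them. *)
Definition fam n (f : 'I_n -> X) : seq X := [seq f i | i <- enum 'I_n].

Lemma size_fam n (f : 'I_n -> X) : size (fam f) = n.
Proof. by rewrite size_map size_enum_ord. Qed.

Lemma nth_fam n (f : 'I_n -> X) (i : 'I_n) : (fam f)`_i = f i.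
Proof. by rewrite (nth_map i) ?size_enum_ord // nth_ord_enum. Qed.

Lemma fam_nth s : fam (fun i : 'I_(size s) => s`_i) = s.
Proof.
apply: (@eq_from_nth _ 0); rewrite size_fam // => i lti.
by rewrite (nth_fam _ (Ordinal lti)).
Qed.

Lemma eq_fam n (f g : 'I_n -> X) : f =1 g -> fam f = fam g.
Proof. by move=> fg; apply: eq_map. Qed.

Lemma enum_ord_split n (i0 : 'I_n) :
  exists s t, [/\ enum 'I_n = s ++ i0 :: t, i0 \notin s & i0 \notin t].
Proof.
have : i0 \in enum 'I_n by rewrite mem_enum.
move: (enum_uniq 'I_n) => /[swap] /splitPr [s t] u.
exists s, t; split => //; move: u; rewrite cat_uniq /= negb_or.
  by case/and3P => _ /andP[].
by case/and3P => _ _ /andP[].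
Qed.

Lemma altform0 alpha s t : alpha (s ++ 0 :: t) = 0.
Proof.
have := altform_linear alpha s t 1 0 0.
by rewrite scaler0 addr0 mul1r => /eqP; rewrite -{1}[alpha _]addr0 (inj_eq (addrI _)) => /eqP.
Qed.

Lemma altform_fam_linear alpha n (f g h : 'I_n -> X) i0 b c :
  f i0 = b *: g i0 + c *: h i0 -> (forall i, i != i0 -> g i = f i) ->
  (forall i, i != i0 -> h i = f i) ->
  alpha (fam f) = b * alpha (fam g) + c * alpha (fam h).
Proof.
move=> f0 gf hf; rewrite /fam; have [s [t [-> s0 t0]]] := enum_ord_split i0.
have E (k : 'I_n -> X) u : i0 \notin u -> (forall i, i != i0 -> k i = f i) ->
    [seq k i | i <- u] = [seq f i | i <- u].
  move=> u0 kf; apply/eq_in_map => i iu; apply: kf.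
  by apply: contra u0 => /eqP <-.
rewrite !map_cat /= !(E g) // !(E h) // f0 altform_linear; congr (_ + _).
by rewrite -[c *: h i0]addr0 altform_linear altform0 addr0.
Qed.

Lemma altform_fam_alt alpha n (f : 'I_n -> X) i1 i2 :
  i1 != i2 -> f i1 = f i2 -> alpha (fam f) = 0.
Proof.
move=> ne e; rewrite /fam; have [s [t [E s0 t0]]] := enum_ord_split i1.
have : i2 \in enum 'I_n by rewrite mem_enum.
rewrite E mem_cat inE eq_sym (negbTE ne) /= => /orP[|] /splitPr [p q].
  by rewrite -catA /= !map_cat /= map_cat /= e altform_alt.
by rewrite !map_cat /= map_cat /= e altform_alt.
Qed.

(** As a function of P the left side is linear and alternating in the rows, so [det_unique]
    applies. *)
Lemma altform_matrix alpha n (P : 'M[R]_n) (x : 'I_n -> X) :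
  alpha (fam (fun i => \sum_j P i j *: x j)) = \det P * alpha (fam x).
Proof.
rewrite (@det_unique _ _ (fun P => alpha (fam (fun i => \sum_j P i j *: x j)))).
- congr (_ * alpha _); apply: eq_fam => i; rewrite (bigD1 i) //= mxE eqxx scale1r.
  by rewrite big1 ?addr0 // => k /negbTE ki; rewrite mxE eq_sym ki scale0r.
- move=> A B C i0 b c h0 hB hC; apply: (@altform_fam_linear _ _ _ _ _ i0) => [|i ii|i ii].
  + rewrite !scaler_sumr -big_split; apply: eq_bigr => k _ /=.
    by rewrite h0 scalerDl !scalerA.
  + by apply: eq_bigr => k _; rewrite hB.
  + by apply: eq_bigr => k _; rewrite hC.
- move=> A i1 i2 ne eqA; apply: (altform_fam_alt _ ne).
  by apply: eq_bigr => k _; rewrite eqA.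
Qed.

Lemma wedge_matrix n (P : 'M[R]_n) (x y : 'I_n -> X) :
  (forall i, y i = \sum_j P i j *: x j) ->
  wedge (fam y) = \det P *: wedge (fam x) :> exterior X.
Proof.
move=> yE; apply/funext => alpha; rewrite /wedge (eq_fam yE) altform_matrix.
by [].
Qed.

(** Supplies the alternating forms that detect nonzero wedges. Since an [altform] takes lists of
    every length, the determinant is extended by 0 to lists whose length is not n. *)
Lemma gram_altform n (l : 'I_n -> X -> R) :
  (forall i a u v, l i (a *: u + v) = a * l i u + l i v) ->
  exists alpha : altform X, forall x : 'I_n -> X,
    alpha (fam x) = \det (\matrix_(i, j) l j (x i)).
Proof.
move=> ll.
pose A s : R := if size s == n then \det (\matrix_(i, j < n) l j (s`_i)) else 0.
have Alin s t a u v : A (s ++ (a *: u + v) :: t) = a * A (s ++ u :: t) + A (s ++ v :: t).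
  rewrite /A !size_cat /=; case: eqP => [sn|_]; last by rewrite mulr0 addr0.
  have lts : (size s < n)%N by rewrite -sn addnS ltnS leq_addr.
  rewrite -[X in _ = _ + X]mul1r; pose i0 := Ordinal lts.
  apply: (@determinant_multilinear _ _ _ _ _ i0).
  + by apply/rowP => j; rewrite !mxE /= !nth_cat ltnn subnn /= ll mul1r.
  + apply/matrixP => i j; rewrite !mxE /= !nth_cat; case: ltnP => // le.
    have lt : (size s < lift i0 i)%N.
      by rewrite ltn_neqAle le andbT; exact: (neq_lift i0 i).
    by rewrite -(subnSK lt).
  + apply/matrixP => i j; rewrite !mxE /= !nth_cat; case: ltnP => // le.
    have lt : (size s < lift i0 i)%N.
      by rewrite ltn_neqAle le andbT; exact: (neq_lift i0 i).
    by rewrite -(subnSK lt).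
have Aalt s t r u : A (s ++ u :: t ++ u :: r) = 0.
  rewrite /A; case: eqP => [|//]; rewrite !size_cat /= size_cat /= => sn.
  have lt1 : (size s < n)%N by rewrite -sn; rewrite addnS ltnS leq_addr.
  have lt2 : (size s + (size t).+1 < n)%N by rewrite -sn; rewrite ltn_add2l ltnS addnS ltnS leq_addr.
  apply: (@determinant_alternate _ _ _ (Ordinal lt1) (Ordinal lt2)).
    by rewrite -val_eqE /= -[X in X != _]addn0 eqn_add2l.
  move=> j; rewrite !mxE /= !nth_cat ltnn subnn /=.
  rewrite ltnNge leq_addr /= addKn /= nth_cat ltnn subnn /=.
  by [].
exists (AltForm Alin Aalt) => x /=; rewrite /A size_fam eqxx.
by congr (\det _); apply/matrixP => i j; rewrite !mxE nth_fam.
Qed.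

(** Lets reversed wedges change by the same determinant as wedges, so that the sign of the reversing
    permutation is never computed. *)
Lemma altform_rev alpha : exists beta : altform X, forall s, beta s = alpha (rev s).
Proof.
have lin s t a u v : alpha (rev (s ++ (a *: u + v) :: t)) =
    a * alpha (rev (s ++ u :: t)) + alpha (rev (s ++ v :: t)).
  by rewrite !rev_cat !rev_cons !cat_rcons altform_linear.
have alt s t r u : alpha (rev (s ++ u :: t ++ u :: r)) = 0.
  by rewrite rev_cat rev_cons rev_cat rev_cons !cat_rcons -?catA /= altform_alt.
by exists (@AltForm _ _ (fun s => alpha (rev s)) lin alt).
Qed.

Lemma wedge_rev_matrix n (P : 'M[R]_n) (x y : 'I_n -> X) :
  (forall i, y i = \sum_j P i j *: x j) ->
  wedge (rev (fam y)) = \det P *: wedge (rev (fam x)) :> exterior X.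
Proof.
move=> yE; apply/funext => alpha; rewrite /wedge.
have [beta bE] := altform_rev alpha.
by rewrite -bE (eq_fam yE) altform_matrix bE.
Qed.

End AltForm.

(** * Bounded operators on Banach spaces *)

Section BoundedOperators.
Context {R : realType} {X Y : completeNormedModType R}.
Implicit Types A D : {linear X -> Y}.

Lemma linear_bound A : continuous A -> exists2 C, 0 < C & forall x, `|A x| <= C * `|x|.
Proof.
move=> cA; have /linear_boundedP : bounded_near A (nbhs (0 : X)).
  exact/linear_bounded_continuous.
move=> h; near +oo_R => C; exists C; last by near: C.
by near: C; exact: nbhs_pinfty_gt.
Unshelve. all: by end_near. Qed.

Lemma bound_continuous A C : (forall x, `|A x| <= C * `|x|) -> continuous A.
Proof.
move=> AC; apply/linear_bounded_continuous/linear_boundedP.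
exists C; split; first exact: num_real.
by move=> r /ltW Cr x; rewrite (le_trans (AC x)) // ler_wpM2r.
Qed.

(* Successive approximation: correcting the error y - A x halves it at each step. *)
Lemma approximate_solution A c : continuous A -> 0 <= c ->
  (forall y, exists x, `|x| <= c * `|y| /\ `|y - A x| <= `|y| / 2) ->
  forall y, exists x, A x = y /\ `|x| <= 2 * c * `|y|.
Proof.
move=> cA c0 /choice [g gP] y.
pose r := fix r k := if k is k'.+1 then r k' - A (g (r k')) else y.
have rle k : `|r k| <= `|y| * (1 / 2) ^+ k.
  elim: k => [|k IH]; first by rewrite expr0 mulr1.
  rewrite exprS mulrCA -[X in _ <= X * _]mul1r; have [_ /le_trans] := gP (r k); apply.
  by lra.
pose u k := g (r k).
have ule k : `|u k| <= c * `|y| * (1 / 2) ^+ k.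
  by have [/le_trans + _] := gP (r k); apply; rewrite -mulrA ler_wpM2l.
have ucvg : cvgn (series u).
  apply: normed_cvg; apply: (@series_le_cvg _ _ (geometric (c * `|y|) (1 / 2))).
  - by move=> n; exact: normr_ge0.
  - by move=> n; rewrite /geometric /= !mulr_ge0 // exprn_ge0 //; lra.
  - exact: ule.
  - by apply: is_cvg_geometric_series; rewrite ger0_norm; lra.
have Au n : A (series u n) = y - r n.
  rewrite /series /=; elim: n => [|n IH]; first by rewrite big_geq // linear0 subrr.
  by rewrite big_nat_recr //= linearD IH opprB -addrA [- _ + _]addrC.
have rcvg : r @ \oo --> (0 : Y).
  apply/norm_cvg0P; apply: (@squeeze_cvgr _ _ _ _ (fun=> 0) (geometric `|y| (1 / 2))).
  - by apply: nearW => n; rewrite normr_ge0 rle.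
  - exact: cvg_cst.
  - by apply: cvg_geometric; rewrite ger0_norm; lra.
exists (limn (series u)); split.
  have h1 : (A \o series u) @ \oo --> A (limn (series u)).
    by apply: continuous_cvg => //; exact: cA.
  have h2 : (A \o series u) @ \oo --> y.
    have -> : A \o series u = (fun n => y - r n) by apply/funext => n /=; exact: Au.
    by rewrite -[X in _ --> X]subr0; apply: cvgB => //; exact: cvg_cst.
  exact: (cvg_unique _ h1 h2).
have sle n : `|series u n| <= 2 * c * `|y|.
  have : `|series u n| <= 2 * c * `|y| * (1 - (1 / 2) ^+ n).
    rewrite /series /=; elim: n => [|n IH]; first by rewrite big_geq // normr0 expr0 subrr mulr0.
    rewrite big_nat_recr //=; apply: (le_trans (ler_normD _ _)).
    apply: (le_trans (lerD IH (ule n))); rewrite exprS; lra.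
  move=> /le_trans; apply; rewrite ler_piMr // ?mulr_ge0 //.
have ncvg : (fun n => `|series u n|) @ \oo --> `|limn (series u)|.
  exact: cvg_norm.
by rewrite -(cvg_lim _ ncvg) //; apply: limr_le; [exact: cvgP ncvg|exact: nearW].
Qed.

(** An exact solution for A is an approximate one for D, with error at most (2 c)^-1 * c |y| = |y| /
    2. *)
Lemma perturbed_solution A D c : continuous A -> 0 < c ->
  (forall y, exists x, A x = y /\ `|x| <= c * `|y|) ->
  (forall x, `|D x - A x| <= (2 * c)^-1 * `|x|) ->
  forall y, exists x, D x = y /\ `|x| <= 2 * c * `|y|.
Proof.
move=> cA c0 solA DA.
have cD : continuous D.
  have [K K0 AK] := linear_bound cA.
  apply: (@bound_continuous _ ((2 * c)^-1 + K)) => x.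
  by rewrite -[D x](subrK (A x)) (le_trans (ler_normD _ _)) // mulrDl lerD.
apply: approximate_solution => // [|y]; first exact: ltW.
have [x [<- xle]] := solA y; exists x; split => //.
rewrite distrC (le_trans (DA x)) // invfM -mulrA [leRHS]mulrC ler_pM2l ?invr_gt0 //.
by rewrite ler_pdivrMl.
Qed.

(** Open mapping argument: by Baire some closure of the image of a ball contains a ball about a
    point y0, and differences of approximate preimages move that ball to the origin. *)
Lemma bounded_inverse A : continuous A -> (forall y, exists x, A x = y) ->
  injective A -> exists2 C, 0 < C & forall x, `|x| <= C * `|A x|.
Proof.
move=> cA surjA injA.
pose B n := closure (A @` [set x | `|x| <= n%:R]).
have [n nd] : exists n, ~ dense (~` B n).
  apply/existsNP => allD.
  have : dense (\bigcap_n (~` B n)).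
    by apply: Baire => n; split => //; apply: closed_openC; exact: closed_closure.
  move=> /(_ setT) [|| y [_ By]]; [by exists 0|exact: openT|].
  have [x xy] := surjA y.
  apply: (By (Num.truncn `|x|).+1) => //; apply: subset_closure; exists x => //=.
  by rewrite ltW // truncnS_gt.
have [W [W0 oW WB]] : exists W, [/\ W !=set0, open W & W `<=` B n].
  move: nd => /existsNP [W /not_implyP [W0 /not_implyP [oW h]]]; exists W; split => //.
  move=> y Wy; apply: contrapT => nB; apply: h; exists y; split => //.
have [y0 Wy0] := W0.
have [r r0 ballW] : exists2 r, 0 < r & forall y, `|y0 - y| < r -> B n y.
  have /nbhs_normP [r /= r0 h] : nbhs y0 W by apply: open_nbhs_nbhs; split.
  by exists r => // y yr; apply: WB; apply: h.
have appr y e : `|y0 - y| < r -> 0 < e -> exists2 x, `|x| <= n%:R & `|y - A x| < e.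
  move=> /ballW By e0.
  have /By [_ [[x xn <-] h]] : nbhs y (ball y e) by exact: nbhsx_ballx.
  by exists x => //; rewrite -ball_normE in h.
have n0 : 0 <= n%:R :> R by [].
have key y : exists x, `|x| <= (4 * n%:R / r) * `|y| /\ `|y - A x| <= `|y| / 2.
  have [->|y00] := eqVneq y 0.
    by exists 0; rewrite !normr0 linear0 subr0 normr0 mulr0 mul0r.
  have ny : 0 < `|y| by rewrite normr_gt0.
  (* This t puts y0 + t y at distance r / 2 from y0. The two errors are below t |y| / 4 each, so
     after division by t the total error is at most |y| / 2. *)
  pose t := r / (2 * `|y|).
  have t0 : 0 < t by rewrite divr_gt0 // mulr_gt0.
  have ty : t * `|y| = r / 2 by rewrite /t invfM -!mulrA mulVf ?mulr1 // gt_eqF.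
  have e0 : 0 < t * `|y| / 4 by rewrite divr_gt0 // mulr_gt0.
  have [|x1 x1n x1e] := appr (y0 + t *: y) _ _ e0.
    by rewrite opprD addrA subrr sub0r normrN normrZ gtr0_norm // ty; lra.
  have [|x2 x2n x2e] := appr y0 _ _ e0; first by rewrite subrr normr0.
  exists (t^-1 *: (x1 - x2)); split.
    rewrite normrZ gtr0_norm ?invr_gt0 // invf_div.
    have : `|x1 - x2| <= 2 * n%:R by rewrite (le_trans (ler_normB _ _)) //; lra.
    move=> h; rewrite (_ : _ / r * `|y| = 2 * `|y| / r * (2 * n%:R)); last by field; rewrite gt_eqF.
    by rewrite ler_wpM2l // divr_ge0 ?mulr_ge0 // ltW.
  have -> : y - A (t^-1 *: (x1 - x2)) = t^-1 *: ((y0 + t *: y - A x1) - (y0 - A x2)).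
    rewrite linearZ /= linearB /= -{1}[y](scalerK (lt0r_neq0 t0)) -scalerBr.
    by congr (_ *: _); rewrite !opprB -!addrA [RHS]addrC !addrA subrK addrAC.
  rewrite normrZ gtr0_norm ?invr_gt0 // ler_pdivrMl //.
  rewrite (le_trans (ler_normB _ _)) //.
  have := lerD (ltW x1e) (ltW x2e) => /le_trans; apply.
  by lra.
have c0 : 0 <= 4 * n%:R / r by rewrite divr_ge0 ?mulr_ge0 // ltW.
exists (2 * (4 * n%:R / r) + 1); first by rewrite ltr_wpDl // mulr_ge0.
move=> x; have [x' [/injA -> /le_trans]] := approximate_solution cA c0 key (A x); apply.
by rewrite ler_wpM2r // lerDl.
Qed.

End BoundedOperators.

(** * Inner products and extremal eigenvectors *)

Section InnerProduct.
Context {R : realType} {H : normedModType R} (ip : H -> H -> R).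
Hypothesis hip : inner_product ip.

Lemma ipC x y : ip x y = ip y x. Proof. by case: hip. Qed.
Lemma ip_linear a x y z : ip (a *: x + y) z = a * ip x z + ip y z.
Proof. by case: hip. Qed.
Lemma ip_norm x : `|x| ^+ 2 = ip x x. Proof. by case: hip. Qed.
Lemma ip0l z : ip 0 z = 0.
Proof.
have := ip_linear 1 0 0 z; rewrite scaler0 addr0 mul1r => /eqP.
by rewrite -{1}[ip 0 z]addr0 (inj_eq (addrI _)) eq_sym => /eqP.
Qed.
Lemma ipDl x y z : ip (x + y) z = ip x z + ip y z.
Proof. by rewrite -{1}[x]scale1r ip_linear mul1r. Qed.
Lemma ipZl a x z : ip (a *: x) z = a * ip x z.
Proof. by rewrite -{1}[_ *: x]addr0 ip_linear ip0l addr0. Qed.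
Lemma ipNl x z : ip (- x) z = - ip x z.
Proof. by rewrite -scaleN1r ipZl mulN1r. Qed.
Lemma ipBl x y z : ip (x - y) z = ip x z - ip y z.
Proof. by rewrite ipDl ipNl. Qed.
Lemma ip0r z : ip z 0 = 0. Proof. by rewrite ipC ip0l. Qed.
Lemma ipDr x y z : ip z (x + y) = ip z x + ip z y.
Proof. by rewrite ipC ipDl !(ipC z). Qed.
Lemma ipZr a x z : ip z (a *: x) = a * ip z x.
Proof. by rewrite ipC ipZl (ipC z). Qed.
Lemma ipNr x z : ip z (- x) = - ip z x.
Proof. by rewrite ipC ipNl (ipC z). Qed.
Lemma ipBr x y z : ip z (x - y) = ip z x - ip z y.
Proof. by rewrite ipDr ipNr. Qed.
Lemma ip_suml I (r : seq I) P (f : I -> H) z :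
  ip (\sum_(i <- r | P i) f i) z = \sum_(i <- r | P i) ip (f i) z.
Proof.
by elim/big_rec2: _ => [|i y x _ <-]; rewrite ?ip0l // ipDl.
Qed.
Lemma ip_sumr I (r : seq I) P (f : I -> H) z :
  ip z (\sum_(i <- r | P i) f i) = \sum_(i <- r | P i) ip z (f i).
Proof. by rewrite ipC ip_suml; apply: eq_bigr => i _; rewrite ipC. Qed.
Lemma ip_ge0 x : 0 <= ip x x. Proof. by rewrite -ip_norm exprn_ge0. Qed.
Lemma ip_eq0 x : ip x x = 0 -> x = 0.
Proof. by rewrite -ip_norm => /eqP; rewrite sqrf_eq0 normr_eq0 => /eqP. Qed.

End InnerProduct.

Lemma discriminant_le {R : realType} (a b c : R) :
  0 <= c -> (forall t, 0 <= a + 2 * t * b + t ^+ 2 * c) -> b ^+ 2 <= a * c.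
Proof.
rewrite le_eqVlt => /orP[/eqP <-|c0] h.
  have [->|b0] := eqVneq b 0; first by rewrite expr0n mulr0.
  (* For c = 0 the expression is affine in t and takes the value -1 here. *)
  have := h (- (a + 1) / (2 * b)); rewrite mulr0 addr0.
  have -> : a + 2 * (- (a + 1) / (2 * b)) * b = -1 by field.
  by rewrite lerNr oppr0 ler10.
have := h (- b / c).
have -> : a + 2 * (- b / c) * b + (- b / c) ^+ 2 * c = (a * c - b ^+ 2) / c.
  by field; rewrite gt_eqF.
by rewrite pmulr_lge0 ?invr_gt0 // subr_ge0.
Qed.

(** Nonnegativity is asked only along the line through x in direction y and at y, so that the
    inequality also serves a form that is nonnegative on a subspace only. *)
Lemma psd_cauchy_schwarz {R : realType} {V : lmodType R} (b : V -> V -> R) :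
  (forall x y, b x y = b y x) ->
  (forall a x y z, b (a *: x + y) z = a * b x z + b y z) ->
  forall x y, (forall t, 0 <= b (t *: y + x) (t *: y + x)) -> 0 <= b y y ->
  b x y ^+ 2 <= b x x * b y y.
Proof.
move=> bC bl x y h by0; apply: discriminant_le => // t; have := h t.
by rewrite bl bC bl (bC _ (t *: y + x)) bl (bC y x); congr (0 <= _); ring.
Qed.

Lemma cauchy_schwarz {R : realType} {H : normedModType R} (ip : H -> H -> R) :
  inner_product ip -> forall x y, `|ip x y| <= `|x| * `|y|.
Proof.
move=> hip x y; rewrite -(@ler_pXn2r _ 2) ?nnegrE ?mulr_ge0 //.
rewrite real_normK ?num_real // exprMn !(ip_norm hip).
apply: (@psd_cauchy_schwarz _ _ ip); [exact: (ipC hip)|exact: (ip_linear hip)| |exact: (ip_ge0 hip)].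
by move=> t; exact: (ip_ge0 hip).
Qed.

Lemma compact_subsequence {R : realType} {H : normedModType R} (Z : set H) (u : nat -> H) :
  compact Z -> (forall n, Z (u n)) ->
  exists z, forall e : R, 0 < e -> forall N, exists2 n, (N <= n)%N & `|u n - z| < e.
Proof.
move=> cZ Zu; have [|z [_ clz]] := cZ (u @ \oo) _.
  by exists 0 => // n _; exact: Zu.
exists z => e e0 N.
have [] := clz (u @` [set n | (N <= n)%N]) (ball z e).
- by exists N => // n Nn; exists n.
- exact: nbhsx_ballx.
- move=> _ [[n Nn <-]]; rewrite -ball_normE /= => h; exists n => //.
  by rewrite distrC.
Qed.

Section Extremal.
Context {R : realType} {H : completeNormedModType R} (ip : H -> H -> R).
Hypothesis hip : inner_product ip.
Variables (K : {linear H -> H}) (c : R) (Z : set H) (L : set H).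
Hypothesis Ksym : forall x y, ip (K x) y = ip x (K y).
Hypothesis Kbound : forall x, `|K x| <= c * `|x|.
Hypothesis cZ : compact Z.
Hypothesis KZ : forall x, `|x| <= 1 -> Z (K x).
Let W := [set y | forall w, L w -> ip y w = 0].
Hypothesis KW : forall y, W y -> W (K y).

(* A maximising sequence for the Rayleigh quotient satisfies M y - K y -> 0, and
   compactness of K makes it accumulate at an eigenvector. *)
Lemma extremal_eigenvector : exists M, [/\ 0 <= M,
  forall y, W y -> ip (K y) y <= M * ip y y &
  M = 0 \/ 0 < M /\ exists z, [/\ z != 0, W z & K z = M *: z]].
Proof.
pose A := [set ip (K y) y | y in [set y | W y /\ `|y| <= 1]].
have W0 : W 0 by move=> w _; exact: ip0l.
have WZ a x y : W x -> W y -> W (a *: x + y).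
  by move=> Wx Wy w Lw; rewrite ip_linear // Wx // Wy // mulr0 addr0.
have A0 : A 0.
  by exists 0; [split; rewrite ?normr0|rewrite linear0 ip0l].
have [c' [c'0 Kb]] : exists c', 0 < c' /\ forall x, `|K x| <= c' * `|x|.
  exists (`|c| + 1); split; first by rewrite ltr_wpDl.
  move=> x; apply: (le_trans (Kbound x)); rewrite ler_wpM2r //.
  by rewrite (le_trans (ler_norm c)) // lerDl.
have Kq y : ip (K y) y <= c' * `|y| ^+ 2.
  apply: (le_trans (ler_norm _)); apply: (le_trans (cauchy_schwarz hip _ _)).
  by rewrite expr2 mulrA ler_wpM2r.
have supA : has_sup A.
  split; first by exists 0.
  exists c' => _ [y [_ y1] <-]; apply: (le_trans (Kq y)).
  by rewrite ler_piMr ?(ltW c'0) // exprn_ile1.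
pose M := sup A.
have M0 : 0 <= M by apply: ub_le_sup => //; case: supA.
have Mle y : W y -> ip (K y) y <= M * ip y y.
  move=> Wy; have [->|y0] := eqVneq y 0; first by rewrite linear0 !(ip0l hip) mulr0.
  have ny : 0 < `|y| by rewrite normr_gt0.
  have : ip (K (`|y|^-1 *: y)) (`|y|^-1 *: y) <= M.
    apply: ub_le_sup; [by case: supA|exists (`|y|^-1 *: y) => //; split].
      by rewrite -[_ *: y]addr0; exact: WZ.
    by rewrite normrZ ger0_norm ?invr_ge0 // mulVf // gt_eqF.
  rewrite linearZ /= ipZl // ipZr // mulrA -invfM -expr2 ler_pdivrMl ?exprn_gt0 //.
  by rewrite (ip_norm hip) mulrC.
exists M; split => //.
move: M0; rewrite le_eqVlt => /orP[/eqP <-|M0]; [by left|right; split => //].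
have /choice [y yP] n : exists y, [/\ W y, `|y| <= 1 & M - n.+1%:R^-1 < ip (K y) y].
  have [|_ [y [Wy y1] <-] h] := @sup_adherent _ A n.+1%:R^-1 _ supA; first by rewrite invr_gt0.
  by exists y.
pose r n := M *: y n - K (y n).
have Wr n : W (r n).
  have [Wy _ _] := yP n; rewrite /r; apply: (WZ) => //.
  by rewrite -scaleN1r -[_ *: _]addr0; apply: (WZ) => //; exact: KW.
(* The form of M - K, nonnegative on W. Its Cauchy-Schwarz inequality bounds |r|^4 = b(y, r)^2 by
   b(y, y) b(r, r), and b(y, y) <= 1 / (n + 1) along the maximising sequence. *)
pose b x z := M * ip x z - ip (K x) z.
have bC x z : b x z = b z x by rewrite /b (ipC hip) Ksym (ipC hip x).
have bl a x x' z : b (a *: x + x') z = a * b x z + b x' z.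
  by rewrite /b linearP /= !(ip_linear hip); ring.
have b0 x : W x -> 0 <= b x x by move=> Wx; rewrite /b subr_ge0 Mle.
have rle n : `|r n| ^+ 2 <= (M + c') * n.+1%:R^-1.
  have [Wy y1 ylt] := yP n.
  have brr : b (y n) (r n) = `|r n| ^+ 2.
    by rewrite (ip_norm hip) {2}/r ipBl // ipZl.
  have := psd_cauchy_schwarz bC bl (x := y n) (y := r n).
  move=> /(_ (fun t => b0 _ (WZ _ _ _ (Wr n) Wy)) (b0 _ (Wr n))).
  have byy : b (y n) (y n) <= n.+1%:R^-1.
    rewrite /b -(ip_norm hip); have : M * `|y n| ^+ 2 <= M by rewrite ler_piMr ?(ltW M0) // exprn_ile1.
    by move: ylt; rewrite ltrBlDr => /ltW h1 h2; rewrite lerBlDr addrC (le_trans h2).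
  have bbr : b (r n) (r n) <= (M + c') * `|r n| ^+ 2.
    rewrite /b -(ip_norm hip) mulrDl lerD2l (le_trans (ler_norm _)) // normrN.
    by rewrite (le_trans (cauchy_schwarz hip _ _)) // expr2 mulrA ler_wpM2r.
  rewrite brr => /le_trans /(_ (ler_pM (b0 _ Wy) (b0 _ (Wr n)) byy bbr)).
  have [->|r0] := eqVneq (r n) 0.
    by rewrite normr0 expr0n /= => _; rewrite mulr_ge0 // addr_ge0 // ltW.
  have nr : 0 < `|r n| ^+ 2 by rewrite exprn_gt0 // normr_gt0.
  by rewrite [_ ^+ 2 ^+ 2]expr2 [in X in _ <= X -> _]mulrA ler_pM2r // mulrC.
have [z zP] := compact_subsequence cZ (fun n => KZ (let: And3 _ h _ := yP n in h)).
have r0 e : 0 < e -> exists N, forall n, (N <= n)%N -> `|r n| < e.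
  move=> e0; exists (Num.truncn ((M + c') / e ^+ 2)) => n Nn.
  rewrite -(@ltr_pXn2r _ 2) ?nnegrE ?(ltW e0) //; apply: (le_lt_trans (rle n)).
  rewrite ltr_pdivrMr // mulrC -ltr_pdivrMr ?exprn_gt0 //.
  by apply: (lt_le_trans (truncnS_gt _)); rewrite ler_nat ltnS.
(* As r n tends to 0, M y n approaches the accumulation point z of K (y n). *)
have near e : 0 < e -> exists n, [/\ n.+1%:R^-1 < e, `|K (y n) - z| < e & `|M *: y n - z| < e].
  move=> e0; have [N NP] := r0 _ (divr_gt0 e0 (ltr0n R 2)).
  pose N' := maxn N (Num.truncn e^-1).
  have [n Nn h] := zP _ (divr_gt0 e0 (ltr0n R 2)) N'.
  exists n; split.
  - rewrite -[e]invrK ltf_pV2 ?posrE ?invr_gt0 //; apply: (lt_le_trans (truncnS_gt _)).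
    by rewrite ler_nat ltnS (leq_trans _ Nn) // leq_maxr.
  - by lra.
  - have -> : M *: y n - z = r n + (K (y n) - z) by rewrite /r addrA subrK.
    apply: (le_lt_trans (ler_normD _ _)).
    have := NP n (leq_trans (leq_maxl _ _) Nn); lra.
exists z; split.
- apply/eqP => z0.
  (* For z = 0 this would give M - M / 3 < <K y, y> <= |K y| < M / 3. *)
  have [n [ne he _]] := near (M / 3) (divr_gt0 M0 (ltr0n R 3)).
  have [Wy y1 ylt] := yP n.
  have := le_trans (ler_norm _) (cauchy_schwarz hip (K (y n)) (y n)).
  have : `|K (y n)| * `|y n| <= `|K (y n)| by rewrite ler_piMr.
  rewrite z0 subr0 in he; move: (n.+1%:R^-1) ne ylt => d ne ylt.
  by move: (M) M0 ne he ylt => M' M'0 ne he ylt; lra.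
- move=> w Lw; apply/eqP; apply/negPn/negP => nz.
  pose e := `|ip z w| / (`|w| + 1).
  have w1 : 0 < `|w| + 1 by rewrite ltr_wpDl.
  have e0 : 0 < e by rewrite divr_gt0 // normr_gt0.
  have [n [_ _ h]] := near e e0; have [Wy _ _] := yP n.
  have : ip (M *: y n - z) w = - ip z w by rewrite ipBl // ipZl // (Wy w Lw) mulr0 sub0r.
  move=> E; have := cauchy_schwarz hip (M *: y n - z) w; rewrite E normrN.
  have -> : `|ip z w| = e * (`|w| + 1) by rewrite /e divfK // gt_eqF.
  apply/negP; rewrite -ltNge.
  apply: (@le_lt_trans _ _ (e * `|w|)); first by rewrite ler_wpM2r // ltW.
  by rewrite ltr_pM2l // ltrDl.
- apply/eqP; rewrite -subr_eq0 -normr_eq0; apply/negPn/negP => nz.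
  have d0 : 0 < `|K z - M *: z| by rewrite normr_gt0 -normr_eq0.
  pose e := `|K z - M *: z| / (c' + M).
  have cM : 0 < c' + M by rewrite addr_gt0.
  have e0 : 0 < e by rewrite divr_gt0.
  have [n [_ h1 h2]] := near e e0.
  have : `|K z - M *: z| <= `|K (z - M *: y n)| + `|M *: (K (y n) - z)|.
    have -> : K z - M *: z = (K z - K (M *: y n)) + (K (M *: y n) - M *: z).
      by rewrite addrA subrK.
    rewrite -linearB [K (M *: y n)]linearZ -scalerBr; exact: ler_normD.
  apply/negP; rewrite -ltNge normrZ (gtr0_norm M0).
  have -> : `|K z - M *: z| = c' * e + M * e by rewrite -mulrDl /e mulrC divfK // gt_eqF.
  apply: ler_ltD; last by rewrite ltr_pM2l.
  by apply: (le_trans (Kb _)); rewrite ler_wpM2l ?(ltW c'0) // distrC ltW.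
Qed.

End Extremal.

(** * Resolvents of symmetric operators *)

Section SymmetricOperators.
Context {R : realType} {E F : completeNormedModType R} (ipF : F -> F -> R).
Hypothesis hip : inner_product ipF.
Variable j : {linear E -> F}.
Hypothesis j_inj : injective j.
Hypothesis j_compact : compact_operator j.
Implicit Types D T : {linear E -> F}.

Definition symmetric D := forall x y, ipF (D x) (j y) = ipF (j x) (D y).

Lemma symmetricC D x y : symmetric D -> ipF (D x) (j y) = ipF (D y) (j x).
Proof. by move=> ->; rewrite (ipC hip). Qed.

Lemma inclusion_bound : exists2 c, 0 < c & forall x, `|j x| <= c * `|x|.
Proof.
have := compact_bounded j_compact => -[M [_ MP]].
pose c := `|M| + 1.
have c0 : 0 < c by rewrite ltr_wpDl.
exists c => // x; have [->|x0] := eqVneq x 0; first by rewrite linear0 !normr0 mulr0.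
have nx : 0 < `|x| by rewrite normr_gt0.
have := MP c _ (j (`|x|^-1 *: x)); rewrite linearZ /= normrZ gtr0_norm ?invr_gt0 //.
rewrite ler_pdivrMl // mulrC; apply.
  by rewrite /c (le_lt_trans (ler_norm M)) // ltrDl.
apply: subset_closure; exists (`|x|^-1 *: x); last by rewrite linearZ.
by rewrite /= normrZ gtr0_norm ?invr_gt0 // mulVf // gt_eqF.
Qed.

Lemma eigenvalue_spectrum D x mu : x != 0 -> D x = mu *: j x -> spectrum j D mu.
Proof.
move=> x0 Dx [S [S1 S2 _]]; move/eqP: x0; apply.
have := S1 x; rewrite Dx subrr => <-.
by have := S1 0; rewrite !linear0 ?scaler0 ?subr0 ?addr0.
Qed.

(** The definition of [spectrum] makes the inverse continuous into F; the bound in the norm of E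
    comes from the open mapping argument for D - lam. *)
Lemma resolvent D lam : continuous D -> ~ spectrum j D lam ->
  (forall y, exists x, D x - lam *: j x = y) /\
  exists2 C, 0 < C & forall x, `|x| <= C * `|D x - lam *: j x|.
Proof.
move=> cD /contrapT [S [S1 S2 _]].
have lin : linear (fun x => D x - lam *: j x).
  move=> a x y; rewrite [D (_ + _)]linearP [j (_ + _)]linearP scalerDr scalerBr !scalerA.
  by rewrite opprD [lam * a]mulrC addrACA.
pose A : {linear E -> F} := HB.pack (fun x => D x - lam *: j x)
  (GRing.isLinear.Build _ _ _ _ _ lin).
have surj y : exists x, D x - lam *: j x = y by exists (S y).
split => //; apply: (@bounded_inverse _ _ _ A) => //; last first.
  by move=> x y e; rewrite -(S1 x) -(S1 y); congr S; exact: e.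
have [CD _ DP] := linear_bound cD; have [c _ jP] := inclusion_bound.
apply: (@bound_continuous _ _ _ _ (CD + `|lam| * c)) => x /=.
rewrite (le_trans (ler_normB _ _)) // mulrDl lerD // normrZ -mulrA.
by rewrite ler_wpM2l.
Qed.

Section Resolvent.
Variables (D : {linear E -> F}) (lam : R).
Hypothesis D_cont : continuous D.
Hypothesis D_sym : symmetric D.
Hypothesis D_gt : forall mu, spectrum j D mu -> lam < mu.

Let lam_reg : ~ spectrum j D lam.
Proof. by move=> /D_gt; rewrite ltxx. Qed.

(** K is j composed with the inverse of D - lam; it is compact because the inverse is bounded into E
    and j is compact. Z contains - K x as well, since extremal eigenvectors are sought both for K
    and for - K. *)
Lemma resolvent_operator : exists K : {linear F -> F},
  [/\ forall x, K (D x - lam *: j x) = j x,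
      forall y, exists2 x, D x - lam *: j x = y & K y = j x,
      forall x y, ipF (K x) y = ipF x (K y) &
      exists c Z, [/\ forall x, `|K x| <= c * `|x|, compact Z &
         forall x, `|x| <= 1 -> Z (K x) /\ Z (- K x)]].
Proof.
have [surj [C C0 bnd]] := resolvent D_cont lam_reg.
have [c c0 jP] := inclusion_bound.
have inj x x' : D x - lam *: j x = D x' - lam *: j x' -> x = x'.
  move=> e; apply/eqP; rewrite -subr_eq0 -normr_le0 (le_trans (bnd _)) //.
  have -> : D (x - x') - lam *: j (x - x') = (D x - lam *: j x) - (D x' - lam *: j x').
    by rewrite [D (_ - _)]linearB [j (_ - _)]linearB scalerBr !opprB addrACA [RHS]addrACA [- D x' + _]addrC.
  by rewrite e subrr normr0 mulr0.
have [S SP] := choice surj.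
have Slin : linear S.
  move=> a y z; apply: inj; rewrite SP [D (_ + _)]linearP [j (_ + _)]linearP.
  by rewrite -{1}(SP y) -{1}(SP z) scalerBr scalerDr !scalerA opprD [lam * a]mulrC addrACA.
have Klin : linear (j \o S) by move=> a y z /=; rewrite Slin linearP.
pose K : {linear F -> F} := HB.pack (j \o S) (GRing.isLinear.Build _ _ _ _ _ Klin).
have SK x : S (D x - lam *: j x) = x by apply: inj; rewrite SP.
exists K; split.
- by move=> x; rewrite /= SK.
- by move=> y; exists (S y).
- move=> x y /=; rewrite -{2}(SP x) -{1}(SP y).
  by rewrite (ipBl hip) (ipBr hip) (ipZl hip) (ipZr hip) D_sym.
have SC y : `|S y| <= C * `|y| by rewrite -{2}(SP y).
exists (c * C), ([set C *: z | z in closure (j @` [set x | `|x| <= 1])]); split.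
- by move=> x; rewrite /= (le_trans (jP _)) // -mulrA ler_wpM2l // ltW.
- apply: continuous_compact => //; apply: continuous_subspaceT => z.
  by apply: cvgZr.
move=> x x1; have h (e : R) : `|e| = 1 -> exists2 z,
    closure (j @` [set x | `|x| <= 1]) z & C *: z = e *: K x.
  move=> e1; exists (j ((C^-1 * e) *: S x)); last first.
    by rewrite linearZ /= scalerA mulrA mulfV ?mul1r // gt_eqF.
  apply: subset_closure; exists ((C^-1 * e) *: S x) => //=.
  rewrite normrZ normrM e1 mulr1 gtr0_norm ?invr_gt0 // ler_pdivrMl // mulr1.
  by rewrite (le_trans (SC x)) // ler_piMr // ltW.
split.
- by have [|z Zz zE] := h 1; [rewrite normr1|exists z => //; rewrite zE scale1r].
- by have [|z Zz zE] := h (-1); [rewrite normrN1|exists z => //; rewrite zE scaleN1r].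
Qed.

(** A positive maximum M of the Rayleigh quotient of - K would be attained, giving D the eigenvalue
    lam - 1 / M below lam. Hence K, and with it the form, is nonnegative. *)
Lemma shifted_form_ge0 x : 0 <= ipF (D x - lam *: j x) (j x).
Proof.
have [K [Kj Ksurj Ksym [c [Z [Kb cZ KZ]]]]] := resolvent_operator.
have := @extremal_eigenvector _ _ _ hip (\- K) c Z set0.
case => //=.
- by move=> u v; rewrite (ipNl hip) (ipNr hip) Ksym.
- by move=> u; rewrite normrN.
- by move=> u /KZ [].
move=> M [M0 ML [M00|[{}M0 [z [z0 _ Kz]]]]].
  have := ML (D x - lam *: j x); rewrite M00 mul0r Kj (ipNl hip) oppr_le0 (ipC hip).
  by apply.
have [x' x'z Kx'] := Ksurj z.
have x'0 : x' != 0.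
  by apply: contra z0 => /eqP x'0; rewrite -x'z x'0 !linear0 ?scaler0 ?subr0 ?addr0.
have : lam < lam - M^-1.
  apply: D_gt; apply: (eigenvalue_spectrum x'0).
  have : - j x' = M *: z by rewrite -Kx'.
  move=> /(congr1 ( *:%R M^-1)); rewrite scalerA mulVf ?gt_eqF // scale1r => e.
  by rewrite -(subrK (lam *: j x') (D x')) x'z -e scalerBl addrC scalerN.
by rewrite ltrBrDr gtrDl invr_lt0 ltNge ltW.
Qed.

(** Variational principle: K maps the orthogonal complement of the eigenvectors in L to itself, and
    a positive maximum M of its Rayleigh quotient there corresponds to lam + 1 / M, the lowest
    eigenvalue of D with an eigenvector orthogonal to L. *)
Lemma compressed_eigenvalue (L : set E) :
  (forall v, L v -> exists mu, D v = mu *: j v) ->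
  exists M, [/\ 0 <= M,
    forall x, (forall v, L v -> ipF (j x) (j v) = 0) ->
      ipF (j x) (j x) <= M * ipF (D x - lam *: j x) (j x) &
    M = 0 \/ 0 < M /\ exists z, [/\ z != 0,
      forall v, L v -> ipF (j z) (j v) = 0 & D z = (lam + M^-1) *: j z]].
Proof.
move=> Leig.
have [K [Kj Ksurj Ksym [c [Z [Kb cZ KZ]]]]] := resolvent_operator.
have Kge0 y : 0 <= ipF (K y) y.
  have [x xy Kx] := Ksurj y; rewrite Kx -xy (ipC hip); exact: shifted_form_ge0.
have perp v x : L v -> ipF (j x) (j v) = 0 -> ipF (D x - lam *: j x) (j v) = 0.
  move=> /Leig [mu Dv] xv; rewrite (ipBl hip) (ipZl hip) D_sym Dv (ipZr hip) xv.
  by rewrite !mulr0 subr0.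
have := @extremal_eigenvector _ _ _ hip K c Z (j @` L).
case => //=.
- by move=> x /KZ [].
- move=> y Wy _ [v Lv <-].
  have [mu Dv] := Leig _ Lv.
  have jv : j v = (mu - lam) *: K (j v).
    by rewrite -[LHS]Kj Dv -scalerBl linearZ.
  have [mul|mul] := eqVneq (mu - lam) 0.
    by rewrite jv mul scale0r (ip0r hip).
  have -> : j v = (mu - lam) *: K (j v) by [].
  (* Invariance of the complement: K (j v) = (mu - lam)^-1 j v for v in L. *)
  rewrite Ksym linearZ /= (_ : K (K _) = (mu - lam)^-1 *: K (j v)); last first.
    by rewrite {2}jv linearZ scalerA mulVf // scale1r.
  rewrite scalerA mulfV // scale1r (_ : K (j v) = (mu - lam)^-1 *: j v); last first.
    by rewrite {2}jv scalerA mulVf // scale1r.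
  by rewrite (ipZr hip) Wy ?mulr0 //; exists v.
move=> M [M0 ML Mc]; exists M; split => //.
  move=> x Lx; pose y := D x - lam *: j x.
  have Wy : forall w, (j @` L) w -> ipF y w = 0.
    by move=> _ [v Lv <-]; apply: perp => //; exact: Lx.
  have WKy : forall w, (j @` L) w -> ipF (K y) w = 0.
    by move=> _ [v Lv <-]; rewrite Kj; exact: Lx.
  have bC u v : ipF (K u) v = ipF (K v) u by rewrite Ksym (ipC hip).
  have bl a u v w : ipF (K (a *: u + v)) w = a * ipF (K u) w + ipF (K v) w.
    by rewrite linearP (ip_linear hip).
  (* Cauchy-Schwarz for the form of K: |K y|^4 <= <K y, y> <K K y, K y> <= M <K y, y> |K y|^2. As K
     y = j x, division by |j x|^2 gives the claim. *)
  have cs := psd_cauchy_schwarz bC bl (fun t => Kge0 (t *: K y + y)) (Kge0 (K y)).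
  have h := le_trans cs (ler_wpM2l (Kge0 y) (ML _ WKy)).
  have jx : j x = K y by rewrite Kj.
  rewrite -/y jx (ipC hip y).
  have := ip_ge0 hip (K y); rewrite le_eqVlt => /orP[/eqP <-|pos].
    by rewrite mulr_ge0 // Kge0.
  by move: h; rewrite expr2 mulrA ler_pM2r // mulrC.
case: Mc => [|[{}M0 [z [z0 Wz Kz]]]]; [by left|right; split => //].
have [x xz Kx] := Ksurj z.
have jx : j x = M *: z by rewrite -Kx.
exists x; split.
- by apply: contra z0 => /eqP x0; rewrite -xz x0 !linear0 ?scaler0 ?subr0 ?addr0.
- by move=> v Lv; rewrite jx (ipZl hip) Wz ?mulr0 //; exists v.
- rewrite -(subrK (lam *: j x) (D x)) xz addrC scalerDl; congr (_ + _).
  by rewrite jx scalerA mulVf ?scale1r // gt_eqF.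
Qed.

End Resolvent.
End SymmetricOperators.

(** * Bases and finite systems of eigenvectors *)

(** Stated over finite types because the index sets of the counting argument are disjoint unions and
    subtypes. *)
Lemma kernel_vector {R : realType} (I J : finType) (f : I -> J -> R) :
  (#|J| < #|I|)%N ->
  exists2 c : I -> R, (exists i, c i != 0) & forall k, \sum_i c i * f i k = 0.
Proof.
move=> JI; pose M := \matrix_(i < #|I|, k < #|J|) f (enum_val i) (enum_val k).
have : kermx M != 0.
  rewrite kermx_eq0 /row_free neq_ltn; apply/orP; left.
  exact: leq_ltn_trans (rank_leq_col _) JI.
move=> /rowV0Pn [v /sub_kermxP vM v0].
exists (fun i => v 0 (enum_rank i)).
  by have /existsP [i vi] : [exists i, v 0 i != 0];
    [apply: contra_neqT v0 => /existsPn h; apply/rowP => i; rewrite mxE; exact/eqP/negbNE/h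
    |exists (enum_val i); rewrite enum_valK].
move=> k; have /rowP/(_ (enum_rank k)) := vM; rewrite !mxE => vMk; rewrite -[RHS]vMk.
rewrite (reindex (@enum_val I I)); last first.
  by exists enum_rank => i _; [exact: enum_valK|exact: enum_rankK].
by apply: eq_bigr => i _; rewrite enum_valK mxE enum_rankK.
Qed.

Section Bases.
Context {R : realType} {X : lmodType R}.
Implicit Types (V : set X).

Definition independent (I : finType) (x : I -> X) :=
  forall c : I -> R, \sum_i c i *: x i = 0 -> forall i, c i = 0.

Lemma lincomb_fam n c (x : 'I_n -> X) : lincomb c (fam x) = \sum_i c (val i) *: x i.
Proof.
rewrite /lincomb size_fam; apply: eq_bigr => i _.
by rewrite nth_fam.
Qed.

Lemma extend_ord n (c : 'I_n -> R) : exists c' : nat -> R, forall i : 'I_n, c' i = c i.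
Proof.
exists (fun i => if insub i is Some k then c k else 0) => i.
by rewrite valK.
Qed.

Lemma basis_famP V n (x : 'I_n -> X) : basis V (fam x) <->
  (forall v, V v <-> exists c : 'I_n -> R, v = \sum_i c i *: x i) /\ independent x.
Proof.
split=> [[sp ind]|[sp ind]]; split.
- move=> v; rewrite sp; split=> [[c ->]|[c ->]].
    by exists (fun i => c (val i)); rewrite lincomb_fam.
  have [c' c'E] := extend_ord c; exists c'; rewrite lincomb_fam.
  by apply: eq_bigr => i _; rewrite c'E.
- move=> c; have [c' c'E] := extend_ord c => h i.
  rewrite -c'E; apply: (ind c') => //; last by rewrite size_fam.
  by rewrite lincomb_fam -[RHS]h; apply: eq_bigr => k _; rewrite c'E.
- move=> v; rewrite sp; split=> [[c ->]|[c ->]].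
    have [c' c'E] := extend_ord c; exists c'; rewrite lincomb_fam.
    by apply: eq_bigr => i _; rewrite c'E.
  by exists (fun i => c (val i)); rewrite lincomb_fam.
- move=> c; rewrite lincomb_fam size_fam => /ind h i lti.
  exact: (h (Ordinal lti)).
Qed.

Lemma basis_fam V s n : basis V s -> size s = n ->
  exists x : 'I_n -> X, s = fam x.
Proof. by move=> bs <-; exists (fun i => s`_i); rewrite fam_nth. Qed.

Lemma independent_le (I J : finType) (x : I -> X) (y : J -> X) :
  independent x -> (forall i, exists c : J -> R, x i = \sum_k c k *: y k) ->
  (#|I| <= #|J|)%N.
Proof.
move=> ind /choice [f fE]; rewrite leqNgt; apply/negP => /(kernel_vector f) [c [i ci] cf].
move/eqP: ci; apply; apply: ind.
under eq_bigr do rewrite fE scaler_sumr.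
rewrite exchange_big /= big1 // => k _.
under eq_bigr do rewrite scalerA.
by rewrite -scaler_suml cf scale0r.
Qed.

Lemma basis_mem V n (x : 'I_n -> X) : basis V (fam x) -> forall i, V (x i).
Proof.
move=> /basis_famP [sp _] i; apply/sp; exists (fun k => (k == i)%:R).
rewrite (bigD1 i) //= eqxx scale1r big1 ?addr0 // => k /negbTE ->.
by rewrite scale0r.
Qed.

Lemma basis_size V s t : basis V s -> basis V t -> size s = size t.
Proof.
suff H s' t' : basis V s' -> basis V t' -> (size s' <= size t')%N.
  by move=> bs bt; apply/eqP; rewrite eqn_leq !H.
move=> bs bt.
have [x xE] := basis_fam bs erefl; have [y yE] := basis_fam bt erefl.
rewrite xE in bs; rewrite yE in bt.
have [_ ind] := (basis_famP _ _).1 bs.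
have [sp _] := (basis_famP _ _).1 bt.
have := @independent_le _ _ x y ind; rewrite !card_ord; apply.
by move=> i; apply/sp; exact: (basis_mem bs).
Qed.

Lemma matrix_of_family n m (x : 'I_n -> X) (y : 'I_m -> X) :
  (forall i, exists c : 'I_n -> R, y i = \sum_k c k *: x k) ->
  exists P : 'M[R]_(m, n), forall i, y i = \sum_k P i k *: x k.
Proof.
move=> /choice [f fE]; exists (\matrix_(i, k) f i k) => i.
by rewrite fE; apply: eq_bigr => k _; rewrite mxE.
Qed.

Lemma independent_det n (x y : 'I_n -> X) (P : 'M[R]_n) :
  (forall i, y i = \sum_k P i k *: x k) -> independent y -> \det P != 0.
Proof.
move=> yE ind; apply/negP => /eqP/eqP/det0P [v v0 vP].
move/eqP: v0; apply; apply/rowP => i; rewrite mxE.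
apply: (ind (fun i => v 0 i)).
under eq_bigr do rewrite yE scaler_sumr.
rewrite exchange_big /= big1 // => k _.
under eq_bigr do rewrite scalerA.
rewrite -scaler_suml; have /rowP/(_ k) := vP; rewrite !mxE => ->.
by rewrite scale0r.
Qed.

Lemma basis_change V n (x y : 'I_n -> X) : basis V (fam x) -> basis V (fam y) ->
  exists2 P : 'M[R]_n, \det P != 0 & forall i, y i = \sum_k P i k *: x k.
Proof.
move=> bx by_; have [sp _] := (basis_famP _ _).1 bx.
have [P PE] : exists P : 'M[R]_n, forall i, y i = \sum_k P i k *: x k.
  by apply: matrix_of_family => i; apply/sp; exact: (basis_mem by_).
exists P => //; apply: (independent_det PE).
by have [] := (basis_famP _ _).1 by_.
Qed.

Lemma basis_zero V s : basis V s -> V 0.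
Proof.
move=> [sp _]; apply/sp; exists (fun=> 0).
by rewrite /lincomb big1 // => i _; rewrite scale0r.
Qed.

Lemma basis_linear V s a u v : basis V s -> V u -> V v -> V (a *: u + v).
Proof.
move=> [sp _] /sp [c ->] /sp [d ->]; apply/sp; exists (fun i => a * c i + d i).
rewrite /lincomb scaler_sumr -big_split; apply: eq_bigr => i _ /=.
by rewrite scalerDl scalerA.
Qed.

Lemma lincomb_cat c (s t : seq X) :
  lincomb c (s ++ t) = lincomb c s + lincomb (fun i => c (size s + i)%N) t.
Proof.
rewrite /lincomb size_cat big_split_ord /=; congr (_ + _); apply: eq_bigr => i _.
  by rewrite nth_cat ltn_ord.
by rewrite nth_cat ltnNge leq_addr addKn.
Qed.

Lemma basis_cat U V W s t : basis V s -> basis W t ->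
  (forall u, U u <-> exists v w, [/\ V v, W w & u = v + w]) ->
  (forall v w, V v -> W w -> v + w = 0 -> v = 0 /\ w = 0) -> basis U (s ++ t).
Proof.
move=> [sps inds] [spt indt] Uvw dir; split.
  move=> u; rewrite Uvw; split=> [[v [w [/sps [c ->] /spt [d ->] ->]]]|[c ->]].
    exists (fun i => if (i < size s)%N then c i else d (i - size s)%N).
    rewrite lincomb_cat; congr (_ + _); apply: eq_bigr => i _ /=.
      by rewrite ltn_ord.
    by rewrite ltnNge leq_addr addKn.
  rewrite lincomb_cat; do 2 eexists; split; last by [].
    by apply/sps; exists c.
  by apply/spt; eexists.
move=> c; rewrite lincomb_cat => /dir [||s0 t0].
- by apply/sps; exists c.
- by apply/spt; eexists.
move=> i; rewrite size_cat; have [lt _|ge lt] := ltnP i (size s); first exact: inds.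
have := indt _ t0 (i - size s)%N; rewrite subnKC //; apply.
by rewrite ltn_subLR.
Qed.

End Bases.

Section EigenBasis.
Context {R : realType} {E F : completeNormedModType R} (ipF : F -> F -> R).
Hypothesis hip : inner_product ipF.
Variable j : {linear E -> F}.
Hypothesis j_inj : injective j.
Hypothesis j_compact : compact_operator j.
Variables (D : {linear E -> F}) (lam b : R) (S : set R).
Hypothesis D_cont : continuous D.
Hypothesis D_sym : symmetric ipF j D.
Hypothesis lam_reg : ~ spectrum j D lam.
Hypothesis S_bound : forall mu, S mu -> spectrum j D mu -> `|mu - lam| <= b.

Let eigen x := exists2 mu, S mu & D x = mu *: j x.

Definition orthonormal_list (s : seq E) := forall i k,
  (i < size s)%N -> (k < size s)%N -> ipF (j s`_i) (j s`_k) = (i == k)%:R.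

Definition eigen_list (s : seq E) :=
  (forall i, (i < size s)%N -> eigen s`_i) /\ orthonormal_list s.

Lemma eigen_orthogonal x y mu nu : D x = mu *: j x -> D y = nu *: j y ->
  mu != nu -> ipF (j x) (j y) = 0.
Proof.
move=> Dx Dy ne; have := D_sym x y; rewrite Dx Dy (ipZl hip) (ipZr hip) => /eqP.
by rewrite -subr_eq0 -mulrBl mulf_eq0 subr_eq0 (negbTE ne) => /eqP.
Qed.

Lemma eigen_list_nil : eigen_list [::].
Proof. by split. Qed.

(** The resolvent estimate applied to D x - lam j x = (mu - lam) j x, whose factor is bounded by
    b. *)
Lemma unit_eigen_bounded : exists2 c, 0 < c & forall x, eigen x ->
  ipF (j x) (j x) = 1 -> `|x| <= c.
Proof.
have [_ [C C0 bnd]] := resolvent j_compact D_cont lam_reg.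
exists (C * (`|b| + 1)); first by rewrite mulr_gt0 // ltr_wpDl.
move=> x [mu Smu Dx] x1; rewrite (le_trans (bnd _)) // ler_wpM2l ?(ltW C0) //.
rewrite Dx -scalerBl normrZ.
have -> : `|j x| = 1.
  by apply/eqP; rewrite -(@eqrXn2 _ 2) // (ip_norm hip) x1 expr1n.
have xn0 : x != 0.
  by apply/eqP => x0; move: x1; rewrite x0 linear0 (ip0l hip) => /eqP; rewrite eq_sym oner_eq0.
have Sm := S_bound Smu (eigenvalue_spectrum xn0 Dx).
by rewrite mulr1 (le_trans Sm) // (le_trans (ler_norm b)) // lerDl.
Qed.

(* Otherwise one could extend forever, giving an infinite orthonormal family with
   bounded E-norm, against compactness of the inclusion. *)
Lemma maximal_eigen_list : exists2 s, eigen_list s &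
  forall x, eigen x -> ipF (j x) (j x) = 1 -> exists2 i, (i < size s)%N & ipF (j x) (j s`_i) != 0.
Proof.
apply: contrapT => nex.
have ext s : exists x, eigen_list s -> [/\ eigen x, ipF (j x) (j x) = 1 &
    forall i, (i < size s)%N -> ipF (j x) (j s`_i) = 0].
  have [es|] := pselect (eigen_list s); last by exists 0.
  apply: contrapT => /forallNP h; apply: nex; exists s => // x ex x1.
  apply: contrapT => /forall2NP hi; apply: (h x) => _; split => // i lti.
  by case: (hi i) => [//|/negP/negPn/eqP].
have [g gP] := choice ext.
pose s := fix s n := if n is n'.+1 then rcons (s n') (g (s n')) else [::].
pose u n := g (s n).
have ssize n : size (s n) = n by elim: n => //= n IH; rewrite size_rcons IH.
have snth m n : (m < n)%N -> (s n)`_m = u m.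
  elim: n => // n IH; rewrite ltnS leq_eqVlt /= nth_rcons ssize => /orP[/eqP ->|mn].
    by rewrite ltnn eqxx.
  by rewrite mn IH.
have sgood n : eigen_list (s n).
  elim: n => [|n IH]; first exact: eigen_list_nil.
  have [en n1 no] := gP _ IH.
  have sn m : (m <= n)%N -> (s n.+1)`_m = u m by exact: (snth m n.+1).
  split=> [i|i k]; rewrite ssize ltnS.
    rewrite leq_eqVlt => /orP[/eqP ->|lt]; first by rewrite sn.
    by rewrite (sn _ (ltnW lt)) -(snth i n lt); apply: IH.1; rewrite ssize.
  rewrite ltnS leq_eqVlt => /orP[/eqP ->|lti]; rewrite leq_eqVlt => /orP[/eqP ->|ltk].
  - by rewrite !sn // eqxx.
  - rewrite (sn n) // (sn _ (ltnW ltk)) -(snth k n ltk) no ?ssize //.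
    by rewrite gtn_eqF.
  - rewrite (sn n) // (sn _ (ltnW lti)) -(snth i n lti) (ipC hip) no ?ssize //.
    by rewrite ltn_eqF.
  - rewrite (sn _ (ltnW lti)) (sn _ (ltnW ltk)) -(snth i n lti) -(snth k n ltk).
    by apply: IH.2; rewrite ssize.
have uP n : [/\ eigen (u n), ipF (j (u n)) (j (u n)) = 1 &
    forall i, (i < n)%N -> ipF (j (u n)) (j (u i)) = 0].
  have [? ? h] := gP _ (sgood n); split => // i lti.
  by rewrite -(snth _ _ lti); apply: h; rewrite ssize.
have [c c0 uc] := unit_eigen_bounded.
have Zu n : closure (j @` [set x | `|x| <= 1]) (j (c^-1 *: u n)).
  apply: subset_closure; exists (c^-1 *: u n) => //=.
  rewrite normrZ gtr0_norm ?invr_gt0 // ler_pdivrMl // mulr1.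
  by have [? ? _] := uP n; exact: uc.
have [z zP] := compact_subsequence j_compact Zu.
(* Two terms within 1 / (2 c) of z are less than 1 / c apart, whereas orthonormal vectors scaled by
   1 / c have distance sqrt 2 / c. *)
pose e := (2 * c)^-1; have e0 : 0 < e by rewrite invr_gt0 mulr_gt0.
have [n _ zn] := zP e e0 0%N.
have [m nm zm] := zP e e0 n.+1.
have : `|j (c^-1 *: u m) - j (c^-1 *: u n)| < c^-1.
  have ce : c^-1 = e + e by rewrite /e; field; rewrite gt_eqF.
  rewrite [ltRHS]ce.
  have -> : j (c^-1 *: u m) - j (c^-1 *: u n) =
      (j (c^-1 *: u m) - z) + (z - j (c^-1 *: u n)) by rewrite addrA subrK.
  by apply: (le_lt_trans (ler_normD _ _)); apply: ltrD => //; rewrite distrC.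
rewrite [j (_ *: u m)]linearZ [j (_ *: u n)]linearZ /= -scalerBr normrZ gtr0_norm ?invr_gt0 // -[ltRHS]mulr1 ltr_pM2l ?invr_gt0 //.
rewrite -(@ltr_pXn2r _ 2) ?nnegrE // (ip_norm hip) expr1n.
have [_ m1 mo] := uP m; have [_ n1 _] := uP n.
rewrite (ipBl hip) !(ipBr hip) m1 n1 (ipC hip (j (u n))) mo //.
by lra.
Qed.

(** Subtracting from an eigenvector its projection onto a maximal list leaves an eigenvector for the
    same eigenvalue, because list members with other eigenvalues do not contribute. It is orthogonal
    to the list, so it vanishes by maximality. *)
Lemma eigen_basis : exists2 s, eigen_list s & basis (eigen_sum j S D) s.
Proof.
have [s es smax] := maximal_eigen_list; exists s => //.
pose x (i : 'I_(size s)) := s`_i.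
have xo i k : ipF (j (x i)) (j (x k)) = (i == k)%:R by rewrite es.2.
have /choice [mu muP] i : exists m, S m /\ D (x i) = m *: j (x i).
  by have [m ? ?] := es.1 i (ltn_ord i); exists m.
have span v : eigen v -> exists c : 'I_(size s) -> R, v = \sum_i c i *: x i.
  move=> [nu Snu Dv]; pose c i := ipF (j v) (j (x i)); exists c.
  apply/eqP; rewrite -subr_eq0; apply/negPn/negP => u0.
  set u := v - _ in u0.
  have Du : D u = nu *: j u.
    rewrite /u [D _]linearB [j (_ - _)]linearB /= Dv scalerBr; congr (_ - _).
    rewrite [D _]linear_sum [j _]linear_sum scaler_sumr.
    apply: eq_bigr => i _; rewrite [D _]linearZ [j _]linearZ /= (muP i).2 !scalerA mulrC.
    have [->//|ne] := eqVneq (mu i) nu.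
    rewrite /c (eigen_orthogonal Dv (muP i).2) ?mulr0 ?mul0r ?scale0r //.
    by rewrite eq_sym.
  have uo i : ipF (j u) (j (x i)) = 0.
    rewrite /u linearB (ipBl hip) linear_sum (ip_suml hip) (bigD1 i) //=.
    rewrite linearZ (ipZl hip) xo eqxx mulr1 big1 ?addr0 ?subrr // => k /negbTE ki.
    by rewrite linearZ (ipZl hip) xo ki mulr0.
  have ju : j u != 0 by rewrite -(linear0 j) (inj_eq j_inj).
  have nu0 : 0 < `|j u| by rewrite normr_gt0.
  have [||i lti] := smax (`|j u|^-1 *: u).
  - by exists nu => //; rewrite [D (_ *: _)]linearZ [j (_ *: _)]linearZ /= Du !scalerA mulrC.
  - rewrite linearZ (ipZl hip) (ipZr hip) -(ip_norm hip); field.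
    by rewrite gt_eqF.
  - by rewrite linearZ (ipZl hip) (uo (Ordinal lti)) mulr0 eqxx.
rewrite -[s]fam_nth; apply/basis_famP; split.
- move=> v; split.
    move=> [t [c [tS ->]]].
    have /choice [f fE] : forall k : 'I_(size t), exists c, t`_k = \sum_i c i *: x i.
      by move=> k; apply: span; exact: tS.
    exists (fun i => \sum_(k < size t) c k * f k i).
    rewrite /lincomb; under eq_bigr do rewrite fE scaler_sumr.
    rewrite exchange_big; apply: eq_bigr => i _ /=.
    by rewrite scaler_suml; apply: eq_bigr => k _; rewrite scalerA.
  move=> [c ->]; have [c' c'E] := extend_ord c; exists s, c'; split; first exact: es.1.
  by apply: eq_bigr => i _; rewrite c'E.
- move=> c h i; have := congr1 (fun v => ipF (j v) (j (x i))) h.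
  rewrite linear0 (ip0l hip) linear_sum (ip_suml hip) (bigD1 i) //=.
  rewrite linearZ (ipZl hip) xo eqxx mulr1 big1 ?addr0 // => k /negbTE ki.
  by rewrite linearZ (ipZl hip) xo ki mulr0.
Qed.

End EigenBasis.

(** * Perturbation of the form of a symmetric operator *)

(** If v 0 = 1 + d with d > 0, repeated squaring gives v n >= 1 + (n + 1) d, which is unbounded. *)
Lemma squaring_bounded_le1 {R : realType} (v : nat -> R) Q :
  (forall n, v n ^+ 2 <= v n.+1) -> (forall n, v n <= Q) -> v 0%N <= 1.
Proof.
move=> vsq vQ; rewrite leNgt; apply/negP => v0; pose d := v 0%N - 1.
have d0 : 0 < d by rewrite subr_gt0.
have vge n : 1 + n.+1%:R * d <= v n.
  elim: n => [|n IH]; first by rewrite /d mul1r addrC subrK.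
  apply: le_trans (vsq n); have h : 0 <= n.+1%:R * d by rewrite mulr_ge0 // ltW.
  have : (1 + n.+1%:R * d) ^+ 2 <= v n ^+ 2.
    by rewrite ler_pXn2r ?nnegrE ?addr_ge0 // (le_trans _ IH) // addr_ge0.
  apply: le_trans; rewrite sqrrD expr1n mul1r.
  have -> : n.+2%:R * d = n.+1%:R * d + d by rewrite -addn1 natrD mulrDl mul1r.
  have : d <= n.+1%:R * d by rewrite ler_pMl // ler1n.
  have := sqr_ge0 (n.+1%:R * d); move: (n.+1%:R * d) h => e; lra.
have := vge (Num.truncn (Q / d)); apply/negP; rewrite -ltNge.
apply: (le_lt_trans (vQ _)); rewrite ltr_wpDl //.
by rewrite -ltr_pdivrMr // truncnS_gt.
Qed.

Section Forms.
Context {R : realType} {E F : completeNormedModType R} (ipF : F -> F -> R).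
Hypothesis hip : inner_product ipF.
Variable j : {linear E -> F}.
Hypothesis j_inj : injective j.
Hypothesis j_compact : compact_operator j.
Implicit Types D T : {linear E -> F}.

Lemma form_suml D (I : finType) (c : I -> R) (x : I -> E) y :
  ipF (D (\sum_i c i *: x i)) y = \sum_i c i * ipF (D (x i)) y.
Proof.
rewrite linear_sum (ip_suml hip); apply: eq_bigr => i _.
by rewrite linearZ (ipZl hip).
Qed.

Lemma form_sumr (I : finType) (c : I -> R) (x : I -> E) y :
  ipF y (j (\sum_i c i *: x i)) = \sum_i c i * ipF y (j (x i)).
Proof. by rewrite (ipC hip) form_suml; apply: eq_bigr => i _; rewrite (ipC hip). Qed.

Lemma diagonal_form D (I : finType) (p : I -> E) (d c : I -> R) :
  (forall i k, ipF (D (p i)) (j (p k)) = if i == k then d i else 0) ->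
  ipF (D (\sum_i c i *: p i)) (j (\sum_i c i *: p i)) = \sum_i c i ^+ 2 * d i.
Proof.
move=> pd; rewrite form_suml; apply: eq_bigr => i _.
rewrite form_sumr (bigD1 i) //= pd eqxx big1 ?addr0 => [|k /negbTE ki].
  by rewrite mulrA expr2.
by rewrite pd eq_sym ki mulr0.
Qed.

(* Reid's inequality: the symmetric perturbation D - T is the operator C = (T - lam)^-1 (D - T)
   in the inner product [x, y] = <(T - lam) x, y>, whose form is bounded by the E-norm of C
   because [C^(2^n) x, x] grows at least like the 2^n-th power of [C x, x]. *)
Lemma form_perturbation T lam : continuous T -> symmetric ipF j T ->
  (forall mu, spectrum j T mu -> lam < mu) ->
  exists2 C, 0 < C & forall D e, symmetric ipF j D -> 0 < e ->
    (forall x, `|D x - T x| <= e * `|x|) ->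
    forall x, `|ipF (D x - T x) (j x)| <= C * e * ipF (T x - lam *: j x) (j x).
Proof.
move=> T_cont T_sym T_gt.
have lam_reg : ~ spectrum j T lam by move=> /T_gt; rewrite ltxx.
have [surj [C C0 bnd]] := resolvent j_compact T_cont lam_reg.
have [S SP] := choice surj.
exists C => // D e D_sym e0 DT x; set k := C * e.
have k0 : 0 < k by rewrite mulr_gt0.
pose b u v := ipF (T u - lam *: j u) (j v).
have bC u v : b u v = b v u.
  by rewrite /b !(ipBl hip) !(ipZl hip) T_sym (ipC hip (j u)) (ipC hip (j u)).
have bl a u v w : b (a *: u + v) w = a * b u w + b v w.
  rewrite /b !(ipBl hip) !(ipZl hip) [T _]linearP [j (_ + _)]linearP !(ip_linear hip).
  by ring.
have b0 u : 0 <= b u u by exact: (@shifted_form_ge0 _ _ _ _ hip _ j_compact T).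
(* [G] is (T - lam)^-1 (D - T) and [b] the energy form of T - lam, for which [G] is symmetric. The
   resolvent bound [C] gives [G] norm at most k = C e in E. *)
pose G u := S (D u - T u).
have Gb u v : b (G u) v = ipF (D u - T u) (j v) by rewrite /b SP.
have Gadj u v : b (G u) v = b u (G v).
  rewrite (bC u) !Gb !(ipBl hip) (D_sym u) (T_sym u).
  by rewrite (ipC hip (D v)) (ipC hip (T v)).
have Gn u : `|G u| <= k * `|u|.
  by rewrite (le_trans (bnd _)) // SP /k -mulrA ler_wpM2l // ltW.
have itn m : `|iter m G x| <= k ^+ m * `|x|.
  elim: m => [|m IH]; first by rewrite mul1r.
  by rewrite iterS (le_trans (Gn _)) // exprS -mulrA ler_wpM2l // ltW.
have itadj m u v : b (iter m G u) v = b u (iter m G v).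
  by elim: m u v => // m IH u v; rewrite iterS Gadj IH -iterSr.
pose w n := b (iter (2 ^ n) G x) x.
(* Cauchy-Schwarz and symmetry: b(G^m x, x)^2 <= b(G^m x, G^m x) b(x, x) = b(G^(2 m) x, x) b(x, x),
   with m = 2^n. *)
have wsq n : w n ^+ 2 <= w n.+1 * b x x.
  have := psd_cauchy_schwarz bC bl (x := iter (2 ^ n) G x) (y := x) (fun t => b0 _) (b0 _).
  by rewrite -itadj -iterD addnn -mul2n -expnS.
have [cT cT1 Tb] := linear_bound T_cont.
have [cj cj0 jb] := inclusion_bound j_compact.
have wb n : `|w n| <= (C + cT + `|lam| * cj) * cj * `|x| ^+ 2 * k ^+ (2 ^ n).
  rewrite (le_trans (cauchy_schwarz hip _ _)) //.
  have -> : (C + cT + `|lam| * cj) * cj * `|x| ^+ 2 * k ^+ (2 ^ n) =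
      ((C + cT + `|lam| * cj) * (k ^+ (2 ^ n) * `|x|)) * (cj * `|x|) by ring.
  have cT0 : 0 <= C + cT + `|lam| * cj.
    by rewrite !addr_ge0 ?(ltW C0) ?(ltW cT1) // mulr_ge0 // ltW.
  apply: ler_pM => //; apply: (@le_trans _ _ ((C + cT + `|lam| * cj) * `|iter (2 ^ n) G x|)).
    rewrite (le_trans (ler_normB _ _)) // mulrDl lerD //.
      by rewrite (le_trans (Tb _)) // ler_wpM2r // lerDr ltW.
    by rewrite normrZ -mulrA ler_wpM2l.
  by rewrite ler_wpM2l.
have [a0|a0] := eqVneq (b x x) 0.
  have := wsq 0%N; rewrite a0 mulr0 => h.
  have : w 0%N ^+ 2 == 0 by rewrite eq_le h sqr_ge0.
  rewrite sqrf_eq0 /w expn0 /= Gb => /eqP ->.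
  by rewrite normr0; apply: mulr_ge0; [exact: ltW|exact: b0].
have ap : 0 < b x x by rewrite lt_def a0 b0.
have kp n : 0 < k ^+ n by rewrite exprn_gt0.
(* Normalised so that v n ^ 2 <= v (n + 1), while the E-norm bound for the powers of [G] keeps v
   bounded. Then v 0 <= 1 is the claim. *)
pose v n := `|w n| / (k ^+ (2 ^ n) * b x x).
have := @squaring_bounded_le1 _ v ((C + cT + `|lam| * cj) * cj * `|x| ^+ 2 / b x x).
have v0E : v 0%N = `|ipF (D x - T x) (j x)| / (k * b x x) by rewrite /v /w expn0 expr1 /= Gb.
rewrite v0E ler_pdivrMr ?mulr_gt0 // mul1r; apply.
- move=> n; rewrite /v expnS mul2n -addnn exprD; set K := k ^+ (2 ^ n).
  have K0 : 0 < K by exact: kp.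
  rewrite ler_pdivlMr ?mulr_gt0 //.
  have -> : (`|w n| / (K * b x x)) ^+ 2 * (K * K * b x x) = `|w n| ^+ 2 / b x x.
    by field; rewrite a0 gt_eqF.
  rewrite ler_pdivrMr // real_normK ?num_real // (le_trans (wsq n)) //.
  by rewrite ler_wpM2r ?(ltW ap) // ler_norm.
- move=> n; rewrite /v ler_pdivrMr ?mulr_gt0 // (le_trans (wb n)) //.
  by rewrite le_eqVlt; apply/orP; left; apply/eqP; field.
Qed.

End Forms.

(** * The negative index *)

Section Inertia.
Context {R : realType} {E F : completeNormedModType R} (ipF : F -> F -> R).
Hypothesis hip : inner_product ipF.
Variable j : {linear E -> F}.
Hypothesis j_inj : injective j.
Hypothesis j_compact : compact_operator j.
Implicit Types D T : {linear E -> F}.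

Definition eigen_frame (S : set R) D n (v : 'I_n -> E) (mu : 'I_n -> R) :=
  [/\ forall i, S (mu i), forall i, D (v i) = mu i *: j (v i),
      forall i k, ipF (j (v i)) (j (v k)) = (i == k)%:R &
      basis (eigen_sum j S D) (fam v)].

Lemma eigen_frame_exists D lam b S : continuous D -> symmetric ipF j D ->
  ~ spectrum j D lam -> (forall mu, S mu -> spectrum j D mu -> `|mu - lam| <= b) ->
  exists n (v : 'I_n -> E) mu, eigen_frame S D v mu.
Proof.
move=> D_cont D_sym lam_reg Sb.
have [s [es so] bs] := eigen_basis hip j_inj j_compact D_cont D_sym lam_reg Sb.
have /choice [mu muP] (i : 'I_(size s)) : exists m, S m /\ D (s`_i) = m *: j (s`_i).
  by have [m ? ?] := es i (ltn_ord i); exists m.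
exists (size s), (fun i => s`_i), mu; split.
- by move=> i; have [] := muP i.
- by move=> i; have [] := muP i.
- by move=> i k; rewrite so.
- by rewrite fam_nth.
Qed.

Lemma eigen_mem S D n (v : 'I_n -> E) mu x nu : eigen_frame S D v mu ->
  S nu -> D x = nu *: j x -> (forall i, ipF (j x) (j (v i)) = 0) -> x = 0.
Proof.
move=> [_ _ _ /basis_famP [sp _]] Snu Dx xv.
have /sp [c xE] : eigen_sum j S D x.
  exists [:: x], (fun=> 1); split; last by rewrite /lincomb big_ord1 scale1r.
  by case=> // _; exists nu.
apply: j_inj; rewrite linear0; apply: (ip_eq0 hip).
by rewrite {2}xE (form_sumr hip) big1 // => i _; rewrite xv mulr0.
Qed.

Lemma eigen_frame_diag S D n (v : 'I_n -> E) mu : eigen_frame S D v mu ->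
  forall i k, ipF (D (v i)) (j (v k)) = if i == k then mu i else 0.
Proof.
move=> [_ Dv vo _] i k; rewrite Dv (ipZl hip) vo.
by case: eqP; rewrite ?mulr1 ?mulr0.
Qed.

Lemma form_orthogonal D x y : symmetric ipF j D -> ipF (D x) (j y) = 0 ->
  ipF (D (x + y)) (j (x + y)) = ipF (D x) (j x) + ipF (D y) (j y).
Proof.
move=> D_sym xy; rewrite [D (_ + _)]linearD [j (_ + _)]linearD (ipDl hip) !(ipDr hip) xy addr0.
by rewrite (symmetricC hip y x D_sym) xy add0r.
Qed.

Section Positivity.
Variables (D : {linear E -> F}) (lam : R).
Hypothesis lam0 : lam < 0.
Hypothesis D_cont : continuous D.
Hypothesis D_sym : symmetric ipF j D.
Hypothesis D_gt : forall mu, spectrum j D mu -> lam < mu.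

Lemma negative_frame : exists n (v : 'I_n -> E) mu, eigen_frame [set l | l < 0] D v mu.
Proof.
apply: (@eigen_frame_exists D lam (- lam)) => //; first by move=> /D_gt; rewrite ltxx.
move=> mu /= mu0 /D_gt lmu; rewrite gtr0_norm ?subr_gt0 //; lra.
Qed.

Lemma form_shift x : ipF (D x) (j x) =
  ipF (D x - lam *: j x) (j x) + lam * ipF (j x) (j x).
Proof. by rewrite (ipBl hip) (ipZl hip) subrK. Qed.

(** Otherwise the lowest eigenvalue lam + 1 / M orthogonal to the frame would be negative, and its
    eigenvector would lie in the span of the frame. *)
Lemma form_ge0_off_negative n (v : 'I_n -> E) mu x :
  eigen_frame [set l | l < 0] D v mu ->
  (forall i, ipF (j x) (j (v i)) = 0) -> 0 <= ipF (D x) (j x).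
Proof.
move=> fv xv; have [mu0 Dv _ _] := fv.
have [|M [M0 ML Mc]] := compressed_eigenvalue hip j_compact D_cont D_sym D_gt (L := range v).
  by move=> _ [i _ <-]; exists (mu i).
have h := ML x _; rewrite form_shift.
have {}h : ipF (j x) (j x) <= M * ipF (D x - lam *: j x) (j x).
  by apply: h => _ [i _ <-].
have xx := shifted_form_ge0 hip j_compact D_cont D_sym D_gt x.
suff Ml : - lam * M <= 1.
  have : - lam * ipF (j x) (j x) <= - lam * M * ipF (D x - lam *: j x) (j x).
    by rewrite -mulrA ler_wpM2l // oppr_ge0 ltW.
  have : - lam * M * ipF (D x - lam *: j x) (j x) <= ipF (D x - lam *: j x) (j x).
    by rewrite ler_piMl.
  lra.
case: Mc => [->|[Mp [z [z0 zv Dz]]]]; first by rewrite mulr0.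
rewrite leNgt; apply/negP => lM; move/eqP: z0; apply.
apply: (eigen_mem fv _ Dz) => [/=|i]; last by apply: zv; exists i.
by move: lM; rewrite -ltr_pdivrMr // div1r; lra.
Qed.

(** Once the kernel is excluded too, lam + 1 / M is strictly positive and c = 1 + lam M works. The
    bound is by the energy form, not by the norm of F, so that it can absorb the perturbation D -
    T. *)
Lemma form_gap n (v : 'I_n -> E) mu : eigen_frame [set l | l < 0] D v mu ->
  exists2 c, 0 < c & forall x, (forall i, ipF (j x) (j (v i)) = 0) ->
    (forall y, ker D y -> ipF (j x) (j y) = 0) ->
    c * ipF (D x - lam *: j x) (j x) <= ipF (D x) (j x).
Proof.
move=> fv; have [mu0 Dv _ _] := fv.
have [|M [M0 ML Mc]] := compressed_eigenvalue hip j_compact D_cont D_sym D_gt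
    (L := range v `|` ker D).
  move=> y [[i _ <-]|Dy]; first by exists (mu i).
  by exists 0; rewrite scale0r.
have Ml : - lam * M < 1.
  case: Mc => [->|[Mp [z [z0 zv Dz]]]]; first by rewrite mulr0.
  rewrite ltNge; apply/negP => lM; move/eqP: (z0); apply.
  have : lam + M^-1 <= 0.
    by rewrite -ler_pdivrMr // div1r in lM; lra.
  rewrite le_eqVlt => /orP[/eqP l0|neg].
    have zk : ker D z by rewrite /ker /= Dz l0 scale0r.
    by apply: j_inj; rewrite linear0; apply: (ip_eq0 hip); apply: zv; right.
  by apply: (eigen_mem fv neg Dz) => i; apply: zv; left; exists i.
exists (1 - - lam * M); first by rewrite subr_gt0.
move=> x xv xk.
have h : ipF (j x) (j x) <= M * ipF (D x - lam *: j x) (j x).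
  by apply: ML => y [[i _ <-]|/xk].
rewrite [leRHS]form_shift.
have : - lam * ipF (j x) (j x) <= - lam * M * ipF (D x - lam *: j x) (j x).
  by rewrite -mulrA ler_wpM2l // oppr_ge0 ltW.
lra.
Qed.

End Positivity.

(** A sum of inverses in place of a minimum also covers the empty family. *)
Lemma negative_family_bound n (mu : 'I_n -> R) : (forall i, mu i < 0) ->
  exists2 g, 0 < g & forall i, mu i <= - g.
Proof.
move=> mu0; pose s := 1 + \sum_i (- mu i)^-1.
have inv_ge0 i : 0 <= (- mu i)^-1 by rewrite invr_ge0 oppr_ge0 ltW.
have s0 : 0 < s by rewrite ltr_pwDl // sumr_ge0.
exists s^-1 => [|i]; first by rewrite invr_gt0.
rewrite lerNr -[leRHS]invrK lef_pV2 ?posrE ?invr_gt0 ?oppr_gt0 //.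
rewrite /s (bigD1 i) //= addrCA lerDl addr_ge0 // sumr_ge0 // => k _.
Qed.

Section Counting.
Variables (T : {linear E -> F}) (lam : R).
Hypothesis lam0 : lam < 0.
Hypothesis T_cont : continuous T.
Hypothesis T_sym : symmetric ipF j T.
Hypothesis T_gt : forall mu, spectrum j T mu -> lam < mu.
Variables (nT : nat) (vT : 'I_nT -> E) (muT : 'I_nT -> R).
Hypothesis fvT : eigen_frame [set l | l < 0] T vT muT.
Variables (N : nat) (e : 'I_N -> E).
Hypothesis e_ker : basis (ker T) (fam e).

Lemma ker_perp x : (forall a, ipF (j x) (j (e a)) = 0) ->
  forall y, ker T y -> ipF (j x) (j y) = 0.
Proof.
move=> xe y; have [sp _] := (basis_famP _ _).1 e_ker.
by move=> /sp [c ->]; rewrite (form_sumr hip) big1 // => i _; rewrite xe mulr0.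
Qed.

Lemma negative_perp_ker i a : ipF (j (vT i)) (j (e a)) = 0.
Proof.
have [mu0 Tv _ _] := fvT.
have Te : T (e a) = 0 *: j (e a) by rewrite scale0r; exact: (basis_mem e_ker).
by apply: (eigen_orthogonal hip T_sym (Tv i) Te); rewrite lt_eqF // mu0.
Qed.

(* Both inequalities come from the splitting of E into the span of the X a, where the
   form of D is that of the matrix diag(d), the span of vT, where it stays negative, and
   the orthogonal complement of vT and ker T, where it stays nonnegative. *)
Lemma inertia : exists2 del, 0 < del & forall D, symmetric ipF j D -> continuous D ->
  (forall mu, spectrum j D mu -> lam < mu) ->
  (forall x, `|D x - T x| <= del * `|x|) ->
  forall nD (vD : 'I_nD -> E) muD, eigen_frame [set l | l < 0] D vD muD ->
  forall q (p : 'I_q -> E) (d : 'I_q -> R) (X : 'I_N -> E),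
  (forall i k, ipF (D (p i)) (j (p k)) = if i == k then d i else 0) ->
  (forall i, d i != 0) ->
  (forall i u, (forall a, ipF (j u) (j (e a)) = 0) -> ipF (D (p i)) (j u) = 0) ->
  (forall x, (forall a, ipF (j (x - \sum_b ipF (j x) (j (e b)) *: X b)) (j (e a)) = 0)) ->
  (forall a, exists c x0, D x0 = 0 /\ X a = \sum_i c i *: p i + x0) ->
  nD = (nT + #|[pred i | (d i < 0)%R]|)%N.
Proof.
have [muT0 Tv vTo _] := fvT.
have [C C0 CP] := form_perturbation hip j_compact T_cont T_sym T_gt.
have [c c0 cP] := form_gap lam0 T_cont T_sym T_gt fvT.
have [g g0 gP] := negative_family_bound muT0.
have nl : 0 < - lam by rewrite oppr_gt0.
(* k bounds D - T relative to the energy form. With k <= c the gap keeps q_D nonnegative off vT and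
   ker T; with - lam k < g it stays at most - (g + lam k) times the sum of squared coefficients on
   the span of vT. *)
have [k k0 [kc kg]] : exists2 k, 0 < k & k <= c /\ - lam * k < g.
  exists (Num.min c (g / (2 * - lam))).
    by rewrite lt_min c0 divr_gt0 // mulr_gt0 // oppr_gt0.
  split; first by rewrite ge_min lexx.
  rewrite mulrC -ltr_pdivlMr ?oppr_gt0 // gt_min; apply/orP; right.
  by rewrite ltr_pM2l // ltf_pV2 ?posrE ?mulr_gt0 // ltr_pMl // ltr1n.
exists (k / C); first by rewrite divr_gt0.
move=> D D_sym D_cont D_gt DT nD vD muD fvD q p d X pd d0 pQ XQ Xp.
have DTk x : `|ipF (D x - T x) (j x)| <= k * ipF (T x - lam *: j x) (j x).
  have := CP D (k / C) D_sym (divr_gt0 k0 C0) DT x.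
  by rewrite [C * _]mulrC divfK // gt_eqF.
have DTE x : ipF (D x) (j x) = ipF (T x) (j x) + ipF (D x - T x) (j x).
  by rewrite (ipBl hip) addrC subrK.
have Dpos x : (forall i, ipF (j x) (j (vT i)) = 0) -> (forall a, ipF (j x) (j (e a)) = 0) ->
    0 <= ipF (D x) (j x).
  move=> xv xe; have h1 := cP x xv (ker_perp xe).
  have h2 := shifted_form_ge0 hip j_compact T_cont T_sym T_gt x.
  have : k * ipF (T x - lam *: j x) (j x) <= c * ipF (T x - lam *: j x) (j x).
    by rewrite ler_wpM2r.
  by have := DTk x; rewrite DTE ler_norml => /andP[]; lra.
have Dneg (b : 'I_nT -> R) : ipF (D (\sum_i b i *: vT i)) (j (\sum_i b i *: vT i)) <=
    - (g - - lam * k) * \sum_i b i ^+ 2.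
  set x := \sum_i b i *: vT i.
  have qT : ipF (T x) (j x) <= - g * \sum_i b i ^+ 2.
    rewrite (diagonal_form hip _ (eigen_frame_diag fvT)) mulr_sumr ler_sum // => i _.
    by rewrite mulrC ler_wpM2r // sqr_ge0.
  have jx : ipF (j x) (j x) = \sum_i b i ^+ 2.
    rewrite (@diagonal_form _ _ _ _ hip j j _ _ (fun=> 1)); last first.
      by move=> i l; rewrite vTo; case: eqP.
    by apply: eq_bigr => i _; rewrite mulr1.
  have := DTk x; rewrite DTE ler_norml => /andP[_].
  rewrite (ipBl hip (T x)) (ipZl hip) jx.
  have : 0 <= \sum_i b i ^+ 2 by apply: sumr_ge0 => i _; exact: sqr_ge0.
  have : k * ipF (T x) (j x) <= k * (- g * \sum_i b i ^+ 2) by rewrite ler_wpM2l // ltW.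
  have : 0 <= k * g by rewrite mulr_ge0 // ltW.
  move: (\sum_i _) qT => s qT kg0 h1 s0 h2.
  have : 0 <= k * g * s by rewrite mulr_ge0.
  lra.
have [muD0 Dv vDo _] := fvD.
pose I := {i : 'I_q | d i < 0}.
have cardI : #|{: I}| = #|[pred i | d i < 0]| by rewrite card_sig.
apply/eqP; rewrite eqn_leq -cardI; apply/andP; split; rewrite leqNgt; apply/negP => lt.
(* If nD were larger, some nontrivial combination x of the vD would have x - Y x orthogonal to vT
   and <D x, j (p i)> = 0 whenever d i < 0. The parts Y x and x - Y x are orthogonal for q_D and
   both have nonnegative form, but q_D(x) < 0. *)
- pose Y x := \sum_b ipF (j x) (j (e b)) *: X b.
  pose f l (m : 'I_nT + I) := match m with
    | inl m => ipF (j (vD l - Y (vD l))) (j (vT m))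
    | inr i => ipF (D (vD l)) (j (p (val i))) end.
  have [|b [l0 bl0] bf] := @kernel_vector R 'I_nD ('I_nT + I)%type f.
    by rewrite card_sum !card_ord.
  pose x := \sum_l b l *: vD l.
  have qx : ipF (D x) (j x) < 0.
    rewrite (diagonal_form hip _ (eigen_frame_diag fvD)) (bigD1 l0) //= ltr_nwDl //.
      by rewrite nmulr_llt0 ?muD0 // lt_def sqrf_eq0 bl0 sqr_ge0.
    by apply: sumr_le0 => l _; rewrite mulr_ge0_le0 ?sqr_ge0 // ltW // muD0.
  have Yx : Y x = \sum_l b l *: Y (vD l).
    rewrite /Y; under eq_bigr do rewrite (form_suml hip) scaler_suml.
    rewrite exchange_big; apply: eq_bigr => l _ /=; rewrite scaler_sumr.
    by apply: eq_bigr => a _; rewrite scalerA.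
  have xv m : ipF (j (x - Y x)) (j (vT m)) = 0.
    have -> : x - Y x = \sum_l b l *: (vD l - Y (vD l)).
      by rewrite Yx -sumrB; apply: eq_bigr => l _; rewrite scalerBr.
    by rewrite (form_suml hip); exact: (bf (inl m)).
  have /choice [cc /choice [x0 XE]] := Xp.
  pose al i := \sum_b ipF (j x) (j (e b)) * cc b i.
  pose x1 := \sum_b ipF (j x) (j (e b)) *: x0 b.
  have YE : Y x = \sum_i al i *: p i + x1.
    rewrite /Y; under eq_bigr do rewrite (XE _).2 scalerDr.
    rewrite big_split; congr (_ + _) => /=.
    under eq_bigr do rewrite scaler_sumr.
    rewrite exchange_big; apply: eq_bigr => i _ /=; rewrite scaler_suml.
    by apply: eq_bigr => a _; rewrite scalerA.
  have Dx1 : D x1 = 0.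
    by rewrite linear_sum big1 // => i _; rewrite linearZ /= (XE i).1 scaler0.
  have DY u : (forall a, ipF (j u) (j (e a)) = 0) -> ipF (D (Y x)) (j u) = 0.
    move=> ue; rewrite YE linearD Dx1 addr0 (form_suml hip) big1 // => i _.
    by rewrite pQ ?mulr0.
  have DYp i : ipF (D (Y x)) (j (p i)) = al i * d i.
    rewrite YE linearD Dx1 addr0 (form_suml hip) (bigD1 i) //= pd eqxx big1 ?addr0 //.
    by move=> l /negbTE li; rewrite pd li mulr0.
  have qY : 0 <= ipF (D (Y x)) (j (Y x)).
    have -> : ipF (D (Y x)) (j (Y x)) = \sum_i al i ^+ 2 * d i.
      rewrite {1}YE linearD Dx1 addr0 {1}YE [j (_ + _)]linearD (ipDr hip).
      rewrite [X in _ + X](symmetricC hip _ _ D_sym) Dx1 (ip0l hip) addr0.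
      exact: (diagonal_form hip).
    apply: sumr_ge0 => i _; have [di|di] := leP 0 (d i); first by rewrite mulr_ge0 ?sqr_ge0.
    suff -> : al i = 0 by rewrite expr0n mul0r.
    apply/eqP; have : al i * d i == 0.
      rewrite -DYp.
      have bx : ipF (D x) (j (p i)) = 0.
        by rewrite (form_suml hip); exact: (bf (inr (exist _ i di))).
      rewrite (symmetricC hip _ _ D_sym) -[Y x](subKr x) linearB (ipBr hip) (pQ i (x - Y x)) ?subr0.
        by rewrite (symmetricC hip _ _ D_sym) bx.
      by move=> a; exact: XQ.
    by rewrite mulf_eq0 (negbTE (d0 i)) orbF.
  have := qx; apply/negP; rewrite -leNgt.
  have -> : ipF (D x) (j x) = ipF (D (Y x)) (j (Y x)) + ipF (D (x - Y x)) (j (x - Y x)).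
    have xe a : ipF (j (x - Y x)) (j (e a)) = 0 by exact: XQ.
    have {1 2}-> : x = Y x + (x - Y x) by rewrite addrC subrK.
    by rewrite (form_orthogonal D_sym) // (DY _ xe).
  by rewrite addr_ge0 // Dpos // => a; exact: XQ.
(* If nD were smaller, some nontrivial combination V + P of the vT and of the p i with d i < 0 would
   be orthogonal to all vD, so q_D would be nonnegative there; yet q_D splits into strictly negative
   contributions of V and P. *)
- pose pv (m : 'I_nT + I) := match m with inl m => vT m | inr i => p (val i) end.
  have [|b b0 bf] := @kernel_vector R ('I_nT + I)%type 'I_nD (fun m l => ipF (j (pv m)) (j (vD l))).
    by rewrite card_sum !card_ord.
  pose V := \sum_m b (inl m) *: vT m.
  pose P := \sum_i b (inr i) *: p (val i).
  have xE : \sum_m b m *: pv m = V + P by rewrite big_sumType.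
  have xv l : ipF (j (V + P)) (j (vD l)) = 0 by rewrite -xE (form_suml hip).
  have := form_ge0_off_negative lam0 D_cont D_sym D_gt fvD xv.
  apply/negP; rewrite -ltNge.
  have VP : ipF (D P) (j V) = 0.
    rewrite (form_suml hip) big1 // => i _; rewrite pQ ?mulr0 // => a.
    by rewrite (form_suml hip) big1 // => m _; rewrite negative_perp_ker mulr0.
  have -> : ipF (D (V + P)) (j (V + P)) = ipF (D V) (j V) + ipF (D P) (j P).
    by rewrite addrC (form_orthogonal D_sym) // addrC.
  have qP : ipF (D P) (j P) = \sum_(i : I) b (inr i) ^+ 2 * d (val i).
    by apply: (diagonal_form hip) => i l; rewrite pd (inj_eq val_inj).
  have qV := Dneg (fun m => b (inl m)).
  have qP0 : ipF (D P) (j P) <= 0.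
    rewrite qP; apply: sumr_le0 => i _.
    by rewrite mulr_ge0_le0 ?sqr_ge0 // ltW // (valP i).
  have lg : 0 < g - - lam * k by rewrite subr_gt0.
  have sV0 : 0 <= \sum_m b (inl m) ^+ 2 by apply: sumr_ge0 => i _; exact: sqr_ge0.
  have [[m bm]|noV] := pselect (exists m, b (inl m) != 0).
    have : 0 < \sum_m b (inl m) ^+ 2.
      rewrite (bigD1 m) //= ltr_pwDl //; first by rewrite lt_def sqrf_eq0 bm sqr_ge0.
      by apply: sumr_ge0 => i _; exact: sqr_ge0.
    move=> sp; rewrite -[ltRHS]addr0 ltr_leD //; apply: (le_lt_trans qV).
    by rewrite mulNr oppr_lt0 mulr_gt0.
  have : ipF (D P) (j P) < 0.
    case: b0 => [[m bm|i bi]]; first by case: noV; exists m.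
    rewrite qP (bigD1 i) //= ltr_nwDl //.
      by rewrite nmulr_llt0 ?(valP i) // lt_def sqrf_eq0 bi sqr_ge0.
    by apply: sumr_le0 => l _; rewrite mulr_ge0_le0 ?sqr_ge0 // ltW // (valP l).
  move=> qPl; rewrite -[ltRHS]addr0 ler_ltD //; apply: (le_trans qV).
  by rewrite mulNr oppr_le0 mulr_ge0 // ltW.
Qed.

End Counting.
End Inertia.

(** * Kernel frames *)

Section Cokernel.
Context {R : realType} {E F : completeNormedModType R} (ipF : F -> F -> R).
Hypothesis hip : inner_product ipF.
Variable j : {linear E -> F}.
Hypothesis j_inj : injective j.
Variable T : {linear E -> F}.
Hypothesis T_sym : symmetric ipF j T.
Variables (n : nat) (e : 'I_n -> E).
Hypothesis e_ker : basis (ker T) (fam e).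

Let e_ind : independent e. Proof. by have [] := (basis_famP _ _).1 e_ker. Qed.
Let Te a : T (e a) = 0. Proof. exact: (basis_mem e_ker). Qed.

Lemma range_perp_ker x a : ipF (T x) (j (e a)) = 0.
Proof. by rewrite T_sym Te (ip0r hip). Qed.

Lemma row_sum N (Phi : {linear 'rV[R]_N -> F}) z :
  Phi z = \sum_i z 0 i *: Phi (delta_mx 0 i).
Proof.
rewrite {1}[z]row_sum_delta linear_sum; apply: eq_bigr => i _.
by rewrite linearZ.
Qed.

(** A vector of ker T that pairs to 0 with the image of Phi is orthogonal to im T + im Phi = F. *)
Lemma pairing_nondegenerate N (Phi : {linear 'rV[R]_N -> F}) (c : 'I_n -> R) :
  coker_iso T Phi ->
  (forall i, \sum_a c a * ipF (j (e a)) (Phi (delta_mx 0 i)) = 0) -> forall a, c a = 0.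
Proof.
move=> [_ dec _] h; apply: e_ind; apply: j_inj; rewrite linear0; apply: (ip_eq0 hip).
set x := \sum_a _; have [z [w {2}->]] := dec (j x).
rewrite (ipDr hip) row_sum (ip_sumr hip) big1 ?addr0 => [|i _].
  by rewrite (form_suml hip) big1 // => a _; rewrite (ipC hip) range_perp_ker mulr0.
by rewrite (ipZr hip) (form_suml hip) h mulr0.
Qed.

Definition pairing N (Phi : {linear 'rV[R]_N -> F}) : 'M[R]_(N, n) :=
  \matrix_(i, a) ipF (Phi (delta_mx 0 i)) (j (e a)).

Section Pairing.
Variable (Phi : {linear 'rV[R]_n -> F}).
Hypothesis cPhi : coker_iso T Phi.

Lemma pairing_unit : pairing Phi \in unitmx.
Proof.
rewrite -unitmx_tr unitmxE unitfE; apply/negP => /eqP/eqP/det0P [v v0 vP].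
move/eqP: v0; apply; apply/rowP => a; rewrite mxE.
apply: (pairing_nondegenerate (c := fun a => v 0 a) cPhi) => i.
have /rowP/(_ i) := vP; rewrite !mxE => h; rewrite -[RHS]h.
by apply: eq_bigr => b _; rewrite !mxE (ipC hip).
Qed.

(** Replaces the closed range theorem by linear algebra: in y = T x + Phi z the invertible pairing
    forces z = 0. *)
Lemma perp_ker_range y : (forall a, ipF y (j (e a)) = 0) -> exists x, y = T x.
Proof.
have [_ dec _] := cPhi; have [x [z ->]] := dec y => yP.
exists x; suff -> : z = 0 by rewrite linear0 addr0.
rewrite -[z](mulmxK pairing_unit); suff -> : z *m pairing Phi = 0 by rewrite mul0mx.
apply/rowP => a; rewrite !mxE; have := yP a.
rewrite (ipDl hip) range_perp_ker add0r row_sum (ip_suml hip) => h; rewrite -[RHS]h.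
by apply: eq_bigr => i _; rewrite mxE (ipZl hip).
Qed.

(** Such an f is determined by its n values on the image of Phi, and inverting the pairing yields a
    vector of ker T with these values; this is the Riesz representation needed here. *)
Lemma annihilator_range (f : F -> R) : (forall a u v, f (a *: u + v) = a * f u + f v) ->
  (forall x, f (T x) = 0) -> exists c : 'I_n -> R, forall y, f y = ipF (j (\sum_a c a *: e a)) y.
Proof.
move=> flin fT; pose r := \row_i f (Phi (delta_mx 0 i)).
have f0 : f 0 = 0 by rewrite -(linear0 T) fT.
have fD u v : f (u + v) = f u + f v by rewrite -[u]scale1r flin mul1r scale1r.
have fZ a u : f (a *: u) = a * f u by rewrite -[a *: u]addr0 flin f0 addr0.
pose c := r *m invmx (pairing Phi)^T; exists (fun a => c 0 a) => y.
have [_ dec _] := cPhi; have [x [z ->]] := dec y.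
rewrite fD fT add0r (ipDr hip) [X in _ = X + _](_ : _ = 0) ?add0r; last first.
  by rewrite (form_suml hip) big1 // => a _; rewrite (ipC hip) range_perp_ker mulr0.
rewrite row_sum (ip_sumr hip) (big_morph f fD f0); apply: eq_bigr => i _.
rewrite fZ (ipZr hip) (form_suml hip); congr (_ * _).
have uP : (pairing Phi)^T \in unitmx by rewrite unitmx_tr pairing_unit.
have /rowP/(_ i) := mulmxKV uP r; rewrite -/c !mxE => <-.
by apply: eq_bigr => a _; rewrite !mxE (ipC hip).
Qed.

End Pairing.

Lemma index_zero_cokernel : index_zero T -> exists Phi : {linear 'rV[R]_n -> F}, coker_iso T Phi.
Proof.
move=> [xs [N [Phi [bx cPhi sx]]]].
have nN : n = N by rewrite -sx -(basis_size e_ker bx) size_fam.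
by rewrite nN; exists Phi.
Qed.

Hypothesis T_index0 : index_zero T.

(** [index_zero] speaks of one complement only. A larger one would contain a nonzero vector
    orthogonal to ker T, hence in im T; a smaller one contradicts nondegeneracy of the pairing. *)
Lemma cokernel_dim N (Phi : {linear 'rV[R]_N -> F}) : coker_iso T Phi -> N = n.
Proof.
move=> cPhi; have [Phi0 cPhi0] := index_zero_cokernel T_index0.
apply/eqP; rewrite eqn_leq; apply/andP; split; rewrite leqNgt; apply/negP => lt.
- have [|c [i ci] cf] := @kernel_vector R 'I_N 'I_n (pairing Phi); first by rewrite !card_ord.
  have [|x Ex] := perp_ker_range cPhi0 (y := Phi (\row_i c i)).
    move=> a; rewrite row_sum (ip_suml hip) -[RHS](cf a); apply: eq_bigr => k _.
    by rewrite (ipZl hip) !mxE.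
  have [inj _ h0] := cPhi.
  have := h0 x (\row_i c i); rewrite Ex => /(_ erefl) Tx.
  move: Ex; rewrite Tx -(linear0 Phi) => /inj /rowP/(_ i).
  by rewrite !mxE => c0; rewrite c0 eqxx in ci.
- have [|c [i ci] cf] := @kernel_vector R 'I_n 'I_N
    (fun a i => ipF (j (e a)) (Phi (delta_mx 0 i))); first by rewrite !card_ord.
  by move: ci; rewrite (pairing_nondegenerate cPhi cf) eqxx.
Qed.

End Cokernel.

(** * Lyapunov-Schmidt reduction near T *)

Section Frame.
Context {R : realType} {E F : completeNormedModType R} (ipF : F -> F -> R).
Hypothesis hip : inner_product ipF.
Variable j : {linear E -> F}.
Hypothesis j_inj : injective j.
Hypothesis j_compact : compact_operator j.
Variable T : {linear E -> F}.
Hypothesis T_sym : symmetric ipF j T.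
Hypothesis T_cont : continuous T.
Variables (n : nat) (e : 'I_n -> E).
Hypothesis e_ker : basis (ker T) (fam e).
Hypothesis e_orth : forall a b, ipF (j (e a)) (j (e b)) = (a == b)%:R.
Hypothesis T_range : forall y, (forall a, ipF y (j (e a)) = 0) -> exists x, y = T x.
Variable phi : 'I_n -> F.
Hypothesis phi_unit : \matrix_(i, a) ipF (phi i) (j (e a)) \in unitmx.

Let Gam := \matrix_(i, a) ipF (phi i) (j (e a)).
(** The combinations of the j (e a) dual to the phi i. *)
Let g i := \sum_a (invmx Gam) a i *: j (e a).

Let phi_g p i : ipF (phi p) (g i) = (p == i)%:R.
Proof.
rewrite /g (ip_sumr hip); have /matrixP/(_ p i) := mulmxV phi_unit.
rewrite !mxE => <-; apply: eq_bigr => a _.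
by rewrite (ipZr hip) mxE mulrC.
Qed.

Let e_g a : j (e a) = \sum_i Gam i a *: g i.
Proof.
rewrite /g; under eq_bigr do rewrite scaler_sumr.
rewrite exchange_big /= (bigD1 a) //= [X in _ + X]big1 ?addr0 => [|b ba].
  under eq_bigr do rewrite scalerA mulrC.
  rewrite -scaler_suml; have /matrixP/(_ a a) := mulVmx phi_unit.
  by rewrite !mxE eqxx => ->; rewrite scale1r.
under eq_bigr do rewrite scalerA mulrC.
rewrite -scaler_suml; have /matrixP/(_ b a) := mulVmx phi_unit.
by rewrite !mxE (negbTE ba) => ->; rewrite scale0r.
Qed.

Let perp_g y : (forall i, ipF y (g i) = 0) -> forall a, ipF y (j (e a)) = 0.
Proof.
by move=> h a; rewrite e_g (ip_sumr hip) big1 // => i _; rewrite (ipZr hip) h mulr0.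
Qed.

(** The projection of F onto the orthogonal complement of j (ker T), which is im T, along the span
    of the phi i. *)
Let proj y := y - \sum_i ipF y (g i) *: phi i.

Let proj_perp y a : ipF (proj y) (j (e a)) = 0.
Proof.
apply: perp_g => p; rewrite /proj (ipBl hip) (ip_suml hip) (bigD1 p) //=.
rewrite (ipZl hip) phi_g eqxx mulr1 big1 ?addr0 ?subrr // => i ip.
by rewrite (ipZl hip) phi_g (negbTE ip) mulr0.
Qed.

Let proj_linear : linear proj.
Proof.
move=> a x y; rewrite /proj scalerBr scaler_sumr addrACA -opprD -big_split /=.
congr (_ - _); apply: eq_bigr => i _.
by rewrite (ip_linear hip) scalerDl scalerA.
Qed.

Let proj_id y : (forall a, ipF y (j (e a)) = 0) -> proj y = y.
Proof.
move=> h; rewrite /proj big1 ?subr0 // => i _; rewrite /g (ip_sumr hip) big1 ?scale0r // => a _.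
by rewrite (ipZr hip) h mulr0.
Qed.

Let proj_phi y : (exists b, y = \sum_i b i *: phi i) -> proj y = 0.
Proof.
move=> [b ->]; apply/eqP; rewrite subr_eq0; apply/eqP; apply: eq_bigr => i _.
rewrite (ip_suml hip) (bigD1 i) //= (ipZl hip) phi_g eqxx mulr1 big1 ?addr0 // => k ki.
by rewrite (ipZl hip) phi_g (negbTE ki) mulr0.
Qed.

Let K := 1 + \sum_i `|g i| * `|phi i|.

Let K1 : 1 <= K.
Proof. by rewrite lerDl sumr_ge0 // => i _; rewrite mulr_ge0. Qed.

Let proj_bound y : `|proj y| <= K * `|y|.
Proof.
rewrite (le_trans (ler_normB _ _)) // mulrDl mul1r lerD2l (le_trans (ler_norm_sum _ _ _)) //.
rewrite mulr_suml ler_sum // => i _; rewrite normrZ.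
have := cauchy_schwarz hip y (g i) => /(ler_wpM2r (normr_ge0 (phi i))) /le_trans; apply.
by rewrite mulrC mulrCA mulrC [`|phi i| * _]mulrC.
Qed.

Let ecomp x := \sum_a ipF (j x) (j (e a)) *: j (e a).

(** The projected operator completed by the ker T component of x. It is bijective for D = T, hence
    also for D near T. *)
Let hat_fun (D : {linear E -> F}) x := proj (D x) + ecomp x.

Let hat_linear D : linear (hat_fun D).
Proof.
move=> a x y; rewrite /hat_fun [D _]linearP proj_linear [a *: (_ + ecomp _)]scalerDr addrACA; congr (_ + _).
rewrite /ecomp scaler_sumr -big_split; apply: eq_bigr => i _ /=.
by rewrite linearP (ip_linear hip) scalerDl scalerA.
Qed.

Let hat D : {linear E -> F} :=
  HB.pack (hat_fun D) (GRing.isLinear.Build _ _ _ _ _ (hat_linear D)).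

Let ecomp_e x a : ipF (ecomp x) (j (e a)) = ipF (j x) (j (e a)).
Proof.
rewrite (ip_suml hip) (bigD1 a) //= (ipZl hip) e_orth eqxx mulr1 big1 ?addr0 // => b ba.
by rewrite (ipZl hip) e_orth (negbTE ba) mulr0.
Qed.

Let hat_e D x a : ipF (hat D x) (j (e a)) = ipF (j x) (j (e a)).
Proof. by rewrite /= /hat_fun (ipDl hip) proj_perp add0r ecomp_e. Qed.

Let ecomp_eq x y : (forall a, ipF (j x) (j (e a)) = ipF (j y) (j (e a))) -> ecomp x = ecomp y.
Proof. by move=> h; apply: eq_bigr => a _; rewrite h. Qed.

Let hatT x : hat T x = T x + ecomp x.
Proof.
rewrite /= /hat_fun proj_id // => a.
exact: (range_perp_ker hip T_sym e_ker).
Qed.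

Let ecomp_bound : exists2 c, 0 < c & forall x, `|ecomp x| <= c * `|x|.
Proof.
have [c c0 jc] := inclusion_bound j_compact.
exists (c * \sum_a (`|j (e a)| * `|j (e a)|) + 1) => [|x].
  by rewrite ltr_wpDl // mulr_ge0 ?(ltW c0) // sumr_ge0 // => i _; rewrite mulr_ge0.
rewrite (le_trans (ler_norm_sum _ _ _)) // mulrDl mul1r.
apply: (@le_trans _ _ (c * (\sum_a `|j (e a)| * `|j (e a)|) * `|x|)); last by rewrite lerDl.
rewrite mulr_sumr mulr_suml ler_sum // => a _; rewrite normrZ.
apply: (@le_trans _ _ (`|j x| * `|j (e a)| * `|j (e a)|)).
  by rewrite ler_wpM2r // cauchy_schwarz.
rewrite -mulrA [c * _]mulrC -mulrA [leLHS]mulrC ler_wpM2l ?mulr_ge0 //.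
Qed.

Let hatT_cont : continuous (hat T).
Proof.
have [c c0 ec] := ecomp_bound; have [t t0 Tt] := linear_bound T_cont.
apply: (@bound_continuous _ _ _ (hat T) (t + c)) => x.
by rewrite hatT (le_trans (ler_normD _ _)) // mulrDl lerD.
Qed.

Let hatT_inj : injective (hat T).
Proof.
move=> x y /eqP; rewrite -subr_eq0 -linearB => /eqP; set z := x - y => Tz.
have ze a : ipF (j z) (j (e a)) = 0 by rewrite -(hat_e T) Tz (ip0l hip).
have ez : ecomp z = 0 by rewrite /ecomp big1 // => a _; rewrite ze scale0r.
have zk : ker T z by rewrite /ker /=; move: Tz; rewrite hatT ez addr0.
apply/eqP; rewrite -subr_eq0 -/z; apply/eqP; apply: j_inj; rewrite linear0.
by apply: (ip_eq0 hip); apply: (ker_perp hip e_ker).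
Qed.

Let hatT_surj y : exists x, hat T x = y.
Proof.
pose c a := ipF y (j (e a)); pose k := \sum_a c a *: e a.
have jk a : ipF (j k) (j (e a)) = c a.
  rewrite (form_suml hip) (bigD1 a) //= e_orth eqxx mulr1 big1 ?addr0 // => b ba.
  by rewrite e_orth (negbTE ba) mulr0.
have Tk : T k = 0.
  by rewrite linear_sum big1 // => a _; rewrite linearZ /= (basis_mem e_ker) scaler0.
have [|x xE] := T_range (y := y - j k); first by move=> a; rewrite (ipBl hip) jk subrr.
pose h := \sum_a ipF (j x) (j (e a)) *: e a.
have Th : T h = 0.
  by rewrite linear_sum big1 // => a _; rewrite linearZ /= (basis_mem e_ker) scaler0.
have jh a : ipF (j h) (j (e a)) = ipF (j x) (j (e a)).
  rewrite (form_suml hip) (bigD1 a) //= e_orth eqxx mulr1 big1 ?addr0 // => b ba.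
  by rewrite e_orth (negbTE ba) mulr0.
exists (x - h + k); rewrite hatT !linearD linearN Th Tk subr0 addr0 -xE.
rewrite (@ecomp_eq _ k) => [|a]; last first.
  by rewrite !linearD linearN (ipDl hip) (ipBl hip) jh subrr add0r.
have -> : ecomp k = j k.
  by rewrite /k linear_sum; apply: eq_bigr => a _; rewrite jk linearZ.
by rewrite subrK.
Qed.

(** X D a is the solution of hat D x = j (e a): its projected part places D x in the span of the
    phi, the other part fixes the components of x along the e. D is any operator near T, symmetric
    or not, because [kernel_frame] ranges over all nearby Fredholm operators. *)
Lemma frame_exists : exists d B, [/\ 0 < d, 0 <= B &
  exists (X : {linear E -> F} -> 'I_n -> E) (c : {linear E -> F} -> 'I_n -> 'I_n -> R),
  forall D, op_ball T d D ->
  [/\ forall a b, ipF (j (X D a)) (j (e b)) = (a == b)%:R,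
      forall a, D (X D a) = \sum_i c D a i *: phi i,
      forall x b, D x = \sum_i b i *: phi i -> x = \sum_a ipF (j x) (j (e a)) *: X D a,
      forall y, exists x b, y = D x + \sum_i b i *: phi i &
      forall D' r, 0 < r -> op_ball T d D' -> op_ball D r D' -> forall a,
        `|X D' a - X D a| <= B * r /\ forall i, `|c D' a i - c D a i| <= B * r]].
Proof.
have [C C0 Cb] := bounded_inverse hatT_cont hatT_surj hatT_inj.
have [t t0 Tt] := linear_bound T_cont.
have K0 : 0 < K by apply: lt_le_trans K1.
(* K bounds the projection, so hat D - hat T has norm at most K d = 1 / (2 C), the margin of
   [perturbed_solution]. *)
pose d := (2 * C * K)^-1.
have d0 : 0 < d by rewrite invr_gt0 !mulr_gt0.
have hatB (D D' : {linear E -> F}) r : op_ball D r D' -> forall x, `|hat D' x - hat D x| <= K * r * `|x|.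
  move=> DD x; have -> : hat D' x - hat D x = proj (D' x - D x).
    have := proj_linear (-1) (D x) (D' x); rewrite !scaleN1r [- D x + _]addrC => ->.
    by rewrite /= /hat_fun opprD addrACA subrr addr0 addrC.
  by rewrite (le_trans (proj_bound _)) // -mulrA ler_wpM2l // ltW.
have solve (D : {linear E -> F}) : op_ball T d D ->
    (forall y, exists x, hat D x = y /\ `|x| <= 2 * C * `|y|) /\
    (forall x, `|x| <= 2 * C * `|hat D x|).
  move=> DT; have Kd : K * d = (2 * C)^-1.
    by rewrite /d invfM mulrCA mulfV ?mulr1 // gt_eqF.
  have := hatB _ _ _ DT; rewrite Kd => h; split.
    apply: (perturbed_solution hatT_cont C0 _ h) => y.
    by have [x <-] := hatT_surj y; exists x; split => //; exact: Cb.
  move=> x; have h1 := Cb x; have h2 := h x.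
  have h3 : `|hat T x| <= `|hat D x| + (2 * C)^-1 * `|x|.
    rewrite -[hat T x](subKr (hat D x)) (le_trans (ler_normB _ _)) // lerD2l //.
  have : C * `|hat T x| <= C * `|hat D x| + `|x| / 2.
    apply: (le_trans (ler_wpM2l (ltW C0) h3)); rewrite mulrDr lerD2l mulrA.
    by rewrite invfM mulrCA mulfV ?mulr1 ?gt_eqF // mulrC.
  by rewrite -[2 * C * _]mulrA; move: (C * `|hat D x|) => u; lra.
have /choice [X XP] (D : {linear E -> F}) : exists X : 'I_n -> E, op_ball T d D ->
    forall a, hat D (X a) = j (e a) /\ `|X a| <= 2 * C.
  have [DT|] := pselect (op_ball T d D); last by exists (fun=> 0).
  have /choice [X XP] a : exists x, hat D x = j (e a) /\ `|x| <= 2 * C.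
    have [x [xe xb]] := (solve _ DT).1 (j (e a)); exists x; split => //.
    apply: (le_trans xb); suff -> : `|j (e a)| = 1 by rewrite mulr1.
    by apply/eqP; rewrite -(@eqrXn2 _ 2) // (ip_norm hip) e_orth eqxx expr1n.
  by exists X.
pose c (D : {linear E -> F}) a i := ipF (D (X D a)) (g i).
have C20 : 0 <= 2 * C by rewrite mulr_ge0 // ltW.
(* Lipschitz constant of X: the bound of the inverse of hat D', the norm of the projection, and the
   bound of X. *)
pose B0 := 2 * C * K * (2 * C).
have B00 : 0 <= B0 by rewrite !mulr_ge0 // ltW.
(* Lipschitz constant of the coefficients, from D' X' - D X = (D' - D) X + D' (X' - X) paired with
   the g i. *)
pose B1 := (2 * C + (t + d) * B0) * \sum_i `|g i|.
have B10 : 0 <= B1.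
  by rewrite mulr_ge0 ?sumr_ge0 // addr_ge0 // mulr_ge0 // addr_ge0 ?ltW.
exists d, (B0 + B1); split; [by []|by rewrite addr_ge0|].
exists X, c => D DT.
have [surjD bndD] := solve _ DT.
have injD x y : hat D x = hat D y -> x = y.
  move=> xy; apply/eqP; rewrite -subr_eq0 -normr_le0 (le_trans (bndD _)) //.
  by rewrite linearB xy subrr normr0 mulr0.
have Xe a b : ipF (j (X D a)) (j (e b)) = (a == b)%:R.
  by rewrite -(hat_e D) (XP _ DT a).1 e_orth.
have ecompX a : ecomp (X D a) = j (e a).
  rewrite /ecomp (bigD1 a) //= Xe eqxx scale1r big1 ?addr0 // => b.
  by rewrite Xe eq_sym => /negbTE ->; rewrite scale0r.
split => //.
- move=> a; have := (XP _ DT a).1; rewrite /= /hat_fun ecompX => /eqP.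
  by rewrite -subr_eq0 addrK subr_eq0 => /eqP.
- move=> x b Dx; apply: injD; rewrite linear_sum.
  have -> : hat D x = ecomp x by rewrite /= /hat_fun proj_phi ?add0r //; exists b.
  by apply: eq_bigr => a _; rewrite linearZZ (XP _ DT a).1.
- move=> y; have [x [xE _]] := surjD (proj y).
  exists x, (fun i => ipF (y - D x) (g i)).
  have xe a : ipF (j x) (j (e a)) = 0 by rewrite -(hat_e D) xE proj_perp.
  have ex : ecomp x = 0 by rewrite /ecomp big1 // => a _; rewrite xe scale0r.
  have Dx : proj (D x) = proj y by rewrite -xE /= /hat_fun ex addr0.
  have : proj (y - D x) = 0.
    have := proj_linear (-1) (D x) y; rewrite !scaleN1r [- D x + _]addrC => ->.
    by rewrite Dx addrC subrr.
  move=> /eqP; rewrite subr_eq0 => /eqP <-.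
  by rewrite addrC subrK.
move=> D' r r0 D'T D'D a.
have [_ bndD'] := solve _ D'T.
have [HX nX] := XP _ DT a; have [HX' nX'] := XP _ D'T a.
have dX : `|X D' a - X D a| <= B0 * r.
  rewrite (le_trans (bndD' _)) // linearB HX' -HX distrC /B0 -!mulrA ler_wpM2l //.
  rewrite (le_trans (ler_wpM2l (ltW C0) (hatB _ _ _ D'D _))) //.
  rewrite ler_wpM2l ?(ltW C0) // -mulrA ler_wpM2l ?(ltW K0) // [r * _]mulrC mulrA.
  by rewrite ler_wpM2r // ltW.
split; first by rewrite (le_trans dX) // ler_wpM2r ?(ltW r0) // lerDl.
move=> i; rewrite /c -(ipBl hip) (le_trans (cauchy_schwarz hip _ _)) //.
have D'b x : `|D' x| <= (t + d) * `|x|.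
  rewrite -[D' x](subrK (T x)) (le_trans (ler_normD _ _)) // mulrDl addrC lerD //.
have dD : `|D' (X D' a) - D (X D a)| <= (2 * C + (t + d) * B0) * r.
  have -> : D' (X D' a) - D (X D a) = (D' (X D a) - D (X D a)) + D' (X D' a - X D a).
    by rewrite linearB [RHS]addrC addrA subrK.
  rewrite (le_trans (ler_normD _ _)) // mulrDl lerD //.
    by rewrite (le_trans (D'D _)) // mulrC ler_wpM2r // ltW.
  by rewrite (le_trans (D'b _)) // -mulrA ler_wpM2l // addr_ge0 // ltW.
apply: (@le_trans _ _ (B1 * r)); last by rewrite ler_wpM2r ?(ltW r0) // lerDr.
rewrite /B1 mulrAC ler_pM //.
by rewrite (bigD1 i) //= lerDl sumr_ge0.
Qed.

End Frame.

(** * Signs of Gram determinants *)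

(** Polarisation at sums of two unit vectors recovers every entry of B from the quadratic form. *)
Lemma symmetric_nonisotropic {R : realType} n (B : 'M[R]_n) : B^T = B -> B != 0 ->
  exists v : 'rV[R]_n, (v *m B *m v^T) 0 0 != 0.
Proof.
move=> Bs B0; have qE (i k : 'I_n) : ((delta_mx 0 i : 'rV[R]_n) *m B *m (delta_mx 0 k : 'rV[R]_n)^T) 0 0 = B i k.
  rewrite -rowE mxE (bigD1 k) //= !mxE !eqxx mulr1 big1 ?addr0 // => l lk.
  by rewrite !mxE (negbTE lk) andbF mulr0.
have [//|/forallNP h] := pselect (exists v : 'rV[R]_n, (v *m B *m v^T) 0 0 != 0).
have {}h (v : 'rV[R]_n) : (v *m B *m v^T) 0 0 = 0 by apply/eqP/negPn/negP; exact: h.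
case/eqP: B0; apply/matrixP => i k; rewrite mxE.
have := h (delta_mx 0 i + delta_mx 0 k : 'rV[R]_n).
have addE (Y Z : 'M[R]_1) : (Y + Z) 0 0 = Y 0 0 + Z 0 0 by rewrite mxE.
rewrite [(_ + _)^T]linearD /= !mulmxDr !mulmxDl !addE.
rewrite !h !qE add0r addr0.
have -> : B k i = B i k by rewrite -{1}Bs mxE.
by move=> e; lra.
Qed.

(** Completing the square: a nonisotropic vector becomes the first basis vector, its row and column
    are cleared, and the induction treats the remaining block. *)
Lemma symmetric_diagonalization {R : realType} n (B : 'M[R]_n) : B^T = B ->
  exists P d, P \in unitmx /\ P *m B *m P^T = diag_mx d.
Proof.
elim: n B => [|n IH] B Bs.
  by exists 1%:M, 0; split; [exact: unitmx1|apply/matrixP => -[]].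
have [->|B0] := eqVneq B 0.
  by exists 1%:M, 0; split; [exact: unitmx1|rewrite mulmx0 mul0mx linear0].
have [v vB] := symmetric_nonisotropic Bs B0.
(* An invertible matrix whose first row is proportional to v. *)
pose U : 'M[R]_(1 + n) := row_ebase v.
have Uu : U \in unitmx by exact: row_ebase_unit.
pose B1 : 'M[R]_(1 + n) := U *m B *m U^T.
have B1s : B1^T = B1 by rewrite /B1 !trmx_mul trmxK Bs mulmxA.
pose b := B1 0 0.
have b0 : b != 0.
  apply: contra vB => /eqP b0.
  have [t vE] : exists t, v = t *: row 0 U.
    pose t : 'rV[R]_(1 + n) := col_ebase v *m pid_mx (\rank v).
    exists (t 0 0); rewrite -{1}[v]mulmx_ebase -/t rowE scalemxAl; congr (_ *m _).
    apply/rowP => k; rewrite !mxE big_ord1 !mxE !eqxx /=.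
    have [->|k0] := eqVneq k 0; first by rewrite big_ord1 !mxE mulr1.
    by rewrite mulr0 (_ : 0%N == k = false) ?mulr0 //; apply/negbTE; rewrite eq_sym.
  have E : row 0 U *m B *m (row 0 U)^T = b%:M.
    apply/matrixP => i k; rewrite !ord1 [RHS]mxE eqxx mulr1n /b /B1.
    by rewrite tr_row -!row_mul !mxE; apply: eq_bigr => l _; rewrite !mxE.
  by rewrite vE linearZ /= -!scalemxAl -scalemxAr E b0 -scalemx1 scale0r !scaler0 mxE.
have B1E : B1 = U *m B *m U^T by [].
clearbody B1.
pose c : 'cV[R]_n := dlsubmx B1.
pose L : 'M[R]_(1 + n) := block_mx 1%:M 0 (- b^-1 *: c) 1%:M.
have Lu : L \in unitmx by rewrite unitmxE det_lblock !det1 mulr1 unitr1.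
pose B2 := L *m B1 *m L^T.
have B2s : B2^T = B2 by rewrite /B2 trmx_mul trmxK [(L *m B1)^T]trmx_mul B1s mulmxA.
have ulb : ulsubmx B1 = b%:M.
  apply/matrixP => i k; rewrite !ord1 !mxE eqxx mulr1n /b; congr (B1 _ _); exact/val_inj.
have B2E : B2 = block_mx (ulsubmx B2) 0 0 (drsubmx B2).
  have dl0 : dlsubmx B2 = 0.
    rewrite /B2 /L -[B1]submxK ulb tr_block_mx !mulmx_block block_mxKdl.
    rewrite !(mul1mx, mul0mx, trmx1, trmx0, mulmx1, mulmx0, addr0).
    by rewrite mul_mx_scalar -/c scalerA mulrN mulfV // scaleN1r addNr.
  rewrite -{1}[B2]submxK dl0; congr (block_mx _ _ _ _).
  by rewrite -[B2]B2s -trmx_dlsub dl0 trmx0.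
have B3s : (drsubmx B2)^T = drsubmx B2 by rewrite trmx_drsub B2s.
have [P3 [d3 [P3u P3E]]] := IH _ B3s.
pose Q : 'M[R]_(1 + n) := block_mx 1%:M 0 0 P3.
have Qu : Q \in unitmx by rewrite unitmxE det_lblock det1 mul1r -unitmxE.
exists (Q *m L *m U), (row_mx (ulsubmx B2) d3); split.
  by rewrite !unitmx_mul Qu Lu Uu.
have -> : Q *m L *m U *m B *m (Q *m L *m U)^T = Q *m B2 *m Q^T.
  by rewrite /B2 B1E !trmx_mul !mulmxA.
rewrite [in LHS]B2E /Q tr_block_mx !mulmx_block !(mul1mx, mul0mx, mulmx0, addr0, add0r, trmx0, trmx1, mulmx1).
rewrite P3E -[RHS]/(diag_mx (row_mx (ulsubmx B2) d3 : 'rV[R]_(1 + n))) diag_mx_row.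
suff -> : diag_mx (ulsubmx B2) = ulsubmx B2 by [].
by apply/matrixP => i k; rewrite !ord1 [LHS]mxE eqxx mulr1n.
Qed.

Lemma prod_sign {R : realType} q (d : 'I_q -> R) : (forall i, d i != 0) ->
  0 < (-1) ^+ #|[pred i | (d i < 0)%R]| * \prod_i d i.
Proof.
move=> d0; rewrite -sum1_card (big_morph _ (@exprD R (-1)) (expr0 _)).
rewrite big_mkcond -big_split /=; apply: prodr_gt0 => i _.
rewrite inE; case: (ltP (d i) 0) => di; first by rewrite expr1 mulN1r oppr_gt0.
by rewrite mul1r lt_def d0.
Qed.

Section Sign.
Context {R : realType} {E F : completeNormedModType R} (ipF : F -> F -> R).
Hypothesis hip : inner_product ipF.
Variable j : {linear E -> F}.
Hypothesis j_inj : injective j.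
Hypothesis j_compact : compact_operator j.
Implicit Types D T : {linear E -> F}.

Definition gram D q (w : 'I_q -> E) : 'M[R]_q := \matrix_(i, k) ipF (D (w i)) (j (w k)).

(* w spans, modulo ker D, the span of the X a, on which D takes values in the span of the e a. *)
Definition reduced_family D N (e X : 'I_N -> E) q (w : 'I_q -> E) :=
  [/\ exists2 xs, basis (ker D) xs & N = (size xs + q)%N,
      forall a b, ipF (j (X a)) (j (e b)) = (a == b)%:R,
      forall i u, (forall a, ipF (j u) (j (e a)) = 0) -> ipF (D (w i)) (j u) = 0 &
      forall a, exists c x0, D x0 = 0 /\ X a = \sum_i c i *: w i + x0].

(** What the determinant lines need from spectral theory: [size vD + size vT] has the parity of the
    change in the number of eigenvalues in S, so sign (det B) compensates the jump of the sign in
    [canonical_orientation]. *)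
Definition sign_stable (A : set {linear E -> F}) (S : set R) := forall T, A T ->
  forall N (e : 'I_N -> E), basis (ker T) (fam e) ->
  exists2 del, 0 < del & forall D, A D -> op_ball T del D ->
  forall vD vT, basis (eigen_sum j S D) vD -> basis (eigen_sum j S T) vT ->
  forall X q (w : 'I_q -> E), reduced_family D e X w -> \det (gram D w) != 0 ->
  0 < (-1) ^+ (size vD + size vT) * \det (gram D w).

Definition bounded_below_symmetric lam : set {linear E -> F} :=
  [set D : {linear E -> F} | [/\ continuous D, symmetric ipF j D & forall mu, spectrum j D mu -> lam < mu]].

(** Diagonalisation by congruence changes the determinant by a positive square, and [inertia] counts
    the negative diagonal entries. *)
Lemma sign_stable_below lam : lam < 0 ->
  sign_stable (bounded_below_symmetric lam) [set l | l < 0].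
Proof.
move=> lam0 T [T_cont T_sym T_gt] N e e_ker.
have [nT [vT [muT fT]]] := negative_frame hip j_inj j_compact T_cont T_sym T_gt.
have [del del0 inert] := inertia hip j_inj j_compact lam0 T_cont T_sym T_gt fT e_ker.
exists del => // D [D_cont D_sym D_gt] DT sD sT bD bT X q w [_ Xe wQ Xw] B0.
have [nD [vD [muD fD]]] := negative_frame hip j_inj j_compact D_cont D_sym D_gt.
have -> : size sD = nD by case: fD => _ _ _ /(basis_size bD) ->; rewrite size_fam.
have -> : size sT = nT by case: fT => _ _ _ /(basis_size bT) ->; rewrite size_fam.
have Bs : (gram D w)^T = gram D w.
  by apply/matrixP => i k; rewrite !mxE; exact: (symmetricC hip).
have [P [d [Pu PE]]] := symmetric_diagonalization Bs.
have detE : \det (gram D w) * \det P ^+ 2 = \prod_i d 0 i.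
  by rewrite -det_diag -PE !det_mulmx det_tr; ring.
have P0 : \det P != 0 by rewrite -unitfE -unitmxE.
have d0 i : d 0 i != 0.
  have : \prod_i d 0 i != 0 by rewrite -detE mulf_neq0 // expf_neq0.
  by move=> /prodf_neq0 /(_ i isT).
pose p i := \sum_k P i k *: w k.
have pd i k : ipF (D (p i)) (j (p k)) = if i == k then d 0 i else 0.
  have /matrixP/(_ i k) := PE; rewrite [in RHS]mxE; have -> : (if i == k then d 0 i else 0) = d 0 i *+ (i == k).
    by case: eqP.
  move=> <-; rewrite !mxE (form_sumr hip); apply: eq_bigr => m _.
  rewrite (form_suml hip) !mxE mulrC; congr (_ * _).
  by apply: eq_bigr => l _; rewrite mxE.
have pQ i u : (forall a, ipF (j u) (j (e a)) = 0) -> ipF (D (p i)) (j u) = 0.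
  by move=> ue; rewrite (form_suml hip) big1 // => k _; rewrite wQ ?mulr0.
have XQ x a : ipF (j (x - \sum_b ipF (j x) (j (e b)) *: X b)) (j (e a)) = 0.
  rewrite linearB (ipBl hip) (form_suml hip) (bigD1 a) //= Xe eqxx mulr1 big1 ?addr0 ?subrr // => b ba.
  by rewrite Xe (negbTE ba) mulr0.
have Xp a : exists c x0, D x0 = 0 /\ X a = \sum_i c i *: p i + x0.
  have [c [x0 [Dx0 ->]]] := Xw a.
  exists (fun i => ((\row_k c k) *m invmx P) 0 i), x0; split => //; congr (_ + _).
  rewrite /p; under [RHS]eq_bigr do rewrite scaler_sumr.
  rewrite exchange_big; apply: eq_bigr => k _ /=.
  under eq_bigr do rewrite scalerA.
  rewrite -scaler_suml; congr (_ *: _).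
  have /rowP/(_ k) := mulmxKV Pu (\row_k c k); rewrite [X in _ = X]mxE => <-.
  by rewrite mxE.
have nE := inert D D_sym D_cont D_gt DT _ _ _ fD q p (fun i => d 0 i) X pd d0 pQ XQ Xp.
have := prod_sign d0; rewrite -detE mulrA pmulr_lgt0 ?exprn_even_gt0 //.
rewrite nE addnAC addnn exprD -mul2n exprM sqrrN !expr1n mul1r.
by [].
Qed.

(** * Passage to spectra bounded from above *)

Definition bounded_above_symmetric lam : set {linear E -> F} :=
  [set D : {linear E -> F} |
    [/\ continuous D, symmetric ipF j D & forall mu, spectrum j D mu -> mu < lam]].

Definition negate D : {linear E -> F} := \- D.

Lemma spectrum_negate D mu : spectrum j (negate D) mu -> spectrum j D (- mu).
Proof.
move=> sp [S [S1 S2 S3]]; apply: sp; exists (S \o -%R); split.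
- by move=> x /=; rewrite opprB opprK addrC -[RHS]S1 scaleNr opprK addrC.
- move=> y /=; rewrite -[RHS]opprK -[X in _ = - X]S2 scaleNr opprK opprD.
  by [].
- move=> y; apply: (@continuous_comp _ _ _ -%R (j \o S)); last exact: S3.
  exact: opp_continuous.
Qed.

Lemma negate_below D lam : bounded_above_symmetric lam D ->
  bounded_below_symmetric (- lam) (negate D).
Proof.
move=> [D_cont D_sym D_lt]; split.
- by move=> x; apply: continuousN; exact: D_cont.
- by move=> x y /=; rewrite (ipNl hip) (ipNr hip) D_sym.
- by move=> mu /spectrum_negate /D_lt; rewrite ltrNl.
Qed.

Lemma ker_negate D : ker (negate D) = ker D.
Proof.
apply/seteqP; split => x; rewrite /ker /= => h; last by rewrite h oppr0.
by apply/eqP; rewrite -oppr_eq0 h.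
Qed.

(** Expresses the count for spectra bounded from above by the negative count for - D plus the
    dimension of the kernel, on which the parity in [sign_stable_above] depends. *)
Lemma eigen_sum_nonneg D s t : symmetric ipF j D ->
  basis (eigen_sum j [set l | l < 0] (negate D)) s -> basis (ker D) t ->
  basis (eigen_sum j [set l | 0 <= l] D) (s ++ t).
Proof.
move=> D_sym bs bt; apply: (basis_cat bs bt) => [u|v w].
  split=> [[r [c [rS ->]]]|[v [w [[r [c [rS ->]]] Dw ->]]]].
    rewrite /lincomb; elim/big_ind: _ => [|u1 u2 [v1 [w1 [V1 W1 ->]]] [v2 [w2 [V2 W2 ->]]]|i _].
    - exists 0, 0; split; [|exact: linear0|by rewrite addr0].
      exact: (basis_zero bs).
    - exists (v1 + v2), (w1 + w2); split; last by rewrite addrACA.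
        by have := basis_linear 1 bs V1 V2; rewrite scale1r.
      by have := basis_linear 1 bt W1 W2; rewrite scale1r.
    have [mu mu0 Dr] := rS _ (ltn_ord i); move: mu0; rewrite /= le_eqVlt => /orP[/eqP mu0|mu0].
      exists 0, (c i *: r`_i); split; [exact: (basis_zero bs)| |by rewrite add0r].
      by rewrite /ker /= linearZ /= Dr -mu0 scale0r scaler0.
    exists (c i *: r`_i), 0; split; [|exact: linear0|by rewrite addr0].
    suff h : eigen_sum j [set l | l < 0] (negate D) r`_i.
      by have := basis_linear (c i) bs h (basis_zero bs); rewrite addr0.
    exists [:: r`_i], (fun=> 1); split; last by rewrite /lincomb big_ord1 scale1r.
    by case=> // _; exists (- mu); rewrite /= ?oppr_lt0 // Dr scaleNr.
  exists (rcons r w), (fun i => if i == size r then 1 else c i); split.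
    move=> i; rewrite size_rcons ltnS leq_eqVlt nth_rcons => /orP[/eqP ->|lt].
      by rewrite ltnn eqxx; exists 0 => //=; rewrite scale0r.
    rewrite lt; have [mu mu0 Dr] := rS _ lt; exists (- mu); first by rewrite /= oppr_ge0 ltW.
    by rewrite scaleNr -Dr /= opprK.
  rewrite /lincomb size_rcons big_ord_recr /= eqxx nth_rcons ltnn eqxx scale1r; congr (_ + _).
  by apply: eq_bigr => i _; rewrite nth_rcons ltn_ord ltn_eqF.
move=> [r [c [rS vE]]] Dw vw.
have jvw : ipF (j v) (j w) = 0.
  rewrite vE /lincomb (form_suml hip) big1 // => i _.
  have [mu mu0 Dr] := rS _ (ltn_ord i).
  have Dr' : D r`_i = (- mu) *: j r`_i by rewrite scaleNr -Dr /= opprK.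
  have Dw' : D w = 0 *: j w by rewrite scale0r.
  by rewrite (eigen_orthogonal hip D_sym Dr' Dw') ?mulr0 // oppr_eq0 lt_eqF.
have w0 : w = 0.
  apply: j_inj; rewrite linear0; apply: (ip_eq0 hip).
  by move/eqP: vw; rewrite addrC addr_eq0 => /eqP {1}->; rewrite linearN (ipNl hip) jvw oppr0.
by rewrite w0 in vw *; rewrite addr0 in vw.
Qed.

Lemma sign_stable_above lam : 0 < lam ->
  sign_stable (bounded_above_symmetric lam) [set l | 0 <= l].
Proof.
move=> lam0 T AT N e e_ker.
have nT := negate_below AT.
have [||del del0 H] := @sign_stable_below (- lam) _ _ nT N e.
- by rewrite oppr_lt0.
- by rewrite ker_negate.
exists del => // D AD DT vD vT bD bT X q w rf B0.
have nD := negate_below AD.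
have [xs bxs Nk] : exists2 xs, basis (ker D) xs & N = (size xs + q)%N by case: rf.
have frame D' : bounded_above_symmetric lam D' ->
    exists s, basis (eigen_sum j [set l | l < 0] (negate D')) s.
  move=> /negate_below [c s g].
  by have [n [v [mu [_ _ _ bv]]]] := negative_frame hip j_inj j_compact c s g; exists (fam v).
have [sD bsD] := frame D AD; have [sT bsT] := frame T AT.
have [_ D_sym _] := AD; have [_ T_sym _] := AT.
rewrite (basis_size bD (eigen_sum_nonneg D_sym bsD bxs)).
rewrite (basis_size bT (eigen_sum_nonneg T_sym bsT e_ker)) !size_cat size_fam.
have gE : gram (negate D) w = - gram D w.
  by apply/matrixP => i k; rewrite !mxE /= (ipNl hip).
have dE : \det (gram (negate D) w) = (-1) ^+ q * \det (gram D w).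
  by rewrite gE -scaleN1r detZ.
have := H (negate D) nD _ sD sT bsD bsT X q w _ _.
rewrite dE => h.
(* The kernels add dim ker D and N = dim ker D + q to the exponent, which has the parity of q and
   cancels the factor (-1)^q between the Gram determinants of D and - D. This is why 0 belongs to
   the eigenvalues counted. *)
have -> : (-1) ^+ (size sD + size xs + (size sT + N)) * \det (gram D w) =
    (-1) ^+ (size sD + size sT) * ((-1) ^+ q * \det (gram D w)).
  rewrite Nk mulrA -exprD; congr (_ * _).
  rewrite (_ : (_ + _ + (_ + (_ + _)) = size sD + size sT + q + 2 * size xs)%N); last by lia.
  by rewrite [in LHS]exprD exprM sqrrN !expr1n mulr1.
apply: h.
- by move=> x /=; rewrite -opprD normrN; exact: DT.
- have [h1 h2 h3 h4] := rf; split => //.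
  + by rewrite ker_negate.
  + by move=> i u ue /=; rewrite (ipNl hip) h3 ?oppr0.
  + move=> a; have [c [x0 [Dx0 Xa]]] := h4 a; exists c, x0; split => //=.
    by rewrite Dx0 oppr0.
- by rewrite mulf_neq0 // signr_eq0.
Qed.

End Sign.

(** * Determinant lines *)

Lemma det_continuous {R : realType} n : continuous (@determinant R n).
Proof.
move=> M; rewrite /determinant /continuous_at.
have FM : Filter (nbhs M) := nbhs_filter M.
apply: (@cvg_big R _ +%R 0 xpredT (@add_continuous R)) => s _.
apply: cvgM; first exact: cvg_cst.
by apply: (@cvg_big R _ *%R 1 xpredT (@mul_continuous R)) => i _; exact: coord_continuous.
Qed.

Lemma det_sign_stable {R : realType} n (M0 : 'M[R]_n) : \det M0 != 0 ->
  exists2 e, 0 < e & forall M : 'M[R]_n, (forall i k, `|M i k - M0 i k| <= e) ->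
    0 < \det M * \det M0.
Proof.
move=> d0; have h : (fun M => \det M * \det M0) @ M0 --> \det M0 * \det M0.
  have FM := nbhs_filter M0; apply: cvgM; last exact: cvg_cst.
  exact: (@det_continuous R n M0).
have p : 0 < \det M0 * \det M0 by rewrite -expr2 lt_def sqrf_eq0 d0 sqr_ge0.
have nb : \forall M \near M0, 0 < \det M * \det M0.
  by have FM := nbhs_filter M0; exact: (cvgr_gt _ h _ p).
have /nbhs_normP [e /= e0 eP] := nb.
exists (e / 2); first by rewrite divr_gt0.
move=> M Mle; apply: eP; rewrite /= [X in X < _]mx_normrE.
apply: bigmax_lt => // -[i k] _ /=; rewrite !mxE distrC.
by apply: (le_lt_trans (Mle i k)); lra.
Qed.

Lemma complete_rows {R : realType} k q (A : 'M[R]_(k, k + q)) : row_free A ->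
  exists B : 'M[R]_(q, k + q), col_mx A B \in unitmx.
Proof.
move=> fA; exists (dsubmx (row_ebase A)).
have AE : A = col_ebase A *m usubmx (row_ebase A).
  rewrite -{1}[A]mulmx_ebase (eqP fA) -mulmxA; congr (_ *m _).
  rewrite pid_mx_row -{1}[row_ebase A]vsubmxK mul_row_col mul0mx addr0.
  by rewrite mul1mx.
rewrite {1}AE.
have -> : col_mx (col_ebase A *m usubmx (row_ebase A)) (dsubmx (row_ebase A)) =
    block_mx (col_ebase A) 0 0 1%:M *m row_ebase A.
  rewrite -{3}[row_ebase A]vsubmxK mul_block_col !mul0mx addr0 add0r mul1mx.
  by [].
rewrite unitmx_mul row_ebase_unit andbT unitmxE det_ublock det1 mulr1 -unitmxE.
exact: col_ebase_unit.
Qed.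

(** The given rows come last here. The intermediate statement uses row rank, because q + k rows of
    width k + q do not form a square matrix by type. *)
Lemma complete_rows' {R : realType} k q (A : 'M[R]_(q, k + q)) : row_free A ->
  exists B : 'M[R]_(k, k + q), col_mx B A \in unitmx.
Proof.
have gen n (C : 'M[R]_(q, n)) : n = (q + k)%N -> row_free C ->
    exists B : 'M[R]_(k, n), row_full (col_mx C B).
  move=> nE; subst n => /complete_rows [B Bu]; exists B.
  by rewrite row_full_unit.
move=> /(gen _ _ (addnC k q)) [B Bf]; exists B.
by rewrite -row_full_unit /row_full -addsmxE addsmxC addsmxE.
Qed.

Section Families.
Context {R : realType} {X Y : lmodType R}.

Lemma rev_fam n (f : 'I_n -> X) : rev (fam f) = fam (f \o @rev_ord n).
Proof.
apply: (@eq_from_nth _ 0); rewrite size_rev !size_fam // => i lti.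
rewrite nth_rev size_fam // (nth_fam _ (Ordinal lti)).
by rewrite /= -(nth_fam f).
Qed.

Lemma map_fam n (f : 'I_n -> X) (h : X -> Y) : map h (fam f) = fam (h \o f).
Proof. by rewrite /fam -map_comp. Qed.

Lemma mkseq_fam n (f : nat -> X) : mkseq f n = fam (fun i : 'I_n => f i).
Proof. by rewrite /mkseq /fam -val_enum_ord -map_comp. Qed.

Lemma basis_rev V n (f : 'I_n -> X) : basis V (fam f) -> basis V (fam (f \o @rev_ord n)).
Proof.
move=> /basis_famP [sp ind]; apply/basis_famP.
have comb (c : 'I_n -> R) : \sum_i c i *: (f \o @rev_ord n) i = \sum_i c (rev_ord i) *: f i.
  by rewrite (reindex_inj rev_ord_inj); apply: eq_bigr => i _ /=; rewrite rev_ordK.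
split.
- move=> v; rewrite sp; split=> [[c ->]|[c ->]].
    exists (fun i => c (rev_ord i)); rewrite comb.
    by apply: eq_bigr => i _; rewrite rev_ordK.
  by exists (fun i => c (rev_ord i)); rewrite comb.
- by move=> c; rewrite comb => /ind h i; rewrite -[i]rev_ordK h.
Qed.

(** For a dual system of functionals; evaluation at this form reads off the coefficient of a
    multiple of the wedge. *)
Lemma wedge_neq0 n (x : 'I_n -> X) (l : 'I_n -> X -> R) :
  (forall i a u v, l i (a *: u + v) = a * l i u + l i v) ->
  (forall i k, l k (x i) = (i == k)%:R) -> exists alpha : altform X, alpha (fam x) = 1.
Proof.
move=> ll lx; have [alpha aE] := gram_altform ll; exists alpha; rewrite aE.
by rewrite -[RHS](det1 R n); congr (\det _); apply/matrixP => i k; rewrite !mxE lx.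
Qed.

End Families.

Lemma tensorZ {R : realType} {Z X : lmodType R} (a b : R) (u : exterior Z) (v : exterior X) :
  tensor (a *: u) (b *: v) = (a * b) *: tensor u v.
Proof. by apply/funext => p; rewrite /tensor /= mulrACA. Qed.

Section DetLine.
Context {R : realType} {E F : completeNormedModType R} (ipF : F -> F -> R).
Hypothesis hip : inner_product ipF.
Variable j : {linear E -> F}.
Hypothesis j_inj : injective j.
Implicit Types D T : {linear E -> F}.

Lemma det_gen_change n (x x' : 'I_n -> E) (y y' : 'I_n -> F -> R^o) (P Q : 'M[R]_n) :
  (forall i, x' i = \sum_k P i k *: x k) -> (forall i, y' i = \sum_k Q i k *: y k) ->
  det_gen (fam y') (fam x') = (\det Q * \det P) *: det_gen (fam y) (fam x).
Proof.
by move=> xE yE; rewrite /det_gen (wedge_rev_matrix yE) (wedge_matrix xE) tensorZ.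
Qed.

Lemma dualF_sum n (c : 'I_n -> R) (x : 'I_n -> E) :
  dualF ipF j (\sum_i c i *: x i) = \sum_i c i *: dualF ipF j (x i).
Proof.
apply/funext => y; rewrite /dualF (form_suml hip) fct_sumE; apply: eq_bigr => i _.
by [].
Qed.

Variable D : {linear E -> F}.
Hypothesis D_sym : symmetric ipF j D.
Hypothesis D_index0 : index_zero D.

(** [annihilator_range] shows that these functionals span; a vanishing combination is tested on the
    vector that represents it. *)
Lemma ker_adj_basis n (x : 'I_n -> E) : basis (ker D) (fam x) ->
  basis (ker_adj D) (fam (dualF ipF j \o x)).
Proof.
move=> bx; have [Phi cPhi] := index_zero_cokernel bx D_index0.
apply/basis_famP; split.
- move=> f; split=> [[flin fcont fD]|[c ->]].
    have [c cE] := annihilator_range hip j_inj D_sym bx cPhi flin fD.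
    exists c; rewrite -dualF_sum; apply/funext => y; exact: cE.
  rewrite -dualF_sum; split.
  + by move=> a u v; rewrite /dualF (ipDr hip) (ipZr hip).
  + move=> y; rewrite /dualF; set z := j _.
    have lin : linear (ipF z : F -> R^o) by move=> a u v; rewrite (ipDr hip) (ipZr hip).
    pose l : {linear F -> R^o} := HB.pack (ipF z : F -> R^o) (GRing.isLinear.Build _ _ _ _ _ lin).
    have lb : bounded_near l (nbhs (0 : F)).
      apply/linear_boundedP; exists `|z|; split; first exact: num_real.
      move=> r /ltW zr u; apply: (le_trans (cauchy_schwarz hip z u)).
      by rewrite ler_wpM2r.
    exact: (bounded_linear_continuous lb).
  + move=> u; rewrite /dualF (ipC hip) (form_sumr hip) big1 // => i _.
    by rewrite (range_perp_ker hip D_sym bx) mulr0.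
- move=> c h; have [_ ind] := (basis_famP _ _).1 bx; apply: ind.
  apply: j_inj; rewrite linear0; apply: (ip_eq0 hip).
  have h' : dualF ipF j (\sum_i c i *: x i) = 0 by rewrite dualF_sum.
  exact: (congr1 (fun f => f (j (\sum_i c i *: x i))) h').
Qed.

(** Changing the basis of ker D by P changes both tensor factors by det P, so the generator changes
    by a positive square and its half-line is well defined. *)
Lemma det_line_orientation n (x : 'I_n -> E) (S : set R) vs : basis (ker D) (fam x) ->
  (forall i k, ipF (j (x i)) (j (x k)) = (i == k)%:R) ->
  basis (eigen_sum j S D) vs ->
  line_orientation (det_line D) (canonical_orientation ipF j S D).
Proof.
move=> bx xo bvs.
have by_ := ker_adj_basis bx; have br := basis_rev by_.
pose w0 := (-1) ^+ size vs *: det_gen (fam (dualF ipF j \o x)) (fam x).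
have sgn : (-1) ^+ size vs * (-1) ^+ size vs = 1 :> R by rewrite -expr2 sqrr_sign.
exists w0; split.
- have [|i k|al alE] := @wedge_neq0 _ _ _ ((dualF ipF j \o x) \o @rev_ord n) (fun k (f : F -> R^o) => f (j (x (rev_ord k)))).
  + by [].
  + by rewrite /= /dualF xo (inj_eq rev_ord_inj).
  have [|i k|be beE] := @wedge_neq0 _ _ _ x (fun k u => ipF (j u) (j (x k))).
  + by move=> i a u v; rewrite linearP (ip_linear hip).
  + by rewrite xo.
  move=> /(congr1 (fun w => w (al, be))).
  rewrite /w0 /det_gen /tensor /wedge /= rev_fam.
  rewrite -[LHS]/((-1) ^+ size vs * (al (fam ((dualF ipF j \o x) \o @rev_ord n)) * be (fam x))).
  rewrite alE beE !mulr1 => /eqP; apply/negP.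
  by rewrite signr_eq0.
- apply/seteqP; split => w.
    move=> [a [b [[ys [c [bys ->]]] [xs [d [bxs ->]]] ->]]].
    have [y yE] := basis_fam bys (etrans (basis_size bys br) (size_fam _)).
    have [x' xE] := basis_fam bxs (etrans (basis_size bxs bx) (size_fam _)).
    rewrite yE in bys *; rewrite xE in bxs *.
    have [Q _ QE] := basis_change br bys; have [P _ PE] := basis_change bx bxs.
    rewrite (wedge_matrix QE) (wedge_matrix PE) !scalerA tensorZ.
    exists (c * \det Q * (d * \det P) * (-1) ^+ size vs).
    by rewrite /w0 scalerA -mulrA sgn mulr1 /det_gen rev_fam.
  move=> [c ->]; exists ((c * (-1) ^+ size vs) *: wedge (fam ((dualF ipF j \o x) \o @rev_ord n))), (1 *: wedge (fam x)); split.
  + by exists (fam ((dualF ipF j \o x) \o @rev_ord n)), (c * (-1) ^+ size vs).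
  + by exists (fam x), 1.
  + by rewrite tensorZ mulr1 /w0 scalerA /det_gen rev_fam.
- apply/seteqP; split => w.
    move=> [c [xs [vs' [c0 bxs bvs' ->]]]].
    have [x' xE] := basis_fam bxs (etrans (basis_size bxs bx) (size_fam _)).
    rewrite xE in bxs *; have [P P0 PE] := basis_change bx bxs.
    have dE i : (dualF ipF j \o x') i = \sum_k P i k *: (dualF ipF j \o x) k.
      by rewrite /= PE dualF_sum.
    exists (c * \det P ^+ 2); first by rewrite mulr_gt0 // lt_def sqrf_eq0 P0 sqr_ge0.
    rewrite map_fam (det_gen_change PE dE) scalerA /w0 scalerA (basis_size bvs' bvs).
    by congr (_ *: _); ring.
  move=> [c c0 ->]; exists c, (fam x), vs; split => //.
  by rewrite map_fam /w0 scalerA.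
Qed.

End DetLine.

(** * The isomorphisms iota *)

Section Iota.
Context {R : realType} {E F : completeNormedModType R}.
Variables (k q : nat) (Phi : {linear 'rV[R]_(k + q) -> F}) (D : {linear E -> F}).

Definition iota_family (x : 'I_k -> E) (xi : 'I_q -> E) (zeta : 'I_(k + q) -> 'rV[R]_(k + q))
    (i : 'I_(k + q)) : (E * 'rV[R]_(k + q))%type :=
  match fintype.split i with inl a => (x a, 0) | inr b => (xi b, zeta (rshift k b)) end.

(** The scalar of iota for l = k, as index zero forces. *)
Definition iota_coef (y : 'I_k -> F -> R^o) (zeta : 'I_(k + q) -> 'rV[R]_(k + q)) : R :=
  (-1) ^+ (k * k) * (\det (\matrix_(i, p) (y p (Phi (zeta (lshift q i))) : R)) /
                     \det (\matrix_(i, p) zeta i 0 p)).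

Lemma iota_list (x : 'I_k -> E) (xi : 'I_q -> E) zeta :
  [seq (u, 0 : 'rV[R]_(k + q)) | u <- fam x] ++ zip (fam xi) (drop k (fam zeta)) =
  fam (iota_family x xi zeta).
Proof.
have sz : size (fam xi) = size (drop k (fam zeta)).
  by rewrite size_drop !size_fam addKn.
apply: (@eq_from_nth _ 0).
  by rewrite size_cat size_map size_zip -sz minnn !size_fam.
move=> i; rewrite size_cat size_map size_zip -sz minnn !size_fam => lti.
rewrite (nth_fam _ (Ordinal lti)) /iota_family nth_cat size_map size_fam.
case: splitP => [a /= ia|b /= ib].
  rewrite ia ltn_ord (nth_map 0) ?size_fam //; congr (_, _).
  exact: nth_fam.
rewrite ib ltnNge leq_addr /= addKn -[0]/((0 : E), (0 : 'rV[R]_(k + q))) nth_zip //.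
rewrite nth_fam nth_drop; congr (_, _).
exact: (nth_fam zeta (rshift k b)).
Qed.

Hypothesis ker_dim : forall s, basis (ker D) s -> size s = k.
Hypothesis ker_adj_dim : forall s, basis (ker_adj D) s -> size s = k.

Lemma iota_graph_families w h : iota_graph Phi D w h <->
  exists (x : 'I_k -> E) (y : 'I_k -> F -> R^o) (zeta : 'I_(k + q) -> 'rV[R]_(k + q))
    (xi : 'I_q -> E) (c : R),
  [/\ basis (ker D) (fam x), basis (ker_adj D) (fam y), basis setT (fam zeta),
      forall i, D (xi i) + Phi (zeta (rshift k i)) = 0 &
      w = c *: det_gen (fam y) (fam x) /\
      h = (c * iota_coef y zeta) *: wedge (fam (iota_family x xi zeta))].
Proof.
have coefE (y : 'I_k -> F -> R^o) (zeta : 'I_(k + q) -> 'rV[R]_(k + q)) :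
    (-1) ^+ (k * k) * (\det (\matrix_(i < k, p < k) ((fam y)`_p (Phi (fam zeta)`_i) : R)) /
       \det (\matrix_(i < k + q, p < k + q) (fam zeta)`_i 0 p)) = iota_coef y zeta.
  rewrite /iota_coef; congr (_ * (_ / _)); congr (\det _);
    apply/matrixP => i p; rewrite !mxE.
    by rewrite nth_fam (nth_fam zeta (lshift q i)).
  by rewrite nth_fam.
split.
- move=> [xs [ys [zs [xis [c /= [bx by_ [bz sz] [sxi Dxi] [wE hE]]]]]]].
  have sx := ker_dim bx; have sy := ker_adj_dim by_.
  have [x xE] := basis_fam bx sx; have [y yE] := basis_fam by_ sy.
  have [zeta zE] := basis_fam bz sz.
  have sxi' : size xis = q by rewrite sxi sy addKn.
  have [xi xiE] : exists xi : 'I_q -> E, xis = fam xi.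
    by rewrite -sxi'; exists (fun i => xis`_i); rewrite fam_nth.
  exists x, y, zeta, xi, c; split.
  + by rewrite -xE.
  + by rewrite -yE.
  + by rewrite -zE.
  + move=> i; have := Dxi i; rewrite sy addKn ltn_ord => /(_ isT).
    by rewrite zE (nth_fam zeta (rshift k i)) xiE nth_fam.
  + split; first by rewrite wE xE yE.
    by rewrite hE sx sy xE yE zE xiE iota_list coefE.
- move=> [x [y [zeta [xi [c [bx by_ bz Dxi [wE hE]]]]]]].
  exists (fam x), (fam y), (fam zeta), (fam xi), c => /=; split => //.
  + by split => //; rewrite size_fam.
  + rewrite !size_fam addKn; split => // i lti.
    by rewrite (nth_fam _ (Ordinal lti)) (nth_fam zeta (rshift k (Ordinal lti))) Dxi.
  + by split => //; rewrite hE !size_fam iota_list coefE.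
Qed.

End Iota.

(** * Image of the canonical orientation under iota *)

Section Fiber.
Context {R : realType} {E F : completeNormedModType R} (ipF : F -> F -> R).
Hypothesis hip : inner_product ipF.
Variable j : {linear E -> F}.
Hypothesis j_inj : injective j.

Definition pairing_matrix N (Phi : {linear 'rV[R]_N -> F}) (X : 'I_N -> E) : 'M[R]_N :=
  \matrix_(a, p) ipF (j (X a)) (Phi (delta_mx 0 p)).

Section Core.
Variables (k q : nat) (Phi : {linear 'rV[R]_(k + q) -> F}) (D : {linear E -> F}).
Variables (e X0 : 'I_(k + q) -> E) (s : 'I_(k + q) -> E * 'rV[R]_(k + q)).
Hypothesis D_sym : symmetric ipF j D.
Hypothesis D_index0 : index_zero D.
Variable x0 : 'I_k -> E.
Hypothesis bx0 : basis (ker D) (fam x0).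
Hypothesis bs : basis (ker (stab D Phi)) (fam s).
Hypothesis se : forall a b, ipF (j (s a).1) (j (e b)) = (a == b)%:R.
Hypothesis X0e : forall a b, ipF (j (X0 a)) (j (e b)) = (a == b)%:R.
Hypothesis DX0 : forall a u, (forall b, ipF (j u) (j (e b)) = 0) -> ipF (D (X0 a)) (j u) = 0.
Hypothesis kerX0 : forall x, D x = 0 -> x = \sum_a ipF (j x) (j (e a)) *: X0 a.

Let frame_pairing := pairing_matrix Phi X0.
Hypothesis G0 : \det frame_pairing != 0.
Variables (eps : R) (m : nat).
Hypothesis eps_sign : 0 < (-1) ^+ (k + q + m) * (eps * \det frame_pairing).
Variables (S : set R) (vs : seq E).
Hypothesis bvs : basis (eigen_sum j S D) vs.
Hypothesis gram_sign : forall w : 'I_q -> E, reduced_family ipF j D e X0 w ->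
  \det (gram ipF j D w) != 0 -> 0 < (-1) ^+ (size vs + m) * \det (gram ipF j D w).

Let eps0 : eps != 0.
Proof.
apply/eqP => e0; move: eps_sign; rewrite e0 mul0r mulr0 ltxx.
by [].
Qed.

Lemma split_lshift a : fintype.split (lshift q a : 'I_(k + q)) = inl a.
Proof. exact: (unsplitK (inl a)). Qed.

Lemma split_rshift b : fintype.split (rshift k b : 'I_(k + q)) = inr b.
Proof. exact: (unsplitK (inr b)). Qed.

Lemma big_split_shift (V : nmodType) (f : 'I_(k + q) -> V) :
  \sum_i f i = \sum_(a < k) f (lshift q a) + \sum_(b < q) f (rshift k b).
Proof. exact: big_split_ord. Qed.

(* Comparing C G Z^T with its block form
   / (<j x_i, Phi zeta_p>)        0        \
   \          *            -gram of the w  /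
   expresses the coefficient of iota through the sign of the gram matrix. *)
Lemma iota_sign (x : 'I_k -> E) (zeta : 'I_(k + q) -> 'rV[R]_(k + q)) (xi : 'I_q -> E) :
  basis (ker D) (fam x) -> basis setT (fam zeta) ->
  (forall i, D (xi i) + Phi (zeta (rshift k i)) = 0) ->
  exists2 t : R, 0 < t &
    iota_coef Phi (dualF ipF j \o x) zeta *: wedge (fam (iota_family x xi zeta)) =
    (t * (-1) ^+ size vs * eps) *: wedge (fam s).
Proof.
move=> bx bz Dxi; pose v := iota_family x xi zeta.
have vl a : v (lshift q a) = (x a, 0) by rewrite /v /iota_family split_lshift.
have vr b : v (rshift k b) = (xi b, zeta (rshift k b)) by rewrite /v /iota_family split_rshift.
have Dx a : D (x a) = 0 := basis_mem bx a.
have vker i : stab D Phi (v i) = 0.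
  rewrite -[i]splitK; case: (fintype.split i) => a /=; rewrite /stab ?vl ?vr /=; last exact: Dxi.
  by rewrite Dx linear0 addr0.
(* Since the first components of s are dual to e, these are the coordinates of v in the frame s. *)
pose C : 'M[R]_(k + q) := \matrix_(i, a) ipF (j (v i).1) (j (e a)).
have [sps _] := (basis_famP _ _).1 bs.
have fstsum (c : 'I_(k + q) -> R) (f : 'I_(k + q) -> E * 'rV[R]_(k + q)) :
    (\sum_a c a *: f a).1 = \sum_a c a *: (f a).1.
  by rewrite (big_morph (fun u => u.1) (id1 := 0) (op1 := +%R)).
have vC i : v i = \sum_a C i a *: s a.
  have /sps [c vE] := vker i; rewrite [LHS]vE; apply: eq_bigr => a _; congr (_ *: _).
  rewrite mxE vE fstsum (form_suml hip) (bigD1 a) //= se eqxx mulr1 big1 ?addr0 // => b ba.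
  by rewrite se (negbTE ba) mulr0.
have wE := wedge_matrix vC.
have v_ind : independent v.
  move=> c; rewrite big_split_shift => h.
  have [_ zind] := (basis_famP _ _).1 bz; have [_ xind] := (basis_famP _ _).1 bx.
  have h2 : \sum_(b < q) c (rshift k b) *: zeta (rshift k b) = 0.
    have := congr1 (fun u => u.2) h => /=.
    rewrite !(big_morph (fun u => u.2) (id1 := 0) (op1 := +%R)) // big1 ?add0r => [e2|a _].
      by rewrite -[RHS]e2; apply: eq_bigr => b _; rewrite vr.
    by rewrite vl /= scaler0.
  have cr b : c (rshift k b) = 0.
    have := zind (fun i => match fintype.split i with inl _ => 0 | inr b => c (rshift k b) end).
    move=> /(_ _ (rshift k b)); rewrite split_rshift; apply.
    rewrite big_split_shift big1 ?add0r => [|a _]; last by rewrite split_lshift scale0r.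
    by rewrite -[RHS]h2; apply: eq_bigr => b' _; rewrite split_rshift.
  have cl a : c (lshift q a) = 0.
    apply: (xind (fun a => c (lshift q a))).
    have h1 : \sum_(b < q) c (rshift k b) *: v (rshift k b) = 0.
      by rewrite big1 // => b _; rewrite cr scale0r.
    have := congr1 (fun u => u.1) h; rewrite h1 addr0 /=.
    rewrite (big_morph (fun u => u.1) (id1 := 0) (op1 := +%R)) // => e1; rewrite -[RHS]e1.
    by apply: eq_bigr => b _; rewrite vl.
  by move=> i; rewrite -[i]splitK; case: (fintype.split i) => a /=.
have C0 : \det C != 0 := independent_det vC v_ind.
have Cu : C \in unitmx by rewrite unitmxE unitfE.
(* The same coordinates used with X0. On the kernel part w equals x; on the rest it differs from xi
   by a vector orthogonal to the e, which does not change pairings with D w. *)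
pose w i := \sum_a C i a *: X0 a.
have we i b : ipF (j (w i)) (j (e b)) = C i b.
  rewrite (form_suml hip) (bigD1 b) //= X0e eqxx mulr1 big1 ?addr0 // => a ab.
  by rewrite X0e (negbTE ab) mulr0.
have wl a : w (lshift q a) = x a.
  by rewrite [RHS]kerX0 //; apply: eq_bigr => b _; rewrite mxE vl.
have Dw i u : (forall b, ipF (j u) (j (e b)) = 0) -> ipF (D (w i)) (j u) = 0.
  by move=> ue; rewrite (form_suml hip) big1 // => a _; rewrite DX0 ?mulr0.
pose wr b := w (rshift k b).
pose Z : 'M[R]_(k + q) := \matrix_(i, p) zeta i 0 p.
pose M : 'M[R]_k := \matrix_(i, p) dualF ipF j (x p) (Phi (zeta (lshift q i))).
have Z0 : \det Z != 0.
  have [_ zind] := (basis_famP _ _).1 bz.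
  apply: (@independent_det _ _ _ (fun i => delta_mx 0 i) zeta) => // i.
  by rewrite [LHS]row_sum_delta; apply: eq_bigr => a _; rewrite mxE.
have prodE i p : (C *m frame_pairing *m Z^T) i p = ipF (j (w i)) (Phi (zeta p)).
  rewrite (row_sum Phi) (ip_sumr hip) mxE; apply: eq_bigr => l _.
  rewrite (ipZr hip) (form_suml hip) !mxE mulrC; congr (_ * _).
  by apply: eq_bigr => a _; rewrite !mxE.
have Phir b : Phi (zeta (rshift k b)) = - D (xi b).
  by apply/eqP; rewrite -addr_eq0 addrC Dxi.
have blockE : C *m frame_pairing *m Z^T =
    block_mx M^T 0 (\matrix_(i, p) ipF (j (wr i)) (Phi (zeta (lshift q p)))) (- gram ipF j D wr).
  apply/matrixP => i p; rewrite prodE.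
  rewrite -[i]splitK -[p]splitK; case: (fintype.split i) => a; case: (fintype.split p) => b /=.
  - by rewrite block_mxEul !mxE wl.
  - by rewrite block_mxEur mxE wl Phir (ipNr hip) -D_sym Dx (ip0l hip) oppr0.
  - by rewrite block_mxEdl mxE.
  - rewrite block_mxEdr Phir (ipNr hip) !mxE -D_sym; congr (- _).
    apply/eqP; rewrite -subr_eq0 -(ipBr hip) -linearB; apply/eqP; apply: Dw => c.
    by rewrite linearB (ipBl hip) we mxE vr subrr.
have detE : \det C * \det frame_pairing * \det Z = \det M * ((-1) ^+ q * \det (gram ipF j D wr)).
  have := congr1 (@determinant _ _) blockE.
  by rewrite !det_mulmx det_tr det_lblock det_tr -scaleN1r detZ.
have B0 : \det (gram ipF j D wr) != 0.
  apply/eqP => b0; move/eqP: detE; rewrite b0 !mulr0 !mulf_eq0.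
  by rewrite (negbTE C0) (negbTE G0) (negbTE Z0).
have M0 : \det M != 0.
  apply/eqP => m0; move/eqP: detE; rewrite m0 mul0r !mulf_eq0.
  by rewrite (negbTE C0) (negbTE G0) (negbTE Z0).
have rf : reduced_family ipF j D e X0 wr.
  split => //.
  - by exists (fam x); rewrite // size_fam.
  - by move=> i u; exact: Dw.
  move=> a; exists (fun b => invmx C a (rshift k b)), (\sum_b invmx C a (lshift q b) *: x b).
  split; first by rewrite linear_sum big1 // => b _; rewrite linearZ /= Dx scaler0.
  have -> : X0 a = \sum_i invmx C a i *: w i.
    rewrite /w; under eq_bigr do rewrite scaler_sumr.
    rewrite exchange_big (bigD1 a) //= [X in _ + X]big1 ?addr0 => [|b ba].
      under eq_bigr do rewrite scalerA.
      rewrite -scaler_suml; have /matrixP/(_ a a) := mulVmx Cu.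
      by rewrite !mxE eqxx => ->; rewrite scale1r.
    under eq_bigr do rewrite scalerA.
    rewrite -scaler_suml; have /matrixP/(_ a b) := mulVmx Cu.
    by rewrite !mxE eq_sym (negbTE ba) => ->; rewrite scale0r.
  rewrite big_split_shift addrC; congr (_ + _).
  by apply: eq_bigr => b _; rewrite wl.
have gs := gram_sign rf B0.
rewrite wE scalerA -/v.
(* The square of det M / det Z times the quotient of the two quantities known to be positive, [gs]
   and [eps_sign]. *)
pose t := \det M ^+ 2 / \det Z ^+ 2 * ((-1) ^+ (size vs + m) * \det (gram ipF j D wr)) /
  ((-1) ^+ (k + q + m) * (eps * \det frame_pairing)).
exists t.
  rewrite divr_gt0 // mulr_gt0 // divr_gt0 // lt_def sqr_ge0 sqrf_eq0 ?M0 ?Z0 //.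
congr (_ *: _); rewrite /iota_coef -/M -/Z.
have CE : \det C = \det M * ((-1) ^+ q * \det (gram ipF j D wr)) / (\det frame_pairing * \det Z).
  by rewrite -detE; field; rewrite G0 Z0.
rewrite CE /t; have sq (i : nat) : (-1) ^+ i * (-1) ^+ i = 1 :> R by rewrite -expr2 sqrr_sign.
have sk : (-1) ^+ (k * k) = (-1) ^+ k :> R.
  by rewrite -signr_odd -[RHS]signr_odd oddM andbb.
rewrite sk !exprD.
have inv (i : nat) : ((-1) ^+ i)^-1 = (-1) ^+ i :> R by rewrite invr_sign.
set a := (-1) ^+ k; set b := (-1) ^+ q; set c := (-1) ^+ m; set d := (-1) ^+ size vs.
have c1 : c * c = 1 := sq m; have d1 : d * d = 1 := sq (size vs).
have iE : (a * b * c * (eps * \det frame_pairing))^-1 = a * b * c / (eps * \det frame_pairing).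
  by rewrite !invfM !inv.
rewrite iE.
transitivity (d * d * (c * c) * (a * (\det M / \det Z) *
  (\det M * (b * \det (gram ipF j D wr)) / (\det frame_pairing * \det Z)))).
  by rewrite c1 d1 !mul1r.
by field; rewrite G0 Z0 eps0.
Qed.

(** The vectors (x, 0) are completed to a basis of ker (D (+) Phi); the second components of the new
    vectors are independent and are completed to a basis of the space of zeta. *)
Lemma iota_data_exists (x : 'I_k -> E) : basis (ker D) (fam x) ->
  exists (zeta : 'I_(k + q) -> 'rV[R]_(k + q)) (xi : 'I_q -> E),
    basis setT (fam zeta) /\ forall i, D (xi i) + Phi (zeta (rshift k i)) = 0.
Proof.
move=> bx; have [sps sind] := (basis_famP _ _).1 bs.
have [_ xind] := (basis_famP _ _).1 bx.
have [A AE] : exists A : 'M[R]_(k, k + q), forall a, (x a, 0) = \sum_i A a i *: s i.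
  apply: matrix_of_family => a; apply/sps.
  by rewrite /ker /= /stab /= linear0 addr0; exact: (basis_mem bx).
have fA : row_free A.
  rewrite -kermx_eq0; apply/rowV0P => v /sub_kermxP vA; apply/rowP => a; rewrite mxE.
  apply: (xind (fun a => v 0 a)).
  have : \sum_a v 0 a *: (x a, 0 : 'rV[R]_(k + q)) = 0.
    under eq_bigr do rewrite AE scaler_sumr.
    rewrite exchange_big big1 // => i _ /=; under eq_bigr do rewrite scalerA.
    by rewrite -scaler_suml; have /rowP/(_ i) := vA; rewrite !mxE => ->; rewrite scale0r.
  move=> /(congr1 (fun u => u.1)) /=.
  by rewrite (big_morph (fun u => u.1) (id1 := 0) (op1 := +%R)).
have [B ABu] := complete_rows fA.
pose r b := \sum_i B b i *: s i.
pose Zq : 'M[R]_(q, k + q) := \matrix_(b, p) (r b).2 0 p.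
have Dr b : D (r b).1 + Phi (r b).2 = 0.
  by apply/sps; exists (fun i => B b i).
(* A combination of the new vectors with zero second component lies in ker D times 0, hence is a
   combination of the (x, 0); invertibility of A stacked on B makes it trivial. *)
have fZ : row_free Zq.
  rewrite -kermx_eq0; apply/rowV0P => v /sub_kermxP vZ.
  pose u := \sum_b v 0 b *: r b.
  have u2 : u.2 = 0.
    apply/rowP => p; rewrite /u (big_morph (fun u => u.2) (id1 := 0) (op1 := +%R)) // mxE.
    rewrite summxE; have /rowP/(_ p) := vZ; rewrite !mxE => vZp; rewrite -[RHS]vZp.
    by apply: eq_bigr => b _; rewrite !mxE.
  have uk : stab D Phi u = 0.
    apply/sps; exists (fun i => (v *m B) 0 i).
    rewrite /u /r; under eq_bigr do rewrite scaler_sumr.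
    rewrite exchange_big; apply: eq_bigr => i _ /=; under eq_bigr do rewrite scalerA.
    by rewrite -scaler_suml mxE.
  have Du : D u.1 = 0 by move: uk; rewrite /stab u2 linear0 addr0.
  have [spx _] := (basis_famP _ _).1 bx.
  have /spx [c uE] : ker D u.1 by [].
  have uE' : u = \sum_a c a *: (x a, 0).
    rewrite [LHS]surjective_pairing u2 uE [RHS]surjective_pairing.
    rewrite !(big_morph (fun u => u.1) (id1 := 0) (op1 := +%R)) //.
    rewrite !(big_morph (fun u => u.2) (id1 := 0) (op1 := +%R)) //=.
    by congr (_, _); rewrite big1 // => a _ /=; rewrite scaler0.
  have vB : row_mx (- \row_a c a) v *m col_mx A B = 0.
    rewrite mul_row_col mulNmx; apply/rowP => i; rewrite mxE [RHS]mxE.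
    have := sind (fun i => (- ((\row_a c a) *m A) + v *m B) 0 i).
    move=> /(_ _ i); rewrite mxE; apply.
    transitivity (u - u); last by rewrite subrr.
    rewrite {1}/u uE' /r; under [X in _ = X - _]eq_bigr do rewrite scaler_sumr.
    under [X in _ = _ - X]eq_bigr do rewrite AE scaler_sumr.
    rewrite exchange_big [X in _ = _ - X]exchange_big -sumrB; apply: eq_bigr => l _ /=.
    under [X in _ = X - _]eq_bigr do rewrite scalerA.
    under [X in _ = _ - X]eq_bigr do rewrite scalerA.
    rewrite -!scaler_suml -scalerBl; congr (_ *: _); rewrite !mxE addrC; congr (_ - _).
    by apply: eq_bigr => a _; rewrite mxE.
  have : row_mx (- \row_a c a) v = 0.
    by rewrite -[LHS](mulmxK ABu) vB mul0mx.
  by rewrite -row_mx0 => /eq_row_mx [_ ->].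
have [B' ZB] := complete_rows' fZ.
pose W : 'M[R]_(k + q) := col_mx B' Zq.
exists (fun i => row i W), (fun b => (r b).1); split.
  apply/basis_famP; split.
    move=> z; split=> // _; exists (fun i => (z *m invmx W) 0 i).
    by rewrite -{1}[z](mulmxKV ZB) mulmx_sum_row.
  move=> c h i; have : (\row_i c i) *m W = 0.
    by rewrite mulmx_sum_row -[RHS]h; apply: eq_bigr => a _; rewrite mxE.
  move=> /(congr1 (mulmx^~ (invmx W))); rewrite mulmxK // mul0mx => /rowP/(_ i).
  by rewrite !mxE.
move=> b; have -> : row (rshift k b) W = (r b).2.
  by rewrite /W; apply/rowP => p; rewrite mxE col_mxEd mxE.
exact: Dr.
Qed.

Lemma fiber_orientation : canonical_orientation ipF j S D =
  [set w | exists2 c : R, 0 < c & iota_graph Phi D w ((c * eps) *: wedge (fam s))].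
Proof.
have kd t : basis (ker D) t -> size t = k by move=> /(basis_size bx0) <-; rewrite size_fam.
have kad t : basis (ker_adj D) t -> size t = k.
  by move=> /(basis_size (ker_adj_basis hip j_inj D_sym D_index0 bx0)) <-; rewrite size_fam.
have sgn : (-1) ^+ size vs * (-1) ^+ size vs = 1 :> R by rewrite -expr2 sqrr_sign.
apply/seteqP; split => w.
- move=> [c [xs [vs' [c0 bxs bvs' ->]]]].
  rewrite (basis_size bvs' bvs).
  have [x xE] := basis_fam bxs (kd _ bxs); rewrite xE in bxs *.
  have [zeta [xi [bz Dxi]]] := iota_data_exists bxs.
  have [t t0 tE] := iota_sign bxs bz Dxi.
  exists (c * t); first by rewrite mulr_gt0.
  apply/(iota_graph_families _ kd kad).
  exists x, (dualF ipF j \o x), zeta, xi, (c * (-1) ^+ size vs); split => //.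
    exact: ker_adj_basis.
  split; first by rewrite map_fam.
  rewrite -[RHS]scalerA tE scalerA; congr (_ *: _).
  by transitivity ((-1) ^+ size vs * (-1) ^+ size vs * (c * t * eps)); [rewrite sgn mul1r|ring].
- move=> [c c0 /(iota_graph_families _ kd kad)].
  move=> [x [y [zeta [xi [b [bx by_ bz Dxi [wE hE]]]]]]].
  have byx := ker_adj_basis hip j_inj D_sym D_index0 bx.
  (* det Q enters both w and the scalar of iota, which reduces an arbitrary basis y to the dual of
     x. *)
  have [Q Q0 QE] := basis_change byx by_.
  have [t t0 tE] := iota_sign bx bz Dxi.
  have coefE : iota_coef Phi y zeta = \det Q * iota_coef Phi (dualF ipF j \o x) zeta.
    rewrite /iota_coef (_ : (\matrix_(i, p) (y p _ : R)) =
      (\matrix_(i, p) (dualF ipF j (x p) (Phi (zeta (lshift q i))) : R)) *m Q^T).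
      by rewrite det_mulmx det_tr; ring.
    apply/matrixP => i p; rewrite !mxE QE fct_sumE; apply: eq_bigr => a _.
    by rewrite !mxE mulrC.
  have [|i a|al alE] := @wedge_neq0 _ _ _ s (fun a u => ipF (j u.1) (j (e a))).
  + by move=> i a u v /=; rewrite linearP (ip_linear hip).
  + exact: se.
  have cE : c * eps = b * \det Q * t * (-1) ^+ size vs * eps.
    have hE' : (c * eps) *: wedge (fam s) = (b * \det Q * t * (-1) ^+ size vs * eps) *: wedge (fam s).
      by rewrite hE coefE mulrA -[LHS]scalerA tE scalerA; congr (_ *: _); ring.
    have ev (z : R) (f : exterior (E * 'rV[R]_(k + q))%type) : (z *: f) al = z * f al by [].
    by have := congr1 (fun f => f al) hE'; rewrite !ev /wedge alE !mulr1.
  have {}cE : c = b * \det Q * t * (-1) ^+ size vs by apply: (mulIf eps0).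
  exists (c / t), (fam x), vs; split => //; first by rewrite divr_gt0.
  rewrite wE map_fam (@det_gen_change _ _ _ _ x x (dualF ipF j \o x) y 1%:M Q) //; last first.
    move=> i; rewrite (bigD1 i) //= mxE eqxx scale1r big1 ?addr0 // => a ai.
    by rewrite mxE eq_sym (negbTE ai) scale0r.
  rewrite det1 mulr1 scalerA; congr (_ *: _).
  transitivity (b * \det Q * ((-1) ^+ size vs * (-1) ^+ size vs)); first by rewrite sgn mulr1.
  by rewrite cE; field; rewrite gt_eqF.
Qed.

End Core.
End Fiber.

(** * Orientation of the determinant line bundle *)

Section Orientation.
Context {R : realType} {E F : completeNormedModType R} (ipF : F -> F -> R).
Hypothesis hip : inner_product ipF.
Variable j : {linear E -> F}.
Hypothesis j_inj : injective j.
Hypothesis j_compact : compact_operator j.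
Implicit Types D T : {linear E -> F}.
Variables (A : set {linear E -> F}) (S : set R).
Hypothesis A_fredholm : forall D, A D -> sym_fredholm ipF j D.
Hypothesis A_ker : forall D, A D -> exists k (x : 'I_k -> E), basis (ker D) (fam x) /\
  forall a b, ipF (j (x a)) (j (x b)) = (a == b)%:R.
Hypothesis A_eigen : forall D, A D -> exists vs, basis (eigen_sum j S D) vs.
Hypothesis A_sign : sign_stable ipF j A S.

Lemma op_ball_le T d d' D : d <= d' -> op_ball T d D -> op_ball T d' D.
Proof. by move=> dd DT x; rewrite (le_trans (DT x)) // ler_wpM2r. Qed.

Lemma local_orientation T N (Phi : {linear 'rV[R]_N -> F}) : A T -> coker_iso T Phi ->
  exists (d : R) m s (eps : R),
    [/\ 0 < d, kernel_frame Phi T d m s, eps <> 0 &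
        forall D, A D -> op_ball T d D ->
          canonical_orientation ipF j S D = [set w | exists2 c : R, 0 < c &
            iota_graph Phi D w ((c * eps) *: wedge (mkseq (s^~ D) m))]].
Proof.
move=> AT cPhi; have [[T_cont _ _] T_index0 T_sym] := A_fredholm AT.
have [n [e [e_ker e_orth]]] := A_ker AT.
have nN := cokernel_dim hip j_inj T_sym e_ker T_index0 cPhi; subst n.
have T_range := perp_ker_range hip j_inj T_sym e_ker cPhi.
have Phi_unit := pairing_unit hip j_inj T_sym e_ker cPhi.
have e_unit : \matrix_(i, a) ipF (j (e i)) (j (e a)) \in unitmx.
  rewrite (_ : \matrix_(i, a) _ = 1%:M) ?unitmx1 //.
  by apply/matrixP => a b; rewrite !mxE e_orth.
(* The two reductions: X along the image of Phi for the frame, X0 along the j (e a) for the reduced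
   form. *)
have [d1 [B1 [d10 B10 [X [c XP]]]]] := frame_exists hip j_inj j_compact T_sym T_cont
  e_ker e_orth T_range Phi_unit.
have [d2 [B2 [d20 B20 [X0 [c0 X0P]]]]] := frame_exists hip j_inj j_compact T_sym T_cont
  e_ker e_orth T_range e_unit.
have [d3 d30 sgn] := A_sign AT e_ker.
have [vT bvT] := A_eigen AT.
have TT d : 0 < d -> op_ball T d T.
  by move=> d0 x; rewrite subrr normr0 mulr_ge0 // ltW.
pose G D := pairing_matrix ipF j Phi (X0 D).
(* At T the vectors X0 are the e a, so G T is the transposed pairing matrix of Phi. *)
have GT : \det (G T) != 0.
  have X0T a : X0 T a = e a.
    have [_ _ uniq _ _] := X0P T (TT _ d20).
    rewrite [RHS](uniq (e a) (fun=> 0)) => [|]; last first.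
      by rewrite (basis_mem e_ker) big1 // => i _; rewrite scale0r.
    rewrite (bigD1 a) //= e_orth eqxx scale1r big1 ?addr0 // => b.
    by rewrite e_orth eq_sym => /negbTE ->; rewrite scale0r.
  rewrite (_ : G T = (pairing ipF j e Phi)^T) ?det_tr -?unitfE -?unitmxE //.
  by apply/matrixP => a p; rewrite !mxE X0T (ipC hip).
have [r r0 rP] := det_sign_stable GT.
have [cj cj0 jb] := inclusion_bound j_compact.
pose bPhi := \sum_p `|Phi (delta_mx 0 p)|.
have bPhi0 : 0 <= bPhi by rewrite sumr_ge0.
pose K := cj * B2 * bPhi.
have K0 : 0 <= K by rewrite !mulr_ge0 // ltW.
(* K is a Lipschitz constant for the entries of G, so they stay within r of those of G T and the
   determinant keeps its sign; the added 1 covers K = 0. *)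
pose d4 := r / (K + 1).
have d40 : 0 < d4 by rewrite divr_gt0 // ltr_wpDl.
pose d := Num.min (Num.min d1 d2) (Num.min d3 d4).
have [dd1 dd2 dd3 dd4] : [/\ d <= d1, d <= d2, d <= d3 & d <= d4].
  by split; rewrite /d !ge_min lexx ?orbT.
have d0 : 0 < d by rewrite !lt_min d10 d20 d30 d40.
have Gsign D : op_ball T d D -> 0 < \det (G D) * \det (G T).
  move=> DT; apply: rP => a p; rewrite !mxE -(ipBl hip) -linearB.
  have [_ _ _ _ lip] := X0P T (TT _ d20).
  have [XX _] := lip D d d0 (op_ball_le dd2 DT) DT a.
  rewrite (le_trans (cauchy_schwarz hip _ _)) //.
  have h1 : `|j (X0 D a - X0 T a)| <= cj * (B2 * d).
    by rewrite (le_trans (jb _)) // ler_wpM2l // ltW.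
  have h2 : `|Phi (delta_mx 0 p)| <= bPhi by rewrite /bPhi (bigD1 p) //= lerDl sumr_ge0.
  apply: (le_trans (ler_pM (normr_ge0 _) (normr_ge0 _) h1 h2)).
  have -> : cj * (B2 * d) * bPhi = K * d by rewrite /K; ring.
  apply: (@le_trans _ _ ((K + 1) * d)); first by rewrite ler_wpM2r ?(ltW d0) // lerDl.
  by rewrite mulrC -ler_pdivlMr // ltr_wpDl.
(* D (X D a) is the image under Phi of the coefficients c, whence the minus sign. *)
pose sD D a : E * 'rV[R]_N := (X D a, - \row_p c D a p).
pose s i D : E * 'rV[R]_N := if insub i is Some a then sD D a else 0.
have sE D : mkseq (s^~ D) N = fam (sD D).
  by rewrite mkseq_fam; apply: eq_fam => a; rewrite /s valK.
have Phisum (b : 'I_N -> R) : Phi (\row_i b i) = \sum_i b i *: Phi (delta_mx 0 i).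
  by rewrite (row_sum Phi); apply: eq_bigr => i _; rewrite mxE.
have sbasis D : op_ball T d D -> basis (ker (stab D Phi)) (fam (sD D)).
  move=> DT; have [Xe DX uniq _ _] := XP D (op_ball_le dd1 DT).
  have [Phi_inj _ _] := cPhi.
  have fst_sum (b : 'I_N -> R) : (\sum_a b a *: sD D a).1 = \sum_a b a *: X D a.
    by rewrite (big_morph (fun u => u.1) (id1 := 0) (op1 := +%R)).
  have sk a : stab D Phi (sD D a) = 0.
    by rewrite /stab /sD /= linearN Phisum DX subrr.
  have stab_lin (b : 'I_N -> R) : stab D Phi (\sum_a b a *: sD D a) = 0.
    rewrite /stab (big_morph (fun u => u.1) (id1 := 0) (op1 := +%R)) //.
    rewrite (big_morph (fun u => u.2) (id1 := 0) (op1 := +%R)) // !linear_sum -big_split.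
    rewrite big1 // => a _ /=; rewrite [D (_ *: _)]linearZ [Phi (_ *: _)]linearZ /= -scalerDr.
    by have := sk a; rewrite /stab /= => ->; rewrite scaler0.
  apply/basis_famP; split.
    move=> v; split=> [kv|[b ->]]; last exact: stab_lin.
    exists (fun a => ipF (j v.1) (j (e a))).
    set u := \sum_a _; have v1 : v.1 = u.1.
      rewrite fst_sum; apply: (uniq v.1 (fun i => - v.2 0 i)).
      move/eqP: kv; rewrite /stab addr_eq0 => /eqP ->; rewrite (row_sum Phi) -sumrN.
      by apply: eq_bigr => i _; rewrite scaleNr.
    rewrite [LHS]surjective_pairing [RHS]surjective_pairing v1; congr (_, _).
    apply: Phi_inj; apply: (addrI (D v.1)); rewrite {2}v1.
    by have := stab_lin (fun a => ipF (j v.1) (j (e a))); rewrite -/u {1}/stab => ->.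
  move=> b h a; have := congr1 (fun v => ipF (j v.1) (j (e a))) h.
  rewrite fst_sum /= linear0 (ip0l hip) (form_suml hip) (bigD1 a) //= Xe eqxx mulr1.
  by rewrite big1 ?addr0 // => i ia; rewrite Xe (negbTE ia) mulr0.
(* The constant depends on T alone: det (G D) has the sign of det (G T), and the part of the sign
   that varies with D is carried by (-1)^(size vD). *)
exists d, N, s, ((-1) ^+ (N + size vT) * \det (G T)); split => //.
- move=> D [Dfr DT]; have [Xe DX uniq surj lip] := XP D (op_ball_le dd1 DT); split.
  + move=> y; have [x [b ->]] := surj y.
    by exists (x, \row_i b i); rewrite /stab /= Phisum.
  + by rewrite sE; exact: sbasis.
  + move=> i iN ep ep0; exists (ep / (2 * (B1 + 1))).
      by rewrite divr_gt0 // mulr_gt0 // ltr_wpDl.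
    move=> D' [_ D'T] D'D; set r' := ep / _ in D'D.
    have r'0 : 0 < r' by rewrite divr_gt0 // mulr_gt0 // ltr_wpDl.
    have [XX cc] := lip D' r' r'0 (op_ball_le dd1 D'T) D'D (Ordinal iN).
    have Br : B1 * r' < ep.
      apply: (@le_lt_trans _ _ ((B1 + 1) * r')); first by rewrite ler_wpM2r ?(ltW r'0) // lerDl.
      have -> : (B1 + 1) * r' = ep / 2 by rewrite /r'; field; rewrite gt_eqF // ltr_wpDl.
      lra.
    rewrite /s insubT /= -[Sub i iN]/(Ordinal iN) prod_normE /= gt_max; apply/andP; split.
      exact: le_lt_trans XX Br.
    rewrite [X in X < _]mx_normrE; apply: bigmax_lt => // -[a p] _ /=.
    by rewrite !mxE opprK addrC distrC; exact: le_lt_trans (cc p) Br.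
- by apply/eqP; rewrite mulf_neq0 // signr_eq0.
move=> D AD DT; rewrite sE.
have [[D_cont _ _] D_index0 D_sym] := A_fredholm AD.
have [Xe DX _ _ _] := XP D (op_ball_le dd1 DT).
have [X0e DX0 uniq0 _ _] := X0P D (op_ball_le dd2 DT).
have [vD bvD] := A_eigen AD.
have [k [x [bx xo]]] := A_ker AD.
have kerX0 y : D y = 0 -> y = \sum_a ipF (j y) (j (e a)) *: X0 D a.
  move=> Dy; apply: (uniq0 y (fun=> 0)); rewrite Dy big1 // => i _.
  by rewrite scale0r.
have kN : (k <= N)%N.
  have [_ ind] := (basis_famP _ _).1 bx.
  have := @independent_le _ _ _ _ x (X0 D) ind; rewrite !card_ord; apply => i.
  by exists (fun a => ipF (j (x i)) (j (e a))); apply: kerX0; exact: (basis_mem bx).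
have DX0p a u : (forall b, ipF (j u) (j (e b)) = 0) -> ipF (D (X0 D a)) (j u) = 0.
  move=> ue; rewrite DX0 (ip_suml hip) big1 // => i _.
  by rewrite (ipZl hip) (ipC hip) ue mulr0.
have Gs := Gsign D DT; have sb := sbasis D DT.
have sgnD := sgn D AD (op_ball_le dd3 DT) vD vT bvD bvT (X0 D).
have G0 : \det (G D) != 0 by apply/eqP => g0; rewrite g0 mul0r ltxx in Gs.
move: (G T) GT Gs => GT' GT0 Gs.
have eps_sign : 0 < (-1) ^+ (N + size vT) * ((-1) ^+ (N + size vT) * \det GT' * \det (G D)).
  by rewrite !mulrA -expr2 sqrr_sign mul1r mulrC.
(* Only facts about D itself are kept, so that N can be replaced by k + q in all types. *)
clear - hip j_inj D_sym D_index0 bx sb Xe X0e DX0p kerX0 G0 eps_sign bvD sgnD kN GT0.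
have [q Nq] : exists q, N = (k + q)%N by exists (N - k)%N; rewrite subnKC.
subst N.
apply: (fiber_orientation hip j_inj D_sym D_index0 bx sb _ X0e DX0p kerX0 G0 eps_sign bvD) => //.
by move=> w rf w0; exact: sgnD.
Qed.

Lemma det_orientation_of_sign : det_orientation A (canonical_orientation ipF j S).
Proof.
split=> [D AD|T AT N Phi cPhi]; last exact: local_orientation.
have [_ D_index0 D_sym] := A_fredholm AD.
have [k [x [bx xo]]] := A_ker AD; have [vs bvs] := A_eigen AD.
exact: (det_line_orientation hip j_inj D_sym D_index0 bx xo bvs).
Qed.

End Orientation.

(** * Operators with spectrum bounded on one side *)

Section SpectralBound.
Context {R : realType} {E F : completeNormedModType R} (ipF : F -> F -> R).
Hypothesis hip : inner_product ipF.
Variable j : {linear E -> F}.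
Hypothesis j_inj : injective j.
Implicit Types D T : {linear E -> F}.

(** A vector y orthogonal to im T defines a functional vanishing there, represented by a vector of
    ker T through [annihilator_range]. *)
Lemma orthocomp_range T : sym_fredholm ipF j T -> orthocomp ipF (range T) = j @` ker T.
Proof.
move=> [[_ [xs bxs] _] T_index0 T_sym].
have [x xE] := basis_fam bxs erefl; rewrite xE in bxs.
have [Phi cPhi] := index_zero_cokernel bxs T_index0.
apply/seteqP; split => [y yP|_ [u uk <-] _ [z _ <-]].
  have [||c cE] := annihilator_range hip j_inj T_sym bxs cPhi (f := ipF y).
  - by move=> a u v; rewrite (ipDr hip) (ipZr hip).
  - by move=> z; rewrite (ipC hip); apply: yP; exists z.
  exists (\sum_a c a *: x a).
    rewrite /ker /= linear_sum big1 // => a _; rewrite linearZ /=.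
    by rewrite (basis_mem bxs) scaler0.
  apply/eqP; rewrite -subr_eq0; apply/eqP; apply: (ip_eq0 hip).
  by rewrite (ipBl hip) -cE subrr.
by rewrite T_sym uk (ip0r hip).
Qed.

Lemma eigen_sum_zero D : eigen_sum j [set 0] D = ker D.
Proof.
apply/seteqP; split => x; rewrite /ker /=.
  move=> [s [c [sS ->]]]; rewrite /lincomb linear_sum big1 // => i _.
  have [mu -> Ds] := sS _ (ltn_ord i).
  by rewrite linearZ /= Ds scale0r scaler0.
move=> Dx; exists [:: x], (fun=> 1); split; last by rewrite /lincomb big_ord1 scale1r.
by case=> // _; exists 0; rewrite //= Dx scale0r.
Qed.

Hypothesis j_compact : compact_operator j.

(** The kernel is the eigenspace sum for S = {0}, so the general eigenvector frame applies. *)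
Lemma orthonormal_kernel_basis D lam : continuous D -> symmetric ipF j D -> ~ spectrum j D lam ->
  exists k (x : 'I_k -> E), basis (ker D) (fam x) /\
    forall a b, ipF (j (x a)) (j (x b)) = (a == b)%:R.
Proof.
move=> D_cont D_sym lam_reg.
have [|k [x [mu [_ _ xo bx]]]] := eigen_frame_exists hip j_inj j_compact D_cont D_sym lam_reg
  (b := `|lam|) (S := [set 0]).
  by move=> mu -> _; rewrite sub0r normrN.
by exists k, x; rewrite -eigen_sum_zero.
Qed.

Lemma sign_stable_sub (A B : set {linear E -> F}) S : A `<=` B ->
  sign_stable ipF j B S -> sign_stable ipF j A S.
Proof.
move=> AB H T AT N e e_ker; have [d d0 dP] := H T (AB _ AT) N e e_ker.
by exists d => // D AD; apply: dP; exact: AB.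
Qed.

Lemma det_orientation_gt r :
  det_orientation (sym_fredholm_gt ipF j r) (canonical_orientation_gt ipF j).
Proof.
(* The counting argument needs a negative bound; lowering r to at most -1 keeps it below all
   spectra. *)
pose lam := Num.min r (-1); have lam0 : lam < 0 by rewrite gt_min oppr_lt0 ltr01 orbT.
have AB : sym_fredholm_gt ipF j r `<=` bounded_below_symmetric ipF j lam.
  move=> D [[[D_cont _ _] _ D_sym] sp]; split => // mu /sp /= rmu.
  by rewrite gt_min rmu.
apply: (det_orientation_of_sign hip j_inj j_compact).
- by move=> D [].
- move=> D /AB [D_cont D_sym D_gt]; apply: (orthonormal_kernel_basis (lam := lam)) => //.
  by move=> /D_gt; rewrite ltxx.
- move=> D /AB [D_cont D_sym D_gt].
  have [n [v [mu [_ _ _ bv]]]] := negative_frame hip j_inj j_compact D_cont D_sym D_gt.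
  by exists (fam v).
- exact: (sign_stable_sub AB (sign_stable_below hip j_inj j_compact lam0)).
Qed.

Lemma det_orientation_lt r :
  det_orientation (sym_fredholm_lt ipF j r) (canonical_orientation_lt ipF j).
Proof.
pose lam := Num.max r 1; have lam0 : 0 < lam by rewrite lt_max ltr01 orbT.
have AB : sym_fredholm_lt ipF j r `<=` bounded_above_symmetric ipF j lam.
  move=> D [[[D_cont _ _] _ D_sym] sp]; split => // mu /sp /= rmu.
  by rewrite lt_max rmu.
apply: (det_orientation_of_sign hip j_inj j_compact).
- by move=> D [].
- move=> D /AB [D_cont D_sym D_lt]; apply: (orthonormal_kernel_basis (lam := lam)) => //.
  by move=> /D_lt; rewrite ltxx.
- move=> D AD; have [[[_ [xs bxs] _] _ _] _] := AD; have BD := AB _ AD.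
  have [_ D_sym _] := BD; have [c s g] := negate_below hip BD.
  have [n [v [mu [_ _ _ bv]]]] := negative_frame hip j_inj j_compact c s g.
  by exists (fam v ++ xs); exact: (eigen_sum_nonneg hip j_inj D_sym bv bxs).
- exact: (sign_stable_sub AB (sign_stable_above hip j_inj j_compact lam0)).
Qed.

End SpectralBound.

Theorem theoremC (R : realType) (E F : completeNormedModType R)
  (ipE : E -> E -> R) (ipF : F -> F -> R)
  (hE : inner_product ipE) (hF : inner_product ipF)
  (j : {linear E -> F}) (j_inj : injective j)
  (j_dense : dense (range j)) (j_compact : compact_operator j)
  (r : R) :
  (forall T : {linear E -> F}, sym_fredholm ipF j T ->
     orthocomp ipF (range T) = j @` ker T) /\
  det_orientation (sym_fredholm_gt ipF j r) (canonical_orientation_gt ipF j) /\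
  det_orientation (sym_fredholm_lt ipF j r) (canonical_orientation_lt ipF j).
Proof.
split; first by move=> T; exact: orthocomp_range.
by split; [exact: det_orientation_gt|exact: det_orientation_lt].
Qed.
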